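(* Let $k$ be a field of characteristic $0$ and let $A$ be an associative unital $k$-algebra. Then the natural map $$\mathrm{SR}(A)_*:\ \mathrm{HS}_*(A)\longrightarrow \mathrm{HR}_*(A,k)$$ from the symmetric homology of $A$ to the one-dimensional representation homology of $A$ is an isomorphism of graded commutative $k$-algebras: $\mathrm{HS}_*(A)\cong \mathrm{HR}_*(A,k)$.
   Context: **Symmetric category.** $\Delta S$ has objects $[n]=\{0,1,\dots,n\}$, $n\ge 0$. A morphism $f:[n]\to[m]$ is an ordered tuple $f=X_0\otimes X_1\otimes\cdots\otimes X_m$ of noncommutative (possibly empty) monomials in formal variables $x_0,\dots,x_n$ such that each variable occurs exactly once in total (equivalently: a map of sets with a total order on each fibre). Composition is substitution: if $g=Y_0\otimes\cdots\otimes Y_l:[m]\to[l]$ in variables $y_0,\dots,y_m$, then $g\circ f$ is obtained by substituting $y_i=X_i$. **Symmetric bar construction and symmetric homology.** For an associative unital $k$-algebra $A$, $B_{\rm sym}A:\Delta S\to \mathrm{Mod}_k$ is the functor $[n]\mapsto A^{\otimes(n+1)}$, where $f=X_0\otimes\cdots\otimes X_m$ sends $a_0\otimes\cdots\otimes a_n$ to the tensor obtained by substituting $x_i=a_i$ (empty monomial $=1_A$). Then $\mathrm{HS}_*(A):=\mathrm{Tor}^{\Delta S}_*(k,B_{\rm sym}A)=H_*(k\otimes^{\boldsymbol L}_{\Delta S}B_{\rm sym}A)$, where $k$ is the constant contravariant functor and $\otimes_{\Delta S}$ is the functor tensor product. For a simplicial algebra $A$, apply $B_{\rm sym}$ degreewise,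 regard the resulting simplicial $\Delta S$-module as a chain complex of $\Delta S$-modules via Dold–Kan, and use hyper-Tor. **Algebra structure on $\mathrm{HS}_*$ (Ault).** Let $\Delta S_+$ be $\Delta S$ with an initial object $[-1]$ adjoined; it is permutative under $[m]\sqcup[n]=[m+n+1]$ (concatenation of tuples), with unit $[-1]$. Extend $B_{\rm sym}A$ to $B_{\rm sym,+}A$ on $\Delta S_+$ by $[-1]\mapsto k$. Put $CA=k[N(-\downarrow\Delta S_+)]\otimes_{\Delta S_+}B_{\rm sym,+}A$, where $N(-\downarrow \Delta S_+)$ is the nerve of the under-category; so $(CA)_p=\bigoplus_{[n_0]\to\cdots\to[n_p]}B_{\rm sym,+}A([n_0])$. One has $\pi_*(CA)\cong\mathrm{HS}_*(A)$, and the product on $\mathrm{HS}_*(A)$ is induced by the simplicial product on $CA$ given by $\sqcup$ of chains and tensor product of coefficients (it is part of an $E_\infty$-structure on $CA$). **Representation homology.** The inclusion of simplicial commutative $k$-algebras into simplicial associative $k$-algebras has left adjoint $R\mapsto R_{\rm ab}=R/(\text{two-sided ideal generated by commutators})$, taken degreewise. Then $\mathrm{HR}_*(A,k):=\pi_*(R_{\rm ab})$, where $R\to A$ is a semi-free simplicial resolution: a weak equivalence of simplicial algebras with each $R_m$ a free (tensor) algebra and the degeneracies preserving generators. It is a graded commutative algebra independent of the choice of $R$. **The map $\mathrm{SR}(A)_*$.** For any algebra $B$ there is a natural isomorphism $k\otimes_{\Delta S}B_{\rm sym}B\cong B_{\rm ab}$, induced by $b_0\otimes\cdots\otimes b_n\mapsto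 b_0\cdots b_n$. For a semi-free simplicial resolution $R\to A$ (so that $B_{\rm sym}R\to B_{\rm sym}A$ is a weak equivalence), $\mathrm{SR}(A)_*$ is the map induced on homology by the canonical map $k\otimes^{\boldsymbol L}_{\Delta S}C(B_{\rm sym}R)\to k\otimes_{\Delta S}C(B_{\rm sym}R)\cong C(R_{\rm ab})$, where $C$ denotes the associated chain complex. *)

(* Defs.v *)
From HB Require Import structures.
#[warning="-notation-overridden,-ambiguous-paths"]
From mathcomp Require Import all_boot all_algebra.
#[warning="-notation-incompatible-prefix"]
From mathcomp Require Import ring_quotient boolp finmap monalg.

Set Implicit Arguments.
Unset Strict Implicit.
Unset Printing Implicit Defensive.
Import GRing.Theory.
Local Open Scope ring_scope.
Local Open Scope quotient_scope.

Section Algebras.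
Variable k : fieldType.

(* Associative unital k-algebras.  MathComp's algType excludes the zero
   algebra, which must be allowed here (and which can arise as a quotient by a
   two-sided ideal); alg_of_algType embeds algType.  *)
Record alg := Alg {
  alg_mod : lmodType k;
  alg_one : alg_mod;
  alg_mul : alg_mod -> alg_mod -> alg_mod;
  alg_mulA : associative alg_mul;
  alg_mul1l : left_id alg_one alg_mul;
  alg_mul1r : right_id alg_one alg_mul;
  alg_mulDl : left_distributive alg_mul +%R;
  alg_mulDr : right_distributive alg_mul +%R;
  alg_scaleAl : forall (c : k) x y, c *: alg_mul x y = alg_mul (c *: x) y;
  alg_scaleAr : forall (c : k) x y, c *: alg_mul x y = alg_mul x (c *: y) }.

Definition alg_sort (A : alg) : Type := alg_mod A.
Coercion alg_sort : alg >-> Sortclass.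

HB.instance Definition _ (A : alg) := GRing.Lmodule.on (alg_sort A).
HB.instance Definition _ (A : alg) := GRing.Zmodule_isPzRing.Build (alg_sort A)
  (@alg_mulA A) (@alg_mul1l A) (@alg_mul1r A) (@alg_mulDl A) (@alg_mulDr A).

Lemma algZAl (A : alg) (c : k) (x y : A) : c *: (x * y) = (c *: x) * y.
Proof. exact: alg_scaleAl. Qed.

Lemma algZAr (A : alg) (c : k) (x y : A) : c *: (x * y) = x * (c *: y).
Proof. exact: alg_scaleAr. Qed.

Definition alg_of_algType (A : algType k) : alg :=
  @Alg A 1 *%R (@mulrA A) (@mul1r A) (@mulr1 A) (@mulrDl A) (@mulrDr A)
    (@scalerAl k A) (@scalerAr k A).

Definition alg_hom (A B : alg) (f : A -> B) : Prop :=
  [/\ linear f, f 1 = 1 & {morph f : x y / x * y}].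
End Algebras.

Section LinearQuotient.
Variables (k : fieldType) (V : lmodType k).

Section Def.
Variable U : submodClosed V.

Definition quot_pred : {pred V} := fun x => x \in U.
Fact quot_pred_closed : zmod_closed quot_pred.
Proof. exact: (submodClosedP U : zmod_closed _). Qed.
HB.instance Definition _ :=
  GRing.isZmodClosed.Build V quot_pred quot_pred_closed.

(* The quotient module V / U. *)
Definition lquot : Type := Quotient.quot quot_pred.
HB.instance Definition _ := GRing.Zmodule.on lquot.

Definition lpi (x : V) : lquot := \pi_(Quotient.quot quot_pred) x.
Definition lrepr (x : lquot) : V := repr (x : Quotient.quot quot_pred).

Lemma lreprK : cancel lrepr lpi.
Proof. exact: reprK. Qed.

Lemma lpi_eq (x y : V) : lpi x = lpi y <-> x - y \in U.
Proof.
have -> : (x - y \in U) = (lpi x == lpi y).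
  by rewrite -[RHS]Quotient.idealrBE.
by split=> /eqP.
Qed.

Lemma lpi_repr (x : V) : lrepr (lpi x) - x \in U.
Proof. by apply/lpi_eq; rewrite lreprK. Qed.

Lemma lpiD : {morph lpi : x y / x + y}.
Proof. by move=> x y; rewrite /lpi !piE. Qed.

Definition lquot_scale (c : k) (x : lquot) : lquot := lpi (c *: lrepr x).

Lemma lpiZ_subproof c x : lpi (c *: x) = lquot_scale c (lpi x).
Proof.
by apply/esym/lpi_eq; rewrite -scalerBr rpredZ // lpi_repr.
Qed.

Fact lquot_scaleA a b x :
  lquot_scale a (lquot_scale b x) = lquot_scale (a * b) x.
Proof.
by rewrite -[x]lreprK -!lpiZ_subproof scalerA.
Qed.
Fact lquot_scale1 : left_id 1 lquot_scale.
Proof. by move=> x; rewrite -[x]lreprK -lpiZ_subproof scale1r. Qed.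
Fact lquot_scaleDr : right_distributive lquot_scale +%R.
Proof.
move=> c x y; rewrite -[x]lreprK -[y]lreprK -lpiD -!lpiZ_subproof.
by rewrite scalerDr lpiD.
Qed.
Fact lquot_scaleDl x : {morph lquot_scale^~ x : a b / a + b}.
Proof. by move=> a b; rewrite -[x]lreprK -!lpiZ_subproof scalerDl lpiD. Qed.

HB.instance Definition _ := GRing.Zmodule_isLmodule.Build k lquot
  lquot_scaleA lquot_scale1 lquot_scaleDr lquot_scaleDl.

Fact lpi_is_linear : linear lpi.
Proof. by move=> c x y; rewrite lpiD lpiZ_subproof. Qed.
HB.instance Definition _ := GRing.isLinear.Build k V lquot _ lpi lpi_is_linear.

Lemma lpiZ c x : lpi (c *: x) = c *: lpi x.
Proof. exact: linearZ. Qed.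

Lemma lpi0 (x : V) : x \in U -> lpi x = 0.
Proof. by move=> Ux; rewrite -(raddf0 lpi); apply/lpi_eq; rewrite subr0. Qed.

Section Map.
Variables (W : lmodType k) (f : {linear V -> W}).
Hypothesis fU : forall x, x \in U -> f x = 0.

Definition lquot_map_def & (forall x, x \in U -> f x = 0) :=
  fun x : lquot => f (lrepr x).
Local Notation lquot_map := (lquot_map_def fU).

Lemma lquot_mapE x : lquot_map (lpi x) = f x.
Proof. by apply/eqP; rewrite -subr_eq0 -raddfB /= fU // lpi_repr. Qed.

Fact lquot_map_is_linear : linear lquot_map.
Proof.
by move=> c x y; rewrite -[x]lreprK -[y]lreprK -linearP !lquot_mapE linearP.
Qed.
HB.instance Definition _ :=
  GRing.isLinear.Build k lquot W _ lquot_map lquot_map_is_linear.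
End Map.
End Def.

Inductive spanned (S : V -> Prop) : V -> Prop :=
| spanned0 : spanned S 0
| spannedD c s x : S s -> spanned S x -> spanned S (c *: s + x).

Definition span (S : V -> Prop) : {pred V} := fun x => `[< spanned S x >].

Lemma span_gen S x : S x -> x \in span S.
Proof.
move=> Sx; apply/asboolP; rewrite -[x]addr0 -[x]scale1r.
by apply: spannedD => //; apply: spanned0.
Qed.

Fact span_closed S : submod_closed (span S).
Proof.
split; first by apply/asboolP; exact: spanned0.
move=> c x y /asboolP Sx /asboolP Sy; apply/asboolP.
elim: Sx => [|d s z Ss _ IH]; first by rewrite scaler0 add0r.
by rewrite scalerDr scalerA -addrA; apply: spannedD.
Qed.
HB.instance Definition _ S :=
  GRing.isSubmodClosed.Build k V (span S) (span_closed S).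

Lemma span_sub S (U : submodClosed V) :
  (forall x, S x -> x \in U) -> forall x, x \in span S -> x \in U.
Proof.
move=> SU x /asboolP; elim=> [|c s y Ss _ IH]; first exact: rpred0.
by rewrite rpredD // rpredZ // SU.
Qed.

Lemma span_ker S (W : lmodType k) (f : {linear V -> W}) :
  (forall x, S x -> f x = 0) -> forall x, x \in span S -> f x = 0.
Proof.
move=> Sf x /asboolP; elim=> [|c s y Ss _ IH]; first exact: raddf0.
by rewrite linearP IH Sf // scaler0 addr0.
Qed.
End LinearQuotient.
Notation lquot_map f fU := (@lquot_map_def _ _ _ _ f fU).

Section AlgebraQuotient.
Variables (k : fieldType) (A : alg k).

Definition two_sided (U : {pred A}) : Prop :=
  forall u x v, x \in U -> u * x * v \in U.

Section Def.
Variables (U : submodClosed A) (idU : two_sided U).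

Definition lquot_one : lquot U := lpi U 1.
Definition lquot_mul (x y : lquot U) : lquot U := lpi U (lrepr x * lrepr y).

Lemma lpiM_subproof & two_sided U :
  forall x y, lpi U (x * y) = lquot_mul (lpi U x) (lpi U y).
Proof.
move=> x y; apply/esym/lpi_eq.
set x' := lrepr _; set y' := lrepr _.
have -> : x' * y' - x * y = 1 * (x' - x) * y' + x * (y' - y) * 1.
  by rewrite mul1r mulr1 mulrBl mulrBr addrA subrK.
by rewrite rpredD // idU // lpi_repr.
Qed.

Let lpiM := lpiM_subproof idU.

Fact aquot_mulA : associative lquot_mul.
Proof.
by move=> x y z; rewrite -[x]lreprK -[y]lreprK -[z]lreprK -!lpiM mulrA.
Qed.
Fact aquot_mul1l : left_id lquot_one lquot_mul.
Proof. by move=> x; rewrite -[x]lreprK -lpiM mul1r. Qed.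
Fact aquot_mul1r : right_id lquot_one lquot_mul.
Proof. by move=> x; rewrite -[x]lreprK -lpiM mulr1. Qed.
Fact aquot_mulDl : left_distributive lquot_mul +%R.
Proof.
move=> x y z; rewrite -[x]lreprK -[y]lreprK -[z]lreprK.
by rewrite -raddfD -!lpiM mulrDl raddfD.
Qed.
Fact aquot_mulDr : right_distributive lquot_mul +%R.
Proof.
move=> x y z; rewrite -[x]lreprK -[y]lreprK -[z]lreprK.
by rewrite -raddfD -!lpiM mulrDr raddfD.
Qed.
Fact aquot_scaleAl c x y : c *: lquot_mul x y = lquot_mul (c *: x) y.
Proof.
by rewrite -[x]lreprK -[y]lreprK -lpiZ -!lpiM -lpiZ algZAl.
Qed.
Fact aquot_scaleAr c x y : c *: lquot_mul x y = lquot_mul x (c *: y).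
Proof.
by rewrite -[x]lreprK -[y]lreprK -lpiZ -!lpiM -lpiZ algZAr.
Qed.

Definition aquot : alg k :=
  Alg aquot_mulA aquot_mul1l aquot_mul1r aquot_mulDl aquot_mulDr
    aquot_scaleAl aquot_scaleAr.

Definition api : A -> aquot := lpi U.
HB.instance Definition _ := GRing.Linear.on api.
Lemma api1 : api 1 = 1. Proof. by []. Qed.
Lemma apiM : {morph api : x y / x * y}. Proof. exact: lpiM. Qed.
End Def.

Definition ideal (S : A -> Prop) : {pred A} :=
  span (fun x => exists u s v, S s /\ x = u * s * v).
HB.instance Definition _ S := GRing.SubmodClosed.on (ideal S).

Lemma ideal_two_sided S : two_sided (ideal S).
Proof.
move=> u x v /asboolP; elim=> [|c s y [u' [s' [v' [Ss ->]]]] _ IH].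
  by rewrite mulr0 mul0r rpred0.
rewrite mulrDr mulrDl rpredD // -algZAr -algZAl rpredZ //.
by apply: span_gen; exists (u * u'), s', (v' * v); rewrite !mulrA.
Qed.

(* A_ab = A / (two-sided ideal generated by the commutators). *)
Definition comm_ideal : {pred A} :=
  ideal (fun x => exists a b, x = a * b - b * a).
HB.instance Definition _ := GRing.SubmodClosed.on comm_ideal.
Definition abelianization : alg k :=
  aquot (@ideal_two_sided _ : two_sided comm_ideal).
Definition ab_pi : A -> abelianization :=
  api (@ideal_two_sided _ : two_sided comm_ideal).
HB.instance Definition _ := GRing.Linear.on ab_pi.

End AlgebraQuotient.

Definition monotone m n (f : {ffun 'I_m.+1 -> 'I_n.+1}) : bool :=
  [forall i : 'I_m.+1, forall j : 'I_m.+1, (i <= j)%N ==> (f i <= f j)%N].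

(* Morphisms [m] -> [n] of the simplex category, [n] being 'I_n.+1. *)
Record dmap m n := Dmap {
  dmap_val :> {ffun 'I_m.+1 -> 'I_n.+1};
  dmapP : monotone dmap_val }.
HB.instance Definition _ m n := [isSub for @dmap_val m n].
HB.instance Definition _ m n := [Choice of dmap m n by <:].

Lemma dmap_mono m n (f : dmap m n) (i j : 'I_m.+1) : (i <= j -> f i <= f j)%N.
Proof. by have /forallP/(_ i)/forallP/(_ j)/implyP := dmapP f. Qed.

Lemma monotone_finfun m n (f : 'I_m.+1 -> 'I_n.+1) :
  (forall i j : 'I_m.+1, i <= j -> f i <= f j)%N -> monotone (finfun f).
Proof.
by move=> h; apply/forallP=> i; apply/forallP=> j; apply/implyP; rewrite !ffunE; exact: h.
Qed.

Definition dmap_id n : dmap n n :=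
  Dmap (@monotone_finfun n n id (fun i j h => h)).

Fact dmap_comp_mono l m n (g : dmap m n) (f : dmap l m) :
  monotone (finfun (g \o f)).
Proof. by apply: monotone_finfun => i j le_ij; do 2!apply: dmap_mono. Qed.
Definition dmap_comp l m n (g : dmap m n) (f : dmap l m) : dmap l n :=
  Dmap (dmap_comp_mono g f).

Fact coface_mono n (i : 'I_n.+2) : monotone (finfun (lift i : 'I_n.+1 -> _)).
Proof. by apply: monotone_finfun => j l; rewrite /= leq_bump2. Qed.
Definition coface n (i : 'I_n.+2) : dmap n n.+1 := Dmap (coface_mono i).

(* For #|mu| = p, the monotone surjection [n] -> [p] that steps up exactly at
   the elements of mu.  It induces the iterated degeneracy s_nu, where nu is
   the complement of mu.  *)
Fact steps_mono n p (mu : {set 'I_n}) :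
  monotone [ffun j : 'I_n.+1 =>
    inord (minn p #|[set i in mu | (i < j)%N]|) : 'I_p.+1].
Proof.
apply: monotone_finfun => i j le_ij.
have h m : (minn p m < p.+1)%N by rewrite ltnS geq_minl.
rewrite !inordK // leq_min geq_minl /=.
apply: leq_trans (geq_minr _ _) _; apply: subset_leq_card.
by apply/subsetP=> l; rewrite !inE => /andP[-> /leq_trans]; apply.
Qed.
Definition steps n p (mu : {set 'I_n}) : dmap n p := Dmap (steps_mono p mu).

(* The number of inversions of the shuffle (mu, complement of mu). *)
Definition shuffle_sign n (mu : {set 'I_n}) : nat :=
  #|[set ij : 'I_n * 'I_n |
     [&& ij.1 \in mu, ij.2 \notin mu & (ij.2 < ij.1)%N]]|.

Section Simplicial.
Variable k : fieldType.

Record smod := Smod {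
  smod_ob :> nat -> lmodType k;
  sact : forall m n, dmap m n -> {linear smod_ob n -> smod_ob m};
  sact_id : forall n x, sact (dmap_id n) x = x;
  sact_comp : forall l m n (g : dmap m n) (f : dmap l m) x,
    sact (dmap_comp g f) x = sact f (sact g x) }.

Record smap (X Y : smod) := Smap {
  smap_fun :> forall n, {linear X n -> Y n};
  smap_nat : forall m n (f : dmap m n) x,
    smap_fun m (sact X f x) = sact Y f (smap_fun n x) }.

Record salg := Salg {
  salg_ob :> nat -> alg k;
  salg_act : forall m n, dmap m n -> {linear salg_ob n -> salg_ob m};
  salg_act1 : forall m n (f : dmap m n), salg_act f 1 = 1;
  salg_actM : forall m n (f : dmap m n), {morph salg_act f : x y / x * y};
  salg_act_id : forall n x, salg_act (dmap_id n) x = x;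
  salg_act_comp : forall l m n (g : dmap m n) (f : dmap l m) x,
    salg_act (dmap_comp g f) x = salg_act f (salg_act g x) }.

Definition smod_of_salg (X : salg) : smod :=
  @Smod (fun n => X n : lmodType k) (@salg_act X) (@salg_act_id X)
    (@salg_act_comp X).
Coercion smod_of_salg : salg >-> smod.

Record samap (X Y : salg) := Samap {
  samap_fun :> forall n, {linear X n -> Y n};
  samap1 : forall n, samap_fun n 1 = 1;
  samapM : forall n, {morph samap_fun n : x y / x * y};
  samap_nat : forall m n (f : dmap m n) x,
    samap_fun m (salg_act X f x) = salg_act Y f (samap_fun n x) }.

Definition smap_of_samap (X Y : salg) (f : samap X Y) : smap X Y :=
  @Smap X Y (fun n => samap_fun f n) (@samap_nat X Y f).
Coercion smap_of_samap : samap >-> smap.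

Definition const_salg (A : alg k) : salg :=
  @Salg (fun _ => A) (fun _ _ _ => idfun : {linear A -> A})
    (fun _ _ _ => erefl) (fun _ _ _ _ _ => erefl)
    (fun _ _ => erefl) (fun _ _ _ _ _ _ => erefl).

Section Homology.
Variable X : smod.

(* The associated (unnormalized) chain complex, with X_(-1) read as 0. *)
Definition bd n : X n -> X n.-1 :=
  match n return X n -> X n.-1 with
  | 0%N => fun _ => 0
  | m.+1 => fun x => \sum_(i < m.+2) (-1) ^+ i *: sact X (coface i) x
  end.

Fact bd_is_linear n : linear (@bd n).
Proof.
case: n => [|n] c x y /=; first by rewrite scaler0 addr0.
rewrite scaler_sumr -big_split; apply: eq_bigr => i _ /=.
by rewrite linearP scalerDr !scalerA mulrC.
Qed.
HB.instance Definition _ n :=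
  GRing.isLinear.Build k (X n) (X n.-1) _ (@bd n) (@bd_is_linear n).

Definition cycles n : {pred X n} := fun x => bd x == 0.
Fact cycles_closed n : submod_closed (@cycles n).
Proof.
split=> [|c x y]; rewrite /cycles !unfold_in ?raddf0 // => /eqP x0 /eqP y0.
by rewrite linearP /= x0 y0 scaler0 addr0.
Qed.
HB.instance Definition _ n :=
  GRing.isSubmodClosed.Build k (X n) (@cycles n) (@cycles_closed n).

Record cycle n := Cycle { cycle_val :> X n; _ : cycle_val \in @cycles n }.
HB.instance Definition _ n := [isSub for @cycle_val n].
HB.instance Definition _ n := [Choice of cycle n by <:].
HB.instance Definition _ n := [SubChoice_isSubLmodule of cycle n by <:].

Definition boundaries n : {pred cycle n} :=
  fun z => `[< exists y : X n.+1, bd y = val z >].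
Fact boundaries_closed n : submod_closed (@boundaries n).
Proof.
split=> [|c x y /asboolP[x' xE] /asboolP[y' yE]]; apply/asboolP.
  by exists 0; rewrite [LHS]raddf0.
exists (c *: x' + y'); rewrite [LHS](@bd_is_linear n.+1).
by rewrite xE yE.
Qed.
HB.instance Definition _ n :=
  GRing.isSubmodClosed.Build k (cycle n) (@boundaries n) (@boundaries_closed n).

Definition homology n : lmodType k := lquot (@boundaries n).

(* The homology class of x if x is a cycle, and 0 otherwise. *)
Definition hclass n (x : X n) : homology n := lpi _ (insubd (0 : cycle n) x).
Definition hrepr n (h : homology n) : X n := val (lrepr h).

End Homology.

Definition hmap (X Y : smod) (f : smap X Y) n (h : homology X n) :
  homology Y n := hclass (f n (hrepr h)).

Definition weak_equiv (X Y : smod) (f : smap X Y) : Prop :=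
  forall n, bijective (@hmap X Y f n).

(* Graded modules with a unit and products G_p x G_q -> G_n.  The index n is
   kept separate from p + q so that no law needs a transport; only the products
   with n = p + q are meaningful, and only these occur in the laws below.  *)
Record galg := Galg {
  galg_deg :> nat -> lmodType k;
  galg_one : galg_deg 0%N;
  galg_mul : forall p q n, galg_deg p -> galg_deg q -> galg_deg n }.

Definition graded_commutative (G : galg) : Prop :=
  [/\ forall p q (y : G q), linear (fun x : G p => galg_mul (p + q) x y),
      forall p q (x : G p), linear (fun y : G q => galg_mul (p + q) x y),
      forall n (x : G n), galg_mul n (galg_one G) x = x,
      forall p q r (x : G p) (y : G q) (z : G r),
        galg_mul (p + q + r) x (galg_mul (q + r) y z) =
        galg_mul (p + q + r) (galg_mul (p + q) x y) z &
      forall p q (x : G p) (y : G q),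
        galg_mul (p + q) x y = (-1) ^+ (p * q) *: galg_mul (p + q) y x].

Definition galg_iso (G H : galg) (f : forall n, G n -> H n) : Prop :=
  [/\ forall n, linear (f n),
      forall n, bijective (f n),
      f 0%N (galg_one G) = galg_one H &
      forall p q (x : G p) (y : G q),
        f (p + q)%N (galg_mul (p + q) x y) = galg_mul (p + q) (f p x) (f q y)].

(* The product induced by that of X through the shuffle map: the sum, over the
   (p, q)-shuffles (mu, nu), of sgn(mu, nu) s_nu(x) s_mu(y).  *)
Definition shuffle (X : salg) p q n (x : X p) (y : X q) : X n :=
  \sum_(mu : {set 'I_n} | (#|mu| == p) && (#|~: mu| == q))
    (-1) ^+ shuffle_sign mu *:
      (salg_act X (steps p mu) x * salg_act X (steps q (~: mu)) y).

Definition homotopy_galg (X : salg) : galg :=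
  @Galg (homology X) (@hclass X 0 (1 : X 0%N))
    (fun p q n x y => @hclass X n (@shuffle X p q n (hrepr x) (hrepr y))).

End Simplicial.

(* The category Delta S_+, with objects the n-element sets {0, ..., n-1} for n
   in nat (so n stands for [n-1], and 0 for the adjoined initial object), in
   untyped form: a morphism from n to m is a sequence of m words (the monomials
   X_0, ..., X_(m-1)) in which each of 0, ..., n-1 occurs exactly once in all;
   m is the size of the sequence.  Delta S is the full subcategory on n > 0.  *)
Definition mor := seq (seq nat).

Definition is_mor n (f : mor) : bool := perm_eq (flatten f) (iota 0 n).

Definition mor_id n : mor := [seq [:: i] | i <- iota 0 n].
(* Substitution of the i-th monomial of f for the variable i of g. *)
Definition mor_comp (g f : mor) : mor :=
  [seq flatten [seq nth [::] f i | i <- Y] | Y <- g].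
(* Here size (flatten f) is the source of f. *)
Definition mor_sum (f g : mor) : mor :=
  f ++ [seq [seq (size (flatten f) + i)%N | i <- Y] | Y <- g].

Lemma is_mor_id n : is_mor n (mor_id n).
Proof. by rewrite /is_mor /mor_id flatten_map1 map_id. Qed.

Lemma size_mor_id n : size (mor_id n) = n.
Proof. by rewrite size_map size_iota. Qed.

Lemma size_mor_comp g f : size (mor_comp g f) = size g.
Proof. by rewrite size_map. Qed.

Lemma is_mor_size n f : is_mor n f -> size (flatten f) = n.
Proof. by move/perm_size; rewrite size_iota. Qed.

Lemma is_mor_lt n f Y i : is_mor n f -> Y \in f -> i \in Y -> (i < n)%N.
Proof.
move=> nf fY Yi; have : i \in flatten f by apply/flattenP; exists Y.
by rewrite (perm_mem nf) mem_iota.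
Qed.

Lemma flatten_mor_comp g f :
  flatten (mor_comp g f) = flatten [seq nth [::] f i | i <- flatten g].
Proof. by elim: g => //= Y g IH; rewrite map_cat flatten_cat -IH. Qed.

Lemma is_mor_comp n f g :
  is_mor n f -> is_mor (size f) g -> is_mor n (mor_comp g f).
Proof.
move=> nf fg; rewrite /is_mor flatten_mor_comp.
apply: perm_trans nf; apply: perm_trans (perm_flatten (perm_map _ fg)) _.
by rewrite map_nth_iota0 // take_size.
Qed.

Lemma mor_compA f g h : is_mor (size g) h ->
  mor_comp h (mor_comp g f) = mor_comp (mor_comp h g) f.
Proof.
move=> gh; rewrite /mor_comp -map_comp; apply/eq_in_map => Y hY /=.
elim: Y {hY} (fun i => @is_mor_lt _ _ _ i gh hY) => //= i Y IH ltY.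
rewrite map_cat flatten_cat IH; last by move=> j Yj; rewrite ltY // inE Yj orbT.
by rewrite (nth_map [::]) // ltY // mem_head.
Qed.

Lemma mor_comp1 f n : is_mor n f -> mor_comp f (mor_id n) = f.
Proof.
move=> nf; rewrite /mor_comp -[RHS]map_id; apply/eq_in_map => Y fY.
have ltY i (Yi : i \in Y) := is_mor_lt nf fY Yi.
rewrite -[RHS]map_id -[in RHS]flatten_map1; congr flatten; apply/eq_in_map.
by move=> i /ltY lt_in; rewrite (nth_map 0%N) ?size_iota // nth_iota.
Qed.

Lemma mor_1comp f : mor_comp (mor_id (size f)) f = f.
Proof.
rewrite /mor_comp /mor_id -map_comp -[RHS](mkseq_nth [::]) /mkseq.
by apply: eq_map => i /=; rewrite cats0.
Qed.

Lemma size_flatten_sum f g :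
  size (flatten (mor_sum f g)) = (size (flatten f) + size (flatten g))%N.
Proof. by rewrite /mor_sum flatten_cat size_cat -map_flatten size_map. Qed.

Lemma size_mor_sum f g : size (mor_sum f g) = (size f + size g)%N.
Proof. by rewrite size_cat size_map. Qed.

Lemma mor_sumA : associative mor_sum.
Proof.
move=> f g h; rewrite {1}/mor_sum {2}/mor_sum map_cat catA.
rewrite {1}[in RHS]/mor_sum {1}/mor_sum size_flatten_sum -!map_comp; congr (_ ++ _).
by apply: eq_map => Y /=; rewrite -map_comp; apply: eq_map => i /=; rewrite addnA.
Qed.

Lemma mor_0sum : left_id [::] mor_sum.
Proof. by move=> f; rewrite /mor_sum /= -[RHS]map_id; apply: eq_map => Y; rewrite map_id. Qed.

Lemma mor_sum0 : right_id [::] mor_sum.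
Proof. by move=> f; rewrite /mor_sum cats0. Qed.

Lemma is_mor_sum m n f g : is_mor m f -> is_mor n g ->
  is_mor (m + n) (mor_sum f g).
Proof.
move=> mf ng; rewrite /is_mor /mor_sum flatten_cat iotaD perm_cat //.
rewrite -map_flatten (is_mor_size mf).
have -> : iota (0 + m) n = [seq (m + i)%N | i <- iota 0 n].
  by rewrite -[in RHS]iotaDl addn0.
exact: perm_map.
Qed.

Lemma mor_id_sum m n : mor_sum (mor_id m) (mor_id n) = mor_id (m + n).
Proof.
rewrite /mor_sum (is_mor_size (is_mor_id m)) /mor_id iotaD map_cat.
by rewrite -[(0 + m)%N]addn0 iotaDl -!map_comp.
Qed.

Lemma mor_comp_sum m f g n f' g' : 
  is_mor m f -> is_mor (size f) g -> is_mor n f' -> is_mor (size f') g' ->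
  mor_comp (mor_sum g g') (mor_sum f f') =
  mor_sum (mor_comp g f) (mor_comp g' f').
Proof.
move=> mf fg nf' fg'; rewrite {1}/mor_comp map_cat; congr (_ ++ _).
  apply/eq_in_map => Y gY; congr flatten; apply/eq_in_map => i Yi.
  by rewrite nth_cat (is_mor_lt fg gY Yi).
rewrite -!map_comp; apply/eq_in_map => Y gY /=.
rewrite map_flatten -!map_comp; congr flatten; apply/eq_in_map => i Yi /=.
rewrite (is_mor_size fg) nth_cat ltnNge leq_addr /= addKn.
rewrite (nth_map [::]) ?(is_mor_lt fg' gY Yi) //.
by rewrite (is_mor_size mf) (is_mor_size (is_mor_comp mf fg)).
Qed.

(* A p-simplex n = n_0 -> ... -> n_p of the nerve is the sequence of its p
   morphisms; n_i is vertex n s i, and arrow n s i j is the composite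
   n_i -> n_j.  *)
Fixpoint is_chain n (s : seq mor) : bool :=
  if s is f :: s' then is_mor n f && is_chain (size f) s' else true.

Definition vertex n (s : seq mor) i : nat := last n (map size (take i s)).

Definition mor_comps n (s : seq mor) : mor :=
  foldl (fun f g => mor_comp g f) (mor_id n) s.

Definition arrow n (s : seq mor) i j : mor :=
  mor_comps (vertex n s i) (drop i (take j s)).

(* The action on the nerve of the simplicial operator th : [q] -> [p]. *)
Definition chain_pull n (s : seq mor) (th : nat -> nat) q : seq mor :=
  mkseq (fun i => arrow n s (th i) (th i.+1)) q.

Lemma is_chain_cat n s t :
  is_chain n (s ++ t) = is_chain n s && is_chain (last n (map size s)) t.
Proof. by elim: s n => //= f s IH n; rewrite IH andbA. Qed.

Lemma is_chain_rcons n s f :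
  is_chain n (rcons s f) = is_chain n s && is_mor (last n (map size s)) f.
Proof. by rewrite -cats1 is_chain_cat /= andbT. Qed.

Lemma mor_comps_rcons n s f :
  mor_comps n (rcons s f) = mor_comp f (mor_comps n s).
Proof. by rewrite /mor_comps foldl_rcons. Qed.

Lemma size_mor_comps n s : size (mor_comps n s) = last n (map size s).
Proof.
elim/last_ind: s => [|s f _]; first by rewrite size_mor_id.
by rewrite mor_comps_rcons size_mor_comp map_rcons last_rcons.
Qed.

Lemma is_mor_comps n s : is_chain n s -> is_mor n (mor_comps n s).
Proof.
elim/last_ind: s => [|s f IH]; first by rewrite is_mor_id.
rewrite is_chain_rcons mor_comps_rcons => /andP[/IH ns sf].
by rewrite is_mor_comp // size_mor_comps.
Qed.

Lemma mor_comps_cat n s t : is_chain n (s ++ t) ->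
  mor_comps n (s ++ t) =
  mor_comp (mor_comps (last n (map size s)) t) (mor_comps n s).
Proof.
elim/last_ind: t => [|t f IH].
  by rewrite cats0 /= -size_mor_comps mor_1comp.
rewrite -rcons_cat is_chain_rcons !mor_comps_rcons => /andP[/IH-> stf].
by rewrite mor_compA // size_mor_comps -last_cat -map_cat.
Qed.

Lemma is_chain_take n s i : is_chain n s -> is_chain n (take i s).
Proof. by rewrite -{1}(cat_take_drop i s) is_chain_cat => /andP[]. Qed.

Lemma is_chain_drop n s i :
  is_chain n s -> is_chain (vertex n s i) (drop i s).
Proof. by rewrite -{1}(cat_take_drop i s) is_chain_cat => /andP[]. Qed.

Lemma take_split (T : Type) (s : seq T) i j : (i <= j)%N ->
  take j s = take i s ++ drop i (take j s).
Proof. by move=> le_ij; rewrite -[LHS](cat_take_drop i) -take_min (minn_idPl le_ij). Qed.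

Lemma vertex_arrow n s i j : (i <= j)%N ->
  last (vertex n s i) (map size (drop i (take j s))) = vertex n s j.
Proof.
by move=> le_ij; rewrite /vertex -last_cat -map_cat -take_split.
Qed.

Lemma is_chain_arrow n s i j : is_chain n s -> (i <= j)%N ->
  is_chain (vertex n s i) (drop i (take j s)).
Proof.
move=> ns le_ij; have := is_chain_take j ns.
by rewrite {1}(take_split _ le_ij) is_chain_cat => /andP[].
Qed.

Lemma size_arrow n s i j : (i <= j)%N -> size (arrow n s i j) = vertex n s j.
Proof. by move=> le_ij; rewrite size_mor_comps vertex_arrow. Qed.

Lemma is_mor_arrow n s i j : is_chain n s -> (i <= j)%N ->
  is_mor (vertex n s i) (arrow n s i j).
Proof. by move=> ns le_ij; rewrite is_mor_comps // is_chain_arrow. Qed.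

Lemma arrow_id n s i : arrow n s i i = mor_id (vertex n s i).
Proof. by rewrite /arrow drop_oversize // size_take_min geq_minl. Qed.

Lemma arrow_comp n s i j l : is_chain n s -> (i <= j)%N -> (j <= l)%N ->
  mor_comp (arrow n s j l) (arrow n s i j) = arrow n s i l.
Proof.
move=> ns le_ij le_jl; have le_il := leq_trans le_ij le_jl.
have E : drop i (take l s) = drop i (take j s) ++ drop j (take l s).
  have := take_split s le_il.
  rewrite {1}(take_split s le_jl) {1}(take_split s le_ij) -catA.
  by move/(congr1 (drop (size (take i s)))); rewrite !drop_size_cat.
rewrite /arrow E mor_comps_cat ?vertex_arrow // -E.
exact: is_chain_arrow.
Qed.

Lemma arrow1 n s i : is_chain n s -> (i < size s)%N ->
  arrow n s i i.+1 = nth [::] s i.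
Proof.
move=> ns lt_is; have := is_chain_arrow ns (leqnSn i); rewrite /arrow.
rewrite (take_nth [::] lt_is) -cats1 drop_size_cat ?size_takel 1?ltnW //=.
by rewrite andbT => /mor_comp1.
Qed.

Lemma is_chainP n s :
  (forall i, (i < size s)%N -> is_mor (vertex n s i) (nth [::] s i)) ->
  is_chain n s.
Proof.
elim: s n => //= f s IH n h; rewrite (h 0%N) //=; apply: IH => i lt_is.
exact: (h i.+1).
Qed.

Lemma vertex0 n s : vertex n s 0 = n.
Proof. by rewrite /vertex take0. Qed.

Section Pull.
Variables (n : nat) (s : seq mor) (th : nat -> nat) (q : nat).
Hypothesis ns : is_chain n s.
Hypothesis th_mono : forall i j, (i <= j)%N -> (j <= q)%N -> (th i <= th j)%N.

Let t := chain_pull n s th q.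

Lemma vertex_pull i : (i <= q)%N -> vertex (vertex n s (th 0)) t i = vertex n s (th i).
Proof.
case: i => [|i] lt_iq; first by rewrite vertex0.
rewrite /vertex (take_nth [::]) ?size_mkseq // map_rcons last_rcons.
by rewrite nth_mkseq // size_arrow // th_mono.
Qed.

Lemma is_chain_pull : is_chain (vertex n s (th 0)) t.
Proof.
apply: is_chainP => i; rewrite size_mkseq => lt_iq.
by rewrite vertex_pull 1?ltnW // nth_mkseq // is_mor_arrow // th_mono.
Qed.

Lemma arrow_pull i j : (i <= j)%N -> (j <= q)%N ->
  arrow (vertex n s (th 0)) t i j = arrow n s (th i) (th j).
Proof.
move=> le_ij; rewrite -(subnK le_ij); elim: (j - i)%N => [|d IH] le_q.
  by rewrite add0n !arrow_id vertex_pull.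
have lt_q : (d + i < q)%N by rewrite -addSn.
have le_i : (i <= d + i)%N by rewrite leq_addl.
rewrite addSn -(@arrow_comp _ _ _ (d + i)) ?is_chain_pull // IH 1?ltnW //.
rewrite arrow1 ?is_chain_pull ?size_mkseq // nth_mkseq //.
by rewrite arrow_comp ?th_mono // ltnW.
Qed.
End Pull.

Lemma chain_pull_id n s th : is_chain n s ->
  (forall i, (i <= size s)%N -> th i = i) -> chain_pull n s th (size s) = s.
Proof.
move=> ns thE; apply: (@eq_from_nth _ [::]); rewrite size_mkseq // => i lt_is.
by rewrite nth_mkseq // (thE i.+1) // (thE i (ltnW lt_is)) arrow1.
Qed.

Lemma chain_pull_comp n s th et r q : is_chain n s ->
  (forall i j, (i <= j)%N -> (j <= q)%N -> (th i <= th j)%N) ->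
  (forall i j, (i <= j)%N -> (j <= r)%N -> (et i <= et j)%N) ->
  (et r <= q)%N ->
  chain_pull (vertex n s (th 0%N)) (chain_pull n s th q) et r =
  chain_pull n s (fun i => th (et i)) r.
Proof.
move=> ns th_mono et_mono le_etq.
apply: (@eq_from_nth _ [::]); rewrite !size_mkseq // => i lt_ir.
rewrite !nth_mkseq // arrow_pull ?et_mono //.
by apply: leq_trans le_etq; apply: et_mono.
Qed.

Definition chain_sum (s t : seq mor) : seq mor :=
  [seq mor_sum x.1 x.2 | x <- zip s t].

Lemma size_chain_sum s t : size s = size t -> size (chain_sum s t) = size s.
Proof. by move=> st; rewrite size_map size1_zip // st. Qed.

Lemma nth_chain_sum s t i : size s = size t -> 
  nth [::] (chain_sum s t) i = mor_sum (nth [::] s i) (nth [::] t i).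
Proof.
move=> st; case: (ltnP i (size s)) => lt_is; last first.
  by rewrite !nth_default -?st // size_chain_sum.
by rewrite (nth_map ([::], [::])) ?size1_zip -?st // nth_zip.
Qed.

Lemma vertex_sum m n s t i : size s = size t -> 
  vertex (m + n) (chain_sum s t) i = (vertex m s i + vertex n t i)%N.
Proof.
rewrite /vertex /chain_sum.
elim: s t m n i => [|f s IH] [|g t] m n [|i] //= [st].
by rewrite -IH // size_mor_sum.
Qed.

Lemma is_chain_sum m n s t : size s = size t ->
  is_chain m s -> is_chain n t -> is_chain (m + n) (chain_sum s t).
Proof.
rewrite /chain_sum.
elim: s t m n => [|f s IH] [|g t] m n //= [st] /andP[mf sP] /andP[ng tP].
by rewrite is_mor_sum // size_mor_sum IH.
Qed.

Lemma mor_comps_sum m n s t : size s = size t ->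
  is_chain m s -> is_chain n t ->
  mor_comps (m + n) (chain_sum s t) = mor_sum (mor_comps m s) (mor_comps n t).
Proof.
elim/last_ind: s t => [|s f IH] t.
  by case: t => //= _ _ _; rewrite mor_id_sum.
case/lastP: t => [|t g]; rewrite !size_rcons // => -[st].
rewrite !is_chain_rcons => /andP[ms sf] /andP[nt tg].
rewrite /chain_sum zip_rcons // map_rcons !mor_comps_rcons IH //.
by rewrite (@mor_comp_sum m _ _ n) ?is_mor_comps // size_mor_comps.
Qed.

Lemma arrow_sum m n s t i j : size s = size t -> (i <= j)%N ->
  is_chain m s -> is_chain n t ->
  arrow (m + n) (chain_sum s t) i j = mor_sum (arrow m s i j) (arrow n t i j).
Proof.
move=> st le_ij ms nt; rewrite /arrow vertex_sum //.
have dE : drop i (take j (chain_sum s t)) =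
  chain_sum (drop i (take j s)) (drop i (take j t)).
  rewrite /chain_sum -map_take -map_drop; congr map.
  by elim: s t st i j {le_ij ms nt} => [|f s IH] [|g t] //= [st] [|i] [|j] //=;
    rewrite ?IH //; congr cons; have := IH _ st 0%N j; rewrite !drop0.
rewrite dE mor_comps_sum ?is_chain_arrow //.
by rewrite !size_drop !size_take_min st.
Qed.

Lemma chain_pull_sum m n s t th q : size s = size t ->
  (forall i j, (i <= j)%N -> (j <= q)%N -> (th i <= th j)%N) ->
  is_chain m s -> is_chain n t ->
  chain_pull (m + n) (chain_sum s t) th q =
  chain_sum (chain_pull m s th q) (chain_pull n t th q).
Proof.
move=> st th_mono ms nt; apply: (@eq_from_nth _ [::]).
  by rewrite size_chain_sum !size_mkseq.
rewrite size_mkseq => i lt_iq; rewrite nth_chain_sum ?size_mkseq //.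
by rewrite !nth_mkseq // arrow_sum // th_mono.
Qed.

Lemma chain_sumA : associative chain_sum.
Proof.
rewrite /chain_sum; elim=> [|f s IH] [|g t] [|h u] //=.
by rewrite mor_sumA IH.
Qed.

Section SymmetricBar.
Variable k : fieldType.

(* The value of B_sym(f) on a decomposable tensor, given by its factors. *)
Definition Bsym (A : alg k) (f : mor) (a : seq A) : seq A :=
  [seq \prod_(i <- Y) a`_i | Y <- f].

Lemma size_Bsym (A : alg k) f (a : seq A) : size (Bsym f a) = size f.
Proof. exact: size_map. Qed.

Lemma Bsym_id (A : alg k) (a : seq A) : Bsym (mor_id (size a)) a = a.
Proof.
rewrite /Bsym /mor_id -map_comp -[RHS](mkseq_nth 0) /mkseq.
by apply: eq_map => i /=; rewrite big_seq1.
Qed.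

Lemma Bsym_comp (A : alg k) f g (a : seq A) : is_mor (size f) g ->
  Bsym (mor_comp g f) a = Bsym g (Bsym f a).
Proof.
move=> fg; rewrite /Bsym -map_comp; apply/eq_in_map => Y gY /=.
rewrite big_flatten big_map /=; apply: eq_big_seq => i Yi.
by rewrite (nth_map [::]) // (is_mor_lt fg gY Yi).
Qed.

Lemma Bsym_sum (A : alg k) f g (a b : seq A) : is_mor (size a) f ->
  Bsym (mor_sum f g) (a ++ b) = Bsym f a ++ Bsym g b.
Proof.
move=> af; rewrite /Bsym /mor_sum map_cat -map_comp; congr (_ ++ _).
  apply/eq_in_map => Y fY /=; apply: eq_big_seq => i Yi.
  by rewrite nth_cat (is_mor_lt af fY Yi).
apply: eq_map => Y /=; rewrite big_map; apply: eq_bigr => i _.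
by rewrite (is_mor_size af) nth_cat ltnNge leq_addr /= addKn.
Qed.

Lemma Bsym_map (A B : alg k) (h : A -> B) f (a : seq A) :
  h 1 = 1 -> {morph h : x y / x * y} -> is_mor (size a) f ->
  map h (Bsym f a) = Bsym f (map h a).
Proof.
move=> h1 hM af; rewrite /Bsym -map_comp; apply/eq_in_map => Y fY /=.
rewrite (big_morph h hM h1); apply: eq_big_seq => i Yi.
by rewrite (nth_map 0) // (is_mor_lt af fY Yi).
Qed.

Lemma Bsym_slot (A : alg k) f (u v : seq A) :
  is_mor (size u + (size v).+1) f ->
  exists U l r V, forall w, Bsym f (u ++ w :: v) = U ++ (l * w * r) :: V.
Proof.
move=> uvf; have : size u \in flatten f.
  by rewrite (perm_mem uvf) mem_iota /= add0n -{1}[size u]addn0 ltn_add2l.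
have : uniq (flatten f) by rewrite (perm_uniq uvf) iota_uniq.
move=> + /flattenP[Y fY Yu]; case/splitPr: fY => F1 F2.
case/splitPr: Yu => Y1 Y2; rewrite flatten_cat /= -catA /=.
set m := size u => fu.
have out Z : m \notin Z -> forall w w',
    \prod_(i <- Z) (u ++ w :: v)`_i = \prod_(i <- Z) (u ++ w' :: v)`_i.
  move=> Zm w w'; apply: eq_big_seq => i Zi; rewrite !nth_cat.
  case: ltnP => // le_mi; have : (m < i)%N.
    by rewrite ltn_neqAle le_mi andbT; apply: contra Zm => /eqP->.
  by rewrite -subn_gt0; case: (i - size u)%N.
have outF F : m \notin flatten F -> forall w w',
    Bsym F (u ++ w :: v) = Bsym F (u ++ w' :: v).
  move=> Fm w w'; apply/eq_in_map => Z FZ; apply: out.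
  by apply: contra Fm => Zm; apply/flattenP; exists Z.
have [F1m Y1m Y2m F2m] : [/\ m \notin flatten F1, m \notin Y1,
    m \notin Y2 & m \notin flatten F2].
  have : uniq (m :: (flatten F1 ++ Y1) ++ Y2 ++ flatten F2).
    rewrite -(perm_uniq (s1 := (flatten F1 ++ Y1) ++ m :: Y2 ++ flatten F2)).
      by rewrite -catA.
    by rewrite perm_catC /= perm_cons perm_catC.
  by rewrite /= !mem_cat !negb_or => /andP[/andP[/andP[-> ->] /andP[-> ->]]].
exists (Bsym F1 (u ++ 0 :: v)), (\prod_(i <- Y1) (u ++ 0 :: v)`_i),
  (\prod_(i <- Y2) (u ++ 0 :: v)`_i), (Bsym F2 (u ++ 0 :: v)) => w.
rewrite (outF _ F1m _ w) (out _ Y1m _ w) (out _ Y2m _ w) (outF _ F2m _ w).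
rewrite {1}/Bsym map_cat /= big_cat big_cons /= mulrA; congr (_ ++ _ * _ * _ :: _).
by rewrite nth_cat ltnn subnn.
Qed.

(* A decorated p-simplex: a decomposable tensor a_0 (x) ... (x) a_(n-1) in
   B_sym([n-1]), given by its factors, together with a p-simplex of the nerve
   starting at n.  The simplices are those of Delta S_+ if aug is true and those
   of Delta S if it is false.  *)
Definition is_decor (aug : bool) (A : alg k) p (x : seq A * p.-tuple mor) :=
  (aug || (0 < size x.1)%N) && is_chain (size x.1) x.2.

Record decor (aug : bool) (A : alg k) p := Decor {
  decor_val :> seq A * p.-tuple mor;
  decorP : is_decor aug decor_val }.
HB.instance Definition _ aug A p := [isSub for @decor_val aug A p].
HB.instance Definition _ aug A p := [Choice of decor aug A p by <:].

Definition dnat q p (th : dmap q p) (i : nat) : nat := th (inord i).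

Lemma dnat_mono q p (th : dmap q p) i j :
  (i <= j)%N -> (j <= q)%N -> (dnat th i <= dnat th j)%N.
Proof.
by move=> le_ij le_jq; apply: dmap_mono; rewrite !inordK // ltnS (leq_trans le_ij).
Qed.

Lemma dnat_le q p (th : dmap q p) i : (dnat th i <= p)%N.
Proof. by rewrite -ltnS ltn_ord. Qed.

Lemma dnat_id p i : (i <= p)%N -> dnat (dmap_id p) i = i.
Proof. by move=> le_ip; rewrite /dnat ffunE inordK. Qed.

Lemma dnat_comp r q p (th : dmap q p) (et : dmap r q) i :
  dnat (dmap_comp th et) i = dnat th (dnat et i).
Proof. by rewrite /dnat ffunE /= inord_val. Qed.

Fact size_chain_pull n s th q : size (chain_pull n s th q) == q.
Proof. by rewrite size_mkseq. Qed.

(* On decorated simplices of a simplicial algebra the simplicial operators act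
   diagonally: on the simplex, and on the coefficient both through the
   simplicial structure of X and through B_sym(n_0 -> n_(th 0)).  *)
Definition decor_pull_def (X : salg k) p q (th : dmap q p)
    (x : seq (X p) * p.-tuple mor) : seq (X q) * q.-tuple mor :=
  (Bsym (arrow (size x.1) x.2 0 (dnat th 0)) (map (salg_act X th) x.1),
   Tuple (size_chain_pull (size x.1) x.2 (dnat th) q)).

Lemma size_decor_pull (X : salg k) p q (th : dmap q p)
    (x : seq (X p) * p.-tuple mor) :
  size (decor_pull_def th x).1 = vertex (size x.1) x.2 (dnat th 0).
Proof. by rewrite size_Bsym size_arrow. Qed.

Fact decor_pullP (X : salg k) aug p q (th : dmap q p) (x : decor aug (X p) p) :
  is_decor aug (decor_pull_def th x).
Proof.
case: x => -[a s] /andP[/= a_gt0 aP]; rewrite /is_decor size_decor_pull /=.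
rewrite (is_chain_pull aP (@dnat_mono _ _ th)) andbT.
case: aug a_gt0 => //= a_gt0; rewrite lt0n; apply: contraTneq a_gt0 => v0.
have := is_mor_arrow aP (leq0n (dnat th 0)); rewrite vertex0.
move/is_mor_size <-; have := size_arrow (size a) s (leq0n (dnat th 0)).
by rewrite v0 => /size0nil->.
Qed.
Definition decor_pull (X : salg k) aug p q (th : dmap q p)
    (x : decor aug (X p) p) : decor aug (X q) q :=
  Decor (decor_pullP th x).

Lemma decor_pull_id (X : salg k) aug p (x : decor aug (X p) p) :
  decor_pull (dmap_id p) x = x.
Proof.
apply: val_inj; case: x => -[a s] /andP[/= _ aP]; congr (_, _).
  rewrite /= dnat_id // arrow_id vertex0.
  rewrite (eq_map (@salg_act_id _ X p)) map_id.
  exact: Bsym_id.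
apply: val_inj => /=; rewrite -[RHS](chain_pull_id (th := dnat (dmap_id p)) aP).
  by rewrite size_tuple.
by move=> i; rewrite size_tuple; exact: dnat_id.
Qed.

Lemma decor_pull_comp (X : salg k) aug p q r (th : dmap q p) (et : dmap r q)
    (x : decor aug (X p) p) :
  decor_pull (dmap_comp th et) x = decor_pull et (decor_pull th x).
Proof.
apply: val_inj; case: x => -[a s] /andP[/= _ aP].
have th_mono := @dnat_mono _ _ th; have et_mono := @dnat_mono _ _ et.
rewrite /decor_pull_def /= size_Bsym size_arrow //; congr (_, _).
  rewrite (@arrow_pull (size a) s (dnat th)  q aP th_mono) ?dnat_le //.
  rewrite Bsym_map; first last.
  - rewrite size_map; have := is_mor_arrow aP (leq0n (dnat th 0)).
    by rewrite vertex0.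
  - exact: salg_actM.
  - exact: salg_act1.
  rewrite -Bsym_comp; last first.
    rewrite size_arrow // is_mor_arrow //.
    by rewrite th_mono ?dnat_le.
  rewrite arrow_comp ?th_mono ?dnat_le //.
  by rewrite dnat_comp -map_comp; congr Bsym; apply: eq_map => y /=; rewrite salg_act_comp.
apply: val_inj => /=; rewrite [RHS](chain_pull_comp aP th_mono et_mono) ?dnat_le //.
by apply: eq_map => i; rewrite !dnat_comp.
Qed.

End SymmetricBar.

Section LinearExtension.
Variables (k : fieldType) (K : choiceType) (W : lmodType k).

Definition lin_ext (h : K -> W) (g : {malg k[K]}) : W :=
  \sum_(x <- msupp g) g@_x *: h x.

Lemma lin_extEw h (d : {fset K}) g : (msupp g `<=` d)%fset ->
  lin_ext h g = \sum_(x <- d) g@_x *: h x.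
Proof.
move=> le; rewrite [LHS](big_fset_incl _ le) // => x _ /mcoeff_outdom->.
by rewrite scale0r.
Qed.

Fact lin_ext_is_linear h : linear (lin_ext h).
Proof.
move=> c f g; set d := (msupp f `|` msupp g)%fset.
rewrite (@lin_extEw h d (c *: f + g)); last first.
  apply: (fsubset_trans (msuppD_le _ _)).
  by apply: fsetSU; apply: msuppZ_le.
rewrite (@lin_extEw h d f) ?fsubsetUl // (@lin_extEw h d g) ?fsubsetUr //.
rewrite scaler_sumr -big_split; apply: eq_bigr => x _ /=.
by rewrite mcoeffD mcoeffZ scalerDl scalerA.
Qed.
HB.instance Definition _ h :=
  GRing.isLinear.Build k {malg k[K]} W _ (lin_ext h) (lin_ext_is_linear h).

Lemma lin_extU h x : lin_ext h << x >> = h x.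
Proof.
by rewrite (@lin_extEw h [fset x]%fset) ?msuppU_le // big_seq_fset1 mcoeffUU scale1r.
Qed.

Lemma malg_basis (g : {malg k[K]}) : g = \sum_(x <- msupp g) g@_x *: << x >>.
Proof.
rewrite {1}(monalgE g); apply: eq_bigr => x _.
by apply/malgP => z; rewrite mcoeffZ !mcoeffU mulr_natr.
Qed.

Lemma malg_linP (f g : {linear {malg k[K]} -> W}) :
  (forall x, f << x >> = g << x >>) -> f =1 g.
Proof.
move=> fg x; rewrite (malg_basis x) !raddf_sum; apply: eq_bigr => y _.
by rewrite [LHS]linearZ_LR [RHS]linearZ_LR fg.
Qed.
End LinearExtension.

Section Complex.
Variable k : fieldType.

Section Multilinear.
Variables (aug : bool) (A : alg k) (p : nat).
Let D := decor aug A p.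

Definition multilinear_rel (x : {malg k[D]}) : Prop :=
  exists (u v : seq A) (a b : A) (c : k) (s : p.-tuple mor) (d d1 d2 : D),
    [/\ val d = (u ++ (c *: a + b) :: v, s),
        val d1 = (u ++ a :: v, s),
        val d2 = (u ++ b :: v, s) &
        x = << d >> - c *: << d1 >> - << d2 >>].

(* The direct sum, over the p-simplices n_0 -> ... -> n_p of the nerve, of the
   tensor powers of A with n_0 factors: the free module on the decorated
   p-simplices modulo multilinearity in the coefficients.  *)
Definition bar_mod : lmodType k := lquot (span multilinear_rel).
Definition bar_gen (d : D) : bar_mod := lpi (span multilinear_rel) << d >>.

Lemma bar_genD u v a b c s (d d1 d2 : D) :
  val d = (u ++ (c *: a + b) :: v, s) -> val d1 = (u ++ a :: v, s) ->
  val d2 = (u ++ b :: v, s) -> bar_gen d = c *: bar_gen d1 + bar_gen d2.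
Proof.
move=> dE d1E d2E; apply/eqP; rewrite -subr_eq0 opprD addrA -lpiZ -!raddfB /=.
by apply/eqP/lpi0/span_gen; exists u, v, a, b, c, s, d, d1, d2.
Qed.

Definition multilinear_map (W : lmodType k) (h : D -> W) : Prop :=
  forall u v a b c s (d d1 d2 : D),
    val d = (u ++ (c *: a + b) :: v, s) -> val d1 = (u ++ a :: v, s) ->
    val d2 = (u ++ b :: v, s) -> h d = c *: h d1 + h d2.

Lemma bar_ext_ker (W : lmodType k) (h : D -> W) : multilinear_map h ->
  forall x, x \in span multilinear_rel -> lin_ext h x = 0.
Proof.
move=> hM; apply: span_ker => x [u [v [a [b [c [s [d [d1 [d2]]]]]]]]].
move=> [dE d1E d2E ->]; rewrite !linearB linearZ /= !lin_extU.
by rewrite (hM _ _ _ _ _ _ _ _ _ dE d1E d2E) addrAC addrK subrr.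
Qed.

Definition bar_ext (W : lmodType k) (h : D -> W) (hM : multilinear_map h) :
  {linear bar_mod -> W} := lquot_map (lin_ext h) (bar_ext_ker hM).

Lemma bar_extE (W : lmodType k) (h : D -> W) (hM : multilinear_map h) d :
  bar_ext hM (bar_gen d) = h d.
Proof. exact: etrans (lquot_mapE _ _) (lin_extU _ _). Qed.

Lemma bar_ind (P : bar_mod -> Prop) : P 0 ->
  (forall c d x, P x -> P (c *: bar_gen d + x)) -> forall x, P x.
Proof.
move=> P0 PD x; rewrite -[x]lreprK; move: (lrepr x) => {x} g.
rewrite (malg_basis g); elim: (enum_fset _) => [|d r IH].
  by rewrite big_nil raddf0.
rewrite big_cons lpiD lpiZ -/(bar_gen d); move: IH; set y := lpi _ _.
exact: PD.
Qed.

Lemma bar_linP (W : lmodType k) (f g : {linear bar_mod -> W}) :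
  (forall d, f (bar_gen d) = g (bar_gen d)) -> f =1 g.
Proof.
move=> fg x; rewrite -[x]lreprK.
exact: (@malg_linP _ _ _ (f \o lpi _) (g \o lpi _)).
Qed.
End Multilinear.

Section Functoriality.
Variables (X : salg k).

Fact bar_pull_multilinear aug p q (th : dmap q p) :
  multilinear_map (fun d : decor aug (X p) p => bar_gen (decor_pull th d)).
Proof.
move=> u v a b c s d d1 d2 dE d1E d2E.
have /andP[_ ds] := decorP d.
have n1 : size d1.1 = size d.1 by rewrite [X in size X.1]d1E dE !size_cat.
have n2 : size d2.1 = size d.1 by rewrite [X in size X.1]d2E dE !size_cat.
have := is_mor_arrow ds (leq0n (dnat th 0)); rewrite vertex0.
set f := arrow _ _ _ _ => df.
have [|U [l [r [V slot]]]] := @Bsym_slot k (X q) f (map (salg_act X th) u)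
  (map (salg_act X th) v).
  by move: df; rewrite dE /= size_cat !size_map.
apply: (@bar_genD _ _ _ U V (l * salg_act X th a * r) (l * salg_act X th b * r) c
  (Tuple (size_chain_pull (size d.1) s (dnat th) q))).
- rewrite /= /decor_pull_def; congr (_, _).
    rewrite -/f dE /= map_cat /= slot linearP /=.
    by rewrite mulrDr mulrDl -algZAr -algZAl.
  by apply: val_inj; rewrite /= dE.
- rewrite /= /decor_pull_def n1; congr (_, _).
    have -> : d1.2 = d.2 by rewrite [X in X.2]d1E dE.
    by rewrite -/f d1E /= map_cat /= slot.
  by apply: val_inj; rewrite /= d1E.
- rewrite /= /decor_pull_def n2; congr (_, _).
    have -> : d2.2 = d.2 by rewrite [X in X.2]d2E dE.
    by rewrite -/f d2E /= map_cat /= slot.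
  by apply: val_inj; rewrite /= d2E.
Qed.

Definition bar_act aug p q (th : dmap q p) :
    {linear bar_mod aug (X p) p -> bar_mod aug (X q) q} :=
  bar_ext (@bar_pull_multilinear aug p q th).

Lemma bar_act_gen aug p q (th : dmap q p) (d : decor aug (X p) p) :
  bar_act aug th (bar_gen d) = bar_gen (decor_pull th d).
Proof. exact: bar_extE. Qed.

Fact bar_act_id aug p (x : bar_mod aug (X p) p) :
  bar_act aug (dmap_id p) x = x.
Proof.
apply: (@bar_linP _ _ _ _ _ idfun) => d.
by rewrite bar_act_gen decor_pull_id.
Qed.

Fact bar_act_comp aug r q p (th : dmap q p) (et : dmap r q)
    (x : bar_mod aug (X p) p) :
  bar_act aug (dmap_comp th et) x = bar_act aug et (bar_act aug th x).
Proof.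
apply: (@bar_linP _ _ _ _ _ (bar_act aug et \o bar_act aug th)) => d.
by rewrite [RHS](congr1 (bar_act aug et) (bar_act_gen th d)) !bar_act_gen decor_pull_comp.
Qed.

(* k[N(- | C)] (x)_C B_sym(X) for C = Delta S_+ or C = Delta S, that is, the
   standard model of k (x)^L_C B_sym(X); when X is not constant, this is the
   diagonal of the bisimplicial module so obtained.  *)
Definition bar_smod aug : smod k :=
  Smod (@bar_act_id aug) (@bar_act_comp aug).

End Functoriality.
End Complex.

Section BarAlgebra.
Variable k : fieldType.

Section MonoidAlgebra.
Variable K : monomType.
Fact malg_scaleAr (c : k) (x y : {malg k[K]}) : c *: (x * y) = x * (c *: y).
Proof.
apply/malgP => z; rewrite mcoeffZ (mcoeffMlw _ (fsubset_refl _) (fsubset_refl _)).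
rewrite (mcoeffMlw _ (fsubset_refl _) (msuppZ_le c y)) mulr_sumr.
apply: eq_bigr => i _; rewrite mulr_sumr; apply: eq_bigr => j _.
by rewrite mcoeffZ mulrnAr mulrCA.
Qed.

Definition malg_alg : alg k :=
  @Alg k {malg k[K]} 1 *%R (@mulrA _) (@mul1r _) (@mulr1 _) (@mulrDl _)
    (@mulrDr _) (@scalerAl _ _) malg_scaleAr.
End MonoidAlgebra.

Section Monoid.
Variables (A : alg k) (p : nat).
Local Notation D := (decor true A p).

Fact decor_oneP : is_decor true (([::], nseq_tuple p [::]) : seq A * p.-tuple mor).
Proof. by rewrite /is_decor /=; elim: (p). Qed.
Definition decor_one : D := Decor decor_oneP.

Fact size_tuple_chain_sum (s t : p.-tuple mor) : size (chain_sum s t) == p.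
Proof. by rewrite size_chain_sum !size_tuple. Qed.

Fact decor_sumP (x y : D) :
  is_decor true (x.1 ++ y.1, Tuple (size_tuple_chain_sum x.2 y.2)).
Proof.
rewrite /is_decor /= size_cat is_chain_sum ?size_tuple //.
  by have /andP[] := decorP x.
by have /andP[] := decorP y.
Qed.
Definition decor_sum (x y : D) : D := Decor (decor_sumP x y).

Fact decor_sumA : associative decor_sum.
Proof.
move=> x y z; apply: val_inj; congr (_, _); first exact: catA.
by apply: val_inj; apply: chain_sumA.
Qed.

Fact decor_1sum : left_id decor_one decor_sum.
Proof.
move=> [[a s] aP]; apply: val_inj; congr (_, _); apply: val_inj => /=.
apply: (@eq_from_nth _ [::]); first by rewrite size_chain_sum !size_tuple ?size_nseq.
move=> i _; rewrite nth_chain_sum ?size_nseq ?size_tuple //.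
by rewrite nth_nseq if_same mor_0sum.
Qed.

Fact decor_sum1 : right_id decor_one decor_sum.
Proof.
move=> [[a s] aP]; apply: val_inj; congr (_, _); first by rewrite /= cats0.
apply: val_inj => /=.
apply: (@eq_from_nth _ [::]); first by rewrite size_chain_sum !size_tuple ?size_nseq.
move=> i _; rewrite nth_chain_sum ?size_nseq ?size_tuple //.
by rewrite nth_nseq if_same mor_sum0.
Qed.

Fact decor_sum_eq1 x y :
  decor_sum x y = decor_one -> x = decor_one /\ y = decor_one.
Proof.
case: x y => [[a s] aP] [[b t] bP] /(congr1 val) [].
case: a aP => // aP; case: b bP => //= bP _ E.
have nthE i : nth [::] s i = [::] /\ nth [::] t i = [::].
  have := congr1 (fun u => nth [::] u i) E.
  rewrite nth_chain_sum ?size_tuple // nth_nseq if_same /mor_sum.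
  by case: (nth _ s i) => //=; case: (nth _ t i).
have nilE (u : p.-tuple mor) : (forall i, nth [::] u i = [::]) -> 
    u = nseq_tuple p [::].
  move=> uE; apply: val_inj; apply: (@eq_from_nth _ [::]) => [|i _] /=.
    by rewrite size_tuple size_nseq.
  by rewrite uE nth_nseq if_same.
by split; apply: val_inj; congr (_, _); apply: nilE => i; case: (nthE i).
Qed.

HB.instance Definition _ := Choice_isMonomialDef.Build D
  decor_sumA decor_1sum decor_sum1 decor_sum_eq1.
End Monoid.

Lemma malgU_mul (K : monomType) (x y : K) :
  (<< x >> * << y >> : {malg k[K]}) = << mmul x y >>.
Proof. by rewrite malgM_def fgmulUU mulr1. Qed.

Lemma alg_morph_span (A B : alg k) (G : A -> Prop) (f : {linear A -> B}) :
  (forall x, x \in span G) ->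
  (forall x y, G x -> G y -> f (x * y) = f x * f y) ->
  {morph f : x y / x * y}.
Proof.
move=> spanG fM x y; have /asboolP := spanG x; elim=> [|c g z Gg _ IHx].
  by rewrite mul0r raddf0 mul0r.
rewrite mulrDl -algZAl !linearP mulrDl IHx -algZAl; congr (_ *: _ + _).
have /asboolP := spanG y; elim=> [|b h w Gh _ IHy].
  by rewrite mulr0 raddf0 mulr0.
by rewrite mulrDr -algZAr !linearP mulrDr IHy -algZAr fM.
Qed.

Section TwoSided.
Variables (A : alg k) (p : nat).
Local Notation D := (decor true A p).
Local Notation M := (malg_alg D).
Local Notation rel := (@multilinear_rel k true A p).

Fact multilinear_rel_mul (x y : D) (g : {malg k[D]}) :
  rel g -> rel (<< x >> * g * << y >>).
Proof.
move=> [u [v [a [b [c [s [d [d1 [d2 [dE d1E d2E ->]]]]]]]]]].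
exists (x.1 ++ u), (v ++ y.1), a, b, c,
  (Tuple (size_tuple_chain_sum (Tuple (size_tuple_chain_sum x.2 s)) y.2)),
  (decor_sum (decor_sum x d) y), (decor_sum (decor_sum x d1) y),
  (decor_sum (decor_sum x d2) y).
split; first 1 last.
- by rewrite /= d1E /= -!catA.
- by rewrite /= d2E /= -!catA.
- rewrite !mulrBr !mulrBl -malg_scaleAr -scalerAl !malgU_mul.
  by [].
by rewrite /= dE /= -!catA.
Qed.

Lemma span_multilinear_mul (u x v : {malg k[D]}) :
  x \in span rel -> u * x * v \in span rel.
Proof.
move=> /asboolP; elim=> {x} [|c g x relg _ IH].
  by rewrite mulr0 mul0r rpred0.
have -> : u * (c *: g + x) * v = c *: (u * g * v) + u * x * v.
  by rewrite mulrDr mulrDl -malg_scaleAr -scalerAl.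
have [_ linU] := span_closed rel.
apply: linU; last by exact: IH.
rewrite (malg_basis u) (malg_basis v) mulr_sumr mulr_suml {IH}.
apply: rpred_sum => y _; rewrite !mulr_suml; apply: rpred_sum => z _.
rewrite -malg_scaleAr -!scalerAl; apply: rpredZ; apply: rpredZ.
by apply: span_gen; apply: multilinear_rel_mul.
Qed.

Fact multilinear_two_sided : @two_sided k M (span rel).
Proof. exact: span_multilinear_mul. Qed.

Definition bar_alg : alg k := aquot multilinear_two_sided.

Definition bar_agen (x : D) : bar_alg := bar_gen x.

Lemma bar_agenM (x y : D) :
  bar_agen x * bar_agen y = bar_agen (decor_sum x y).
Proof.
rewrite /bar_agen /bar_gen -malgU_mul.
exact: esym (apiM multilinear_two_sided _ _).
Qed.

Lemma bar_agen1 : 1 = bar_agen (decor_one A p).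
Proof. by []. Qed.

Lemma bar_agen_span (x : bar_alg) : x \in span (fun y => exists d, y = bar_agen d).
Proof.
move: x; apply: bar_ind => [|c d x /asboolP xP]; apply/asboolP.
  exact: spanned0.
by apply: spannedD => //; exists d.
Qed.

Lemma bar_alg_morphP (B : alg k) (f : {linear bar_alg -> B}) :
  (forall x y, f (bar_agen x * bar_agen y) = f (bar_agen x) * f (bar_agen y)) ->
  {morph f : x y / x * y}.
Proof.
by move=> fM; apply: (alg_morph_span bar_agen_span) => _ _ [x ->] [y ->].
Qed.
End TwoSided.

Section Simplicial.
Variable X : salg k.

Fact decor_pull_one p q (th : dmap q p) :
  decor_pull th (decor_one (X p) p) = decor_one (X q) q.
Proof.
have v0 i : vertex 0 (nseq p [::]) i = 0%N.
  by rewrite /vertex; elim: (p) i => [|m IH] [|i] //=.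
have aE i j : (i <= j)%N -> arrow 0 (nseq p [::]) i j = [::].
  by move=> le_ij; apply: size0nil; rewrite size_arrow.
apply: val_inj; rewrite /= /decor_pull_def /= aE //; congr (_, _).
apply: val_inj; apply: (@eq_from_nth _ [::]) => /= [|i].
  by rewrite size_mkseq size_nseq.
rewrite size_mkseq => lt_iq; rewrite nth_mkseq // aE ?dnat_mono //.
by rewrite nth_nseq if_same.
Qed.

Fact decor_pull_sum p q (th : dmap q p) (x y : decor true (X p) p) :
  decor_pull th (decor_sum x y) = decor_sum (decor_pull th x) (decor_pull th y).
Proof.
have /andP[_ xP] := decorP x; have /andP[_ yP] := decorP y.
apply: val_inj; rewrite /= /decor_pull_def /=; congr (_, _).
  rewrite size_cat arrow_sum ?size_tuple // map_cat Bsym_sum //.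
  by rewrite size_map; have := is_mor_arrow xP (leq0n (dnat th 0)); rewrite vertex0.
apply: val_inj; rewrite /= size_cat chain_pull_sum ?size_tuple //.
exact: dnat_mono.
Qed.

End Simplicial.
End BarAlgebra.

Section Bar.
Variable k : fieldType.

Section BarAlg.
Variable X : salg k.

Local Notation act th := (bar_act X true th).

Fact bar_salg_act1 p q (th : dmap q p) :
  (act th : bar_alg (X p) p -> bar_alg (X q) q) 1 = 1.
Proof. by rewrite bar_agen1 [LHS]bar_act_gen decor_pull_one. Qed.

Fact bar_salg_actM p q (th : dmap q p) :
  {morph (act th : bar_alg (X p) p -> bar_alg (X q) q) : x y / x * y}.
Proof.
apply: (@bar_alg_morphP _ _ _ _ (act th : {linear bar_alg (X p) p -> bar_alg (X q) q})).
move=> x y; rewrite bar_agenM.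
transitivity (bar_agen (decor_sum (decor_pull th x) (decor_pull th y))).
  by rewrite -decor_pull_sum; apply: bar_act_gen.
by rewrite -bar_agenM; congr (_ * _); apply/esym/bar_act_gen.
Qed.

(* CX, with the product given by the sum of chains and the tensor product of
   coefficients.  *)
Definition bar_salg : salg k :=
  @Salg k (fun p => bar_alg (X p) p) (fun q p th => act th)
    (fun q p th => bar_salg_act1 th) (fun q p th => @bar_salg_actM p q th)
    (@bar_act_id k X true) (@bar_act_comp k X true).

Fact decor_inclP p (d : decor false (X p) p) : is_decor true d.
Proof. by have /andP[_] := decorP d. Qed.
Definition decor_incl p (d : decor false (X p) p) : decor true (X p) p :=
  Decor (decor_inclP d).

Fact bar_incl_multilinear p :
  multilinear_map (fun d : decor false (X p) p => bar_gen (decor_incl d)).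
Proof.
move=> u v a b c s d d1 d2 dE d1E d2E.
exact: (@bar_genD _ _ _ _ u v a b c s).
Qed.

Definition bar_incl_fun p :
    {linear bar_mod false (X p) p -> bar_mod true (X p) p} :=
  bar_ext (@bar_incl_multilinear p).

Fact bar_incl_nat q p (th : dmap q p) (x : bar_mod false (X p) p) :
  bar_incl_fun q (bar_act X false th x) = act th (bar_incl_fun p x).
Proof.
apply: (@bar_linP _ _ _ _ _ (bar_incl_fun q \o bar_act X false th)
  (act th \o bar_incl_fun p)) => d.
rewrite [LHS](congr1 _ (bar_act_gen th d)) [LHS]bar_extE.
rewrite [RHS](congr1 _ (bar_extE _ d)) [RHS]bar_act_gen.
by congr bar_gen; apply: val_inj.
Qed.

Definition bar_incl : smap (bar_smod X false) bar_salg :=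
  @Smap k (bar_smod X false) bar_salg bar_incl_fun bar_incl_nat.

End BarAlg.

Section BarMap.
Variables (X Y : salg k) (f : samap X Y).

Fact decor_mapP aug p (d : decor aug (X p) p) :
  is_decor aug (map (f p) d.1, d.2).
Proof. by rewrite /is_decor /= size_map; apply: decorP d. Qed.
Definition decor_map aug p (d : decor aug (X p) p) : decor aug (Y p) p :=
  Decor (decor_mapP d).

Fact bar_map_multilinear aug p :
  multilinear_map (fun d : decor aug (X p) p => bar_gen (decor_map d)).
Proof.
move=> u v a b c s d d1 d2 dE d1E d2E.
apply: (@bar_genD _ _ _ _ (map (f p) u) (map (f p) v) (f p a) (f p b) c s).
- by rewrite /= dE /= map_cat /= linearP.
- by rewrite /= d1E /= map_cat.
- by rewrite /= d2E /= map_cat.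
Qed.

Definition bar_map_fun aug p :
    {linear bar_mod aug (X p) p -> bar_mod aug (Y p) p} :=
  bar_ext (@bar_map_multilinear aug p).

Fact bar_map_nat aug q p (th : dmap q p) (x : bar_mod aug (X p) p) :
  bar_map_fun aug q (bar_act X aug th x) = bar_act Y aug th (bar_map_fun aug p x).
Proof.
apply: (@bar_linP _ _ _ _ _ (bar_map_fun aug q \o bar_act X aug th)
  (bar_act Y aug th \o bar_map_fun aug p)) => d.
rewrite [LHS](congr1 _ (bar_act_gen th d)) [LHS]bar_extE.
rewrite [RHS](congr1 _ (bar_extE _ d)) [RHS]bar_act_gen.
congr bar_gen; apply: val_inj; rewrite /= /decor_pull_def /= size_map.
congr (_, _); rewrite Bsym_map; first last.
- rewrite size_map; have /andP[_ dP] := decorP d.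
  by have := is_mor_arrow dP (leq0n (dnat th 0)); rewrite vertex0.
- exact: samapM.
- exact: samap1.
rewrite -!map_comp; congr Bsym; apply: eq_map => y /=.
exact: samap_nat.
Qed.

Definition bar_map aug : smap (bar_smod X aug) (bar_smod Y aug) :=
  @Smap k (bar_smod X aug) (bar_smod Y aug) (bar_map_fun aug)
    (@bar_map_nat aug).
End BarMap.
End Bar.

Section Abelianization.
Variable k : fieldType.

Lemma ab_pi1 (A : alg k) : ab_pi (1 : A) = 1.
Proof. exact: api1. Qed.
Lemma ab_piM (A : alg k) : {morph @ab_pi k A : x y / x * y}.
Proof. exact: apiM. Qed.
Lemma ab_pi_comm (A : alg k) (a b : A) : ab_pi (a * b) = ab_pi (b * a).
Proof.
apply/lpi_eq/span_gen; exists 1, (a * b - b * a), 1.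
by rewrite mul1r mulr1; split => //; exists a, b.
Qed.

Lemma ab_mulC (A : alg k) : commutative (@GRing.mul (abelianization A)).
Proof.
move=> x y; have [a ->] : exists a, x = ab_pi a.
  by exists (lrepr x); rewrite [RHS]lreprK.
have [b ->] : exists b, y = ab_pi b by exists (lrepr y); rewrite [RHS]lreprK.
by rewrite -!ab_piM ab_pi_comm.
Qed.

Section Map.
Variables (A B : alg k) (f : {linear A -> B}).
Hypothesis fM : {morph f : x y / x * y}.

Fact ab_map_ker x : x \in @comm_ideal k A -> (@ab_pi k B \o f) x = 0.
Proof.
apply: span_ker => _ [u [_ [v [[a [b ->]] ->]]]] /=.
have -> : f (u * (a * b - b * a) * v) = f u * (f a * f b - f b * f a) * f v.
  by rewrite 2!fM [f (_ - _)]linearB [X in X - _]fM [X in _ - X]fM.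
rewrite 2!ab_piM [ab_pi (_ - _)]linearB [X in X - _]ab_pi_comm subrr.
by rewrite mulr0 mul0r.
Qed.

Definition ab_map :
  {linear abelianization A -> abelianization B} :=
  lquot_map (@ab_pi k B \o f) ab_map_ker.

End Map.

Lemma ab_mapE (A B : alg k) (f : {linear A -> B})
    (fM : {morph f : x y / x * y}) x : ab_map fM (ab_pi x) = ab_pi (f x).
Proof. exact: lquot_mapE. Qed.

Section AbSalg.
Variable X : salg k.

Definition ab_act q p (th : dmap q p) :
    {linear abelianization (X p) -> abelianization (X q)} :=
  ab_map (@salg_actM k X q p th).

Lemma ab_actE q p (th : dmap q p) x :
  ab_act th (ab_pi x) = ab_pi (salg_act X th x).
Proof. exact: ab_mapE. Qed.

Lemma ab_piK (A : alg k) (x : abelianization A) : exists y, x = ab_pi y.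
Proof. by exists (lrepr x); rewrite [RHS]lreprK. Qed.

Fact ab_act1 q p (th : dmap q p) : ab_act th 1 = 1.
Proof. by rewrite -ab_pi1 ab_actE salg_act1. Qed.
Fact ab_actM q p (th : dmap q p) : {morph ab_act th : x y / x * y}.
Proof.
move=> x y; have [a ->] := ab_piK x; have [b ->] := ab_piK y.
by rewrite -ab_piM !ab_actE salg_actM ab_piM.
Qed.
Fact ab_act_id p (x : abelianization (X p)) : ab_act (dmap_id p) x = x.
Proof. by have [a ->] := ab_piK x; rewrite ab_actE salg_act_id. Qed.
Fact ab_act_comp r q p (th : dmap q p) (et : dmap r q) x :
  ab_act (dmap_comp th et) x = ab_act et (ab_act th x).
Proof. by have [a ->] := ab_piK x; rewrite !ab_actE salg_act_comp. Qed.

Definition ab_salg : salg k :=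
  @Salg k (fun p => abelianization (X p)) (fun q p th => ab_act th)
    ab_act1 ab_actM ab_act_id ab_act_comp.

Definition decor_prod p (d : decor false (X p) p) : abelianization (X p) :=
  ab_pi (\prod_(a <- d.1) a).

Fact decor_prod_multilinear p : multilinear_map (@decor_prod p).
Proof.
move=> u v a b c s d d1 d2 dE d1E d2E.
rewrite /decor_prod dE d1E d2E /= !big_cat /= !big_cons.
by rewrite mulrDl mulrDr -algZAl -algZAr linearP.
Qed.

Definition bar_aug_fun p :
    {linear bar_mod false (X p) p -> abelianization (X p)} :=
  bar_ext (@decor_prod_multilinear p).

Lemma ab_pi_perm (A : alg k) (s t : seq A) : perm_eq s t ->
  ab_pi (\prod_(a <- s) a) = ab_pi (\prod_(a <- t) a).
Proof.
have catC (u v : seq A) : ab_pi (\prod_(a <- u ++ v) a) = ab_pi (\prod_(a <- v ++ u) a).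
  by rewrite !big_cat; exact: ab_pi_comm.
elim: s t => [|a s IH] t; first by rewrite perm_sym => /perm_nilP->.
move=> ast; have : a \in t by rewrite -(perm_mem ast) mem_head.
move=> /splitPr ta; case: ta ast => t1 t2 ast.
rewrite catC /= !big_cons !ab_piM (IH (t2 ++ t1)) //.
by rewrite -(perm_cons a) (permPl ast) perm_catC.
Qed.

Fact bar_aug_nat q p (th : dmap q p) (x : bar_mod false (X p) p) :
  bar_aug_fun q (bar_act X false th x) = ab_act th (bar_aug_fun p x).
Proof.
apply: (@bar_linP _ _ _ _ _ (bar_aug_fun q \o bar_act X false th)
  (ab_act th \o bar_aug_fun p)) => d.
rewrite [LHS](congr1 _ (bar_act_gen th d)) [LHS]bar_extE.
rewrite [RHS](congr1 _ (bar_extE _ d)) [RHS]ab_actE /decor_prod /=.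
rewrite (big_morph _ (@salg_actM k X q p th) (@salg_act1 k X q p th)).
set f := arrow _ _ _ _; set b := map _ _.
have df : is_mor (size d.1) f.
  have /andP[_ dP] := decorP d.
  by have := is_mor_arrow dP (leq0n (dnat th 0)); rewrite vertex0.
have -> : \prod_(a <- Bsym f b) a = \prod_(a <- [seq b`_i | i <- flatten f]) a.
  by rewrite /Bsym !big_map big_flatten.
rewrite -(big_map (salg_act X th) predT id); apply: ab_pi_perm.
rewrite -[X in perm_eq _ X](mkseq_nth 0) size_map /mkseq.
exact: perm_map.
Qed.

(* The canonical map from k (x)^L_(Delta S) B_sym(X) to the tensor product
   k (x)_(Delta S) B_sym(X) = X_ab.  *)
Definition bar_aug : smap (bar_smod X false) ab_salg :=
  @Smap k (bar_smod X false) ab_salg bar_aug_fun bar_aug_nat.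

End AbSalg.
End Abelianization.

Section Main.
Variable k : fieldType.

(* A is the free (tensor) algebra on the set S of elements of A. *)
Definition free_on (A : alg k) (S : A -> Prop) : Prop :=
  forall (B : alg k) (g : A -> B),
    (exists2 f : A -> B, alg_hom f & forall x, S x -> f x = g x) /\
    (forall f f' : A -> B, alg_hom f -> alg_hom f' ->
       (forall x, S x -> f x = f' x) -> f =1 f').

(* The iterated degeneracies are the operators induced by the monotone
   surjections.  *)
Definition semi_free (X : salg k) : Prop :=
  exists S : forall n, X n -> Prop,
    (forall n, free_on (S n)) /\
    (forall m n (th : dmap m n), (forall j, exists i, th i = j) ->
       forall x, S n x -> S m (salg_act X th x)).

Record resolution (A : alg k) := Resolution {
  res_salg :> salg k;
  res_map : samap res_salg (const_salg A);
  res_semi_free : semi_free res_salg;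
  res_weak_equiv : weak_equiv res_map }.

(* The inverse of f, when f is bijective. *)
Definition preimage (U V : lmodType k) (f : U -> V) (y : V) : U :=
  if pselect (exists x, f x = y) is left ex then projT1 (cid ex) else 0.

(* The symmetric homology Tor^(Delta S)(k, B_sym(X)) and its comparison with
   the homotopy of CX.  *)
Definition HS_mod (X : salg k) (n : nat) : lmodType k :=
  homology (bar_smod X false) n.

Definition HS_incl (X : salg k) n :
    HS_mod X n -> homotopy_galg (bar_salg X) n :=
  @hmap k (bar_smod X false) (bar_salg X) (bar_incl X) n.

(* The unit and the product are those of the homotopy of CA, transported along
   the isomorphism HS_incl.  *)
Definition HS (A : alg k) : galg k :=
  let X := const_salg A in
  let G := homotopy_galg (bar_salg X) in
  @Galg k (HS_mod X) (preimage (@HS_incl X 0) (galg_one G))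
    (fun p q n x y => preimage (@HS_incl X n)
       (galg_mul n (@HS_incl X p x) (@HS_incl X q y))).

Definition HR (X : salg k) : galg k := homotopy_galg (ab_salg X).

(* The map on homology induced by bar_aug R, precomposed with the inverse of
   the isomorphism HS(R) -> HS(A) induced by the resolution.  *)
Definition SR (A : alg k) (R : resolution A) (n : nat) (x : HS A n) : HR R n :=
  hmap (bar_aug R)
    (preimage (@hmap k _ _ (bar_map (res_map R) false) n) x).
End Main.

(* Main.v *)
(* Both arrows below are weak equivalences of simplicial modules, where CR and R_ab
   are simplicial algebras and the second arrow is a map of such:
     k (x)^L_(Delta S) B_sym(R) --> CR --> R_ab.
   First arrow: its image is an ideal of CR containing the vertex u = 1 in A = B_sym([0]),
   which the edge [-1] -> [0] joins to the unit, so multiplication by u is homotopic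
   to the identity by the Leibniz rule for the shuffle product.
   Second arrow: a bisimplicial module with acyclic columns has an acyclic diagonal
   (dimension shifting along based path objects), so R may be replaced by one free
   algebra F.  A tensor of words in F is the image of the tensor of its letters under
   a morphism of Delta S_+ that is unique up to the m! orderings of the letters;
   averaging over these, which is possible in characteristic 0, gives an extra
   degeneracy contracting CF onto F_ab.
   Replacing A by R: over a field the augmentation R -> A admits an extra
   degeneracy compatible with faces, whose tensor powers contract R^(x)n onto A^(x)n;
   the diagonal argument applies again.
   The products match because all maps come from maps of simplicial algebras, and
   HS(A) is graded commutative because R_ab is commutative. *)
Require Import Defs.
From HB Require Import structures.
From mathcomp Require Import all_boot all_algebra.
From mathcomp Require classical_sets.
From mathcomp Require Import boolp monalg zify.

Set Implicit Arguments.
Unset Strict Implicit.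
Unset Printing Implicit Defensive.
Import GRing.Theory.
Local Open Scope ring_scope.

(** * Simplicial modules *)

(** Neither contraction lives on the diagonal. The extra degeneracy of [R -> A] is only linear, so
    it need not commute with the nerve operators, which multiply factors; the symmetrizing
    contraction of [CF] depends on chosen generators, so it need not commute with the algebra maps
    between the levels of [R]. Each contracts one direction of a bisimplicial module while the other
    index is fixed, and both comparison maps are treated through their kernels by the same diagonal
    argument, with the two directions exchanged. The simplicial bookkeeping rests on one operation,
    adjoining a first vertex ([dcone]). It yields the decalage, in which [d_0] becomes a projection
    and [s_0] a contraction; the vanishing of [bd (bd x)], the shuffle identities and the diagonal
    argument are inductions that trade one degree for one decalage. Since the product is available
    only on [CA], over Delta S_+, the augmentation is extended to an algebra map [CR -> R_ab], and
    [SR] is compared with it. *)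

Lemma dmap_eqP m n (f g : dmap m n) :
  (forall i : 'I_m.+1, f i = g i :> nat) -> f = g.
Proof. by move=> fg; apply/val_inj/ffunP => i; apply/val_inj/fg. Qed.

Lemma dmap_idE n (i : 'I_n.+1) : dmap_id n i = i.
Proof. by rewrite ffunE. Qed.

Lemma dmap_compE l m n (g : dmap m n) (f : dmap l m) i :
  dmap_comp g f i = g (f i).
Proof. by rewrite ffunE. Qed.

Lemma dmap_comp1l m n (f : dmap m n) : dmap_comp (dmap_id n) f = f.
Proof. by apply: dmap_eqP => i; rewrite dmap_compE dmap_idE. Qed.
Lemma dmap_comp1r m n (f : dmap m n) : dmap_comp f (dmap_id m) = f.
Proof. by apply: dmap_eqP => i; rewrite dmap_compE dmap_idE. Qed.

(* The join of a map with the identity of an additional first vertex. *)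
Fact dcone_mono m n (f : dmap m n) :
  monotone [ffun i : 'I_m.+2 => oapp (fun j => lift ord0 (f j)) ord0 (unlift ord0 i)].
Proof.
apply: monotone_finfun => i j.
case: (unliftP ord0 i) => [i'|] ->; case: (unliftP ord0 j) => [j'|] -> //=.
by rewrite /bump /= !add1n !ltnS; apply: dmap_mono.
Qed.
Definition dcone m n (f : dmap m n) : dmap m.+1 n.+1 := Dmap (dcone_mono f).

Lemma dcone0 m n (f : dmap m n) : dcone f ord0 = ord0.
Proof. by rewrite ffunE unlift_none. Qed.

Lemma dcone_lift m n (f : dmap m n) i : dcone f (lift ord0 i) = lift ord0 (f i).
Proof. by rewrite ffunE liftK. Qed.

Lemma dcone_id n : dcone (dmap_id n) = dmap_id n.+1.
Proof.
apply: dmap_eqP => i; rewrite dmap_idE.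
by case: (unliftP ord0 i) => [j|] ->; rewrite ?dcone0 // dcone_lift dmap_idE.
Qed.

Lemma dcone_comp l m n (g : dmap m n) (f : dmap l m) :
  dcone (dmap_comp g f) = dmap_comp (dcone g) (dcone f).
Proof.
apply: dmap_eqP => i; rewrite dmap_compE.
case: (unliftP ord0 i) => [j|] ->; rewrite ?dcone0 //.
by rewrite !dcone_lift dmap_compE.
Qed.

(** With natural indices the simplicial identities become arithmetic on [bump] and [unbump], within
    reach of [lia]. *)
Definition fc n (i : nat) : dmap n n.+1 := coface (inord i : 'I_n.+2).

Lemma fcE n i (j : 'I_n.+1) : (i <= n.+1)%N -> fc n i j = bump i j :> nat.
Proof. by move=> le_in; rewrite ffunE /= inordK. Qed.

(** The truncation by [n] is inactive for [i <= n]; it keeps the value in range for larger [i], so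
    that monotonicity holds for every natural [i]. *)
Fact dg_mono n (i : nat) :
  monotone [ffun j : 'I_n.+2 => inord (minn n (unbump i j)) : 'I_n.+1].
Proof.
apply: monotone_finfun => j l le_jl; rewrite !inordK ?ltnS ?geq_minl //.
by move: le_jl; rewrite /unbump; lia.
Qed.
Definition dg n (i : nat) : dmap n.+1 n := Dmap (dg_mono n i).

Lemma dgE n i (j : 'I_n.+2) : (i <= n)%N -> dg n i j = unbump i j :> nat.
Proof.
move=> le_in; rewrite ffunE /= inordK ?ltnS ?geq_minl //.
by have := ltn_ord j; rewrite /unbump; lia.
Qed.

Lemma fc_fc n i j : (i < j)%N -> (j <= n.+2)%N ->
  dmap_comp (fc n.+1 j) (fc n i) = dmap_comp (fc n.+1 i) (fc n j.-1).
Proof.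
move=> lt_ij le_jn; apply: dmap_eqP => l; rewrite !dmap_compE.
by rewrite !fcE /bump; lia.
Qed.

Lemma dg_fc_lt n i j : (j < i)%N -> (i <= n.+1)%N ->
  dmap_comp (dg n.+1 i) (fc n.+1 j) = dmap_comp (fc n j) (dg n i.-1).
Proof.
move=> lt_ij le_jn; apply: dmap_eqP => l; rewrite !dmap_compE.
by rewrite dgE ?fcE ?dgE /bump /unbump; lia.
Qed.

Lemma dg_fc_id n i j : (i <= j <= i.+1)%N -> (i <= n)%N ->
  dmap_comp (dg n i) (fc n j) = dmap_id n.
Proof.
move=> lt_ij le_jn; apply: dmap_eqP => l; rewrite dmap_compE dmap_idE.
by rewrite dgE ?fcE /bump /unbump; lia.
Qed.

Lemma dg_fc_gt n i j : (i.+1 < j)%N -> (j <= n.+2)%N ->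
  dmap_comp (dg n.+1 i) (fc n.+1 j) = dmap_comp (fc n j.-1) (dg n i).
Proof.
move=> lt_ij le_jn; apply: dmap_eqP => l; rewrite !dmap_compE.
by rewrite dgE ?fcE ?dgE /bump /unbump; lia.
Qed.

Lemma dcone_fc n i : (i <= n.+1)%N -> dcone (fc n i) = fc n.+1 i.+1.
Proof.
move=> le_in; apply: dmap_eqP => j; rewrite fcE //.
case: (unliftP ord0 j) => [l|] ->; rewrite ?dcone0 //.
by rewrite dcone_lift !lift0 fcE // /bump; lia.
Qed.

(** This is the naturality of [d_0] as a map from the decalage to the original object. *)
Lemma dcone_fc0 m n (f : dmap m n) :
  dmap_comp (dcone f) (fc m 0) = dmap_comp (fc n 0) f.
Proof.
apply: dmap_eqP => j; rewrite !dmap_compE fcE //.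
rewrite (_ : fc m 0 j = lift ord0 j) ?dcone_lift //.
by apply: val_inj; rewrite /= fcE.
Qed.

(** Collapsing the adjoined vertex onto the old first vertex commutes with maps that preserve the
    first vertex, as the iterated degeneracies of a shuffle do. *)
Lemma dg0_dcone m n (f : dmap m n) : f ord0 = ord0 ->
  dmap_comp (dg n 0) (dcone f) = dmap_comp f (dg m 0).
Proof.
move=> f0; apply: dmap_eqP => j; rewrite !dmap_compE dgE //.
case: (unliftP ord0 j) => [l|] ->.
  rewrite dcone_lift lift0 /unbump subn1 /=; congr (nat_of_ord (f _)).
  by apply: val_inj; rewrite /= dgE //= /unbump /bump; lia.
rewrite dcone0 (_ : dg m 0 ord0 = ord0) ?f0 //.
by apply: val_inj; rewrite /= dgE.
Qed.

Section Simplicial.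
Variable k : fieldType.

Lemma sact_eq (X : smod k) l m m' n (g : dmap m n) (f : dmap l m)
    (g' : dmap m' n) (f' : dmap l m') (x : X n) :
  dmap_comp g f = dmap_comp g' f' ->
  sact X f (sact X g x) = sact X f' (sact X g' x).
Proof. by move=> e; rewrite -!sact_comp e. Qed.

Fact dec_act_id (X : smod k) n (x : X n.+1) : sact X (dcone (dmap_id n)) x = x.
Proof. by rewrite dcone_id sact_id. Qed.
Fact dec_act_comp (X : smod k) l m n (g : dmap m n) (f : dmap l m) (x : X n.+1) :
  sact X (dcone (dmap_comp g f)) x = sact X (dcone f) (sact X (dcone g) x).
Proof. by rewrite dcone_comp sact_comp. Qed.
(** The decalage: the faces [d_1], [d_2], ... remain, while [d_0] is freed and becomes the map
    [dec_proj] to [X]. *)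
Definition dec (X : smod k) : smod k :=
  @Smod k (fun n => X n.+1) (fun m n f => sact X (dcone f))
    (@dec_act_id X) (@dec_act_comp X).

Section Boundary.
Variable X : smod k.

Lemma bd0 n : bd (0 : X n) = 0.
Proof. exact: linear0. Qed.
Lemma bdB n (x y : X n) : bd (x - y) = bd x - bd y.
Proof. exact: linearB. Qed.
Lemma bdD n (x y : X n) : bd (x + y) = bd x + bd y.
Proof. exact: linearD. Qed.
Lemma bdZ n c (x : X n) : bd (c *: x) = c *: bd x.
Proof. exact: linearZ. Qed.

(** Minus the part of the boundary without [d_0]. It is the boundary of the decalage in positive
    degrees, and in the lowest degree its augmentation [d_1]. *)
Definition bdp n (x : X n.+1) : X n :=
  \sum_(i < n.+1) (-1) ^+ i *: sact X (fc n i.+1) x.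

Lemma bdE n (x : X n.+1) :
  bd x = \sum_(i < n.+2) (-1) ^+ i *: sact X (fc n i) x.
Proof. by apply: eq_bigr => i _; rewrite /fc inord_val. Qed.

Lemma bd_bdp n (x : X n.+1) : bd x = sact X (fc n 0) x - bdp x.
Proof.
rewrite bdE big_ord_recl expr0 scale1r /bdp -sumrN; congr (_ + _).
by apply: eq_bigr => i _; rewrite lift0 exprS mulN1r scaleNr.
Qed.

Lemma bdp1 (x : X 1%N) : bdp x = sact X (fc 0 1) x.
Proof. by rewrite /bdp big_ord1 expr0 scale1r. Qed.

End Boundary.

Lemma bdpE (X : smod k) n (x : X n.+2) : bdp x = @bd k (dec X) n.+1 x.
Proof.
rewrite (@bdE (dec X) n x) /bdp /=.
by apply: eq_bigr => i _; rewrite dcone_fc ?leq_ord.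
Qed.


Lemma smap_bd (X Y : smod k) (f : smap X Y) n (x : X n) :
  f n.-1 (bd x) = bd (f n x).
Proof.
case: n x => [|n] x /=; first exact: raddf0.
rewrite raddf_sum; apply: eq_bigr => i _ /=.
by rewrite [LHS]linearZ /= smap_nat.
Qed.

Fact dec_proj_nat (X : smod k) m n (f : dmap m n) (x : dec X n) :
  sact X (fc m 0) (sact (dec X) f x) = sact X f (sact X (fc n 0) x).
Proof. by apply: sact_eq; rewrite dcone_fc0. Qed.
Definition dec_proj (X : smod k) : smap (dec X) X :=
  @Smap k (dec X) X (fun n => sact X (fc n 0)) (@dec_proj_nat X).

(** Write [bd] as [d_0] minus [bdp]. As [d_0] is a chain map from the decalage, the mixed terms
    cancel, and [bdp] squares to zero by induction applied to the decalage. *)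
Lemma bd_bd (X : smod k) n (x : X n) : bd (bd x) = 0.
Proof.
elim: n X x => [|n IHn] X x; first by [].
rewrite (bd_bdp x); case: n IHn x => [|n] IHn x; first by [].
rewrite bdB.
have <- : sact X (fc n 0) (bdp x) = bd (sact X (fc n.+1 0) x).
  by rewrite bdpE; apply: (smap_bd (dec_proj X) (x : dec X n.+1)).
rewrite (bd_bdp (bdp x)) opprD opprK addrA subrr add0r.
case: n IHn x => [|n] IHn x; last by rewrite [LHS]bdpE bdpE; apply: (IHn (dec X)).
rewrite bdp1 bdpE bdE !big_ord_recl big_ord0 /= expr0 expr1 scale1r scaleN1r.
rewrite addr0 !dcone_fc // raddfB /=.
by rewrite (@sact_eq X _ _ _ _ _ _ (fc 1 2) (fc 0 1)) ?subrr // [RHS]fc_fc.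
Qed.

Lemma bd_bdS (X : smod k) n (x : X n.+1) : @bd k X n (@bd k X n.+1 x) = 0.
Proof. exact: (@bd_bd X n.+1 x). Qed.
(** The homotopy formula for the extra degeneracy [s_0] of the decalage. The use of [bdp] on the
    right covers the lowest degree as well. *)
Lemma bd_dg0 (Y : smod k) n (y : Y n.+1) :
  @bd k (dec Y) n.+1 (sact Y (dg n.+1 0) y) = y - sact Y (dg n 0) (bdp y).
Proof.
transitivity (bdp (sact Y (dg n.+1 0) y)); first by rewrite bdpE.
rewrite /bdp big_ord_recl expr0 scale1r -sact_comp dg_fc_id // sact_id.
congr (_ + _); rewrite raddf_sum -sumrN; apply: eq_bigr => i _ /=.
rewrite (_ : bump 0 i = i.+1) // exprS mulN1r scaleNr; congr (- _).
rewrite (@sact_eq Y _ _ _ _ _ _ (fc n i.+1) (dg n 0)) ?dg_fc_gt // ?ltnS ?leq_ord //.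
exact: esym (linearZ _ _).
Qed.
End Simplicial.

(** * Shuffle products *)

Lemma steps0 n p (mu : {set 'I_n}) : steps p mu ord0 = ord0.
Proof.
apply: val_inj; rewrite ffunE /= inordK ?ltnS ?geq_minl //.
rewrite (_ : [set _ in _ | _] = set0) ?cards0 ?minn0 //.
by apply/setP => i; rewrite !inE ltn0 andbF.
Qed.

Lemma stepsE n p (mu : {set 'I_n}) j :
  steps p mu j = minn p #|[set i in mu | (i < j)%N]| :> nat.
Proof. by rewrite ffunE /= inordK ?ltnS ?geq_minl. Qed.

(** * Shuffles as subsets, decomposed at their first step *)

Section ShuffleSets.
Variable n : nat.
Implicit Types (mu : {set 'I_n}) (b : bool).

Definition set_up b mu : {set 'I_n.+1} :=
  [set i : 'I_n.+1 | oapp (fun j : 'I_n => j \in mu) b (unlift ord0 i)].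
Definition set_down (mu : {set 'I_n.+1}) : {set 'I_n} :=
  [set i | lift ord0 i \in mu].

Lemma in_set_up0 b mu : (ord0 \in set_up b mu) = b.
Proof. by rewrite inE unlift_none. Qed.
Lemma in_set_up_lift b mu i : (lift ord0 i \in set_up b mu) = (i \in mu).
Proof. by rewrite inE liftK. Qed.
Definition in_set_up := (in_set_up0, in_set_up_lift).

Lemma set_upK b : cancel (set_up b) set_down.
Proof. by move=> mu; apply/setP => i; rewrite inE in_set_up. Qed.

Lemma set_downK b (mu : {set 'I_n.+1}) : (ord0 \in mu) = b -> set_up b (set_down mu) = mu.
Proof.
move=> mu0; apply/setP => i.
by case: (unliftP ord0 i) => [j|] ->; rewrite in_set_up // inE.
Qed.

Lemma setC_up b mu : ~: set_up b mu = set_up (~~ b) (~: mu).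
Proof.
apply/setP => i; rewrite inE.
by case: (unliftP ord0 i) => [j|] ->; rewrite !in_set_up ?inE.
Qed.

Lemma card_set_up b mu : #|set_up b mu| = (b + #|mu|)%N.
Proof.
rewrite -!sum1_card big_mkcond [in RHS]big_mkcond big_ord_recl in_set_up.
congr (_ + _)%N.
by apply: eq_bigr => i _; rewrite in_set_up.
Qed.

Lemma card_set_up_lt b mu (j : 'I_n.+1) :
  #|[set i in set_up b mu | (i < lift ord0 j)%N]| =
  (b + #|[set i in mu | (i < j)%N]|)%N.
Proof.
rewrite -card_set_up; apply: eq_card => i.
by case: (unliftP ord0 i) => [l|] ->; rewrite inE !in_set_up ?inE ?andbT // !lift0.
Qed.

Lemma steps_up_true p mu : steps p.+1 (set_up true mu) = dcone (steps p mu).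
Proof.
apply: dmap_eqP => j; case: (unliftP ord0 j) => [l|] ->.
  by rewrite dcone_lift stepsE card_set_up_lt lift0 stepsE; lia.
by rewrite steps0 dcone0.
Qed.

Lemma steps_up_false p mu :
  steps p (set_up false mu) = dmap_comp (dg p 0) (dcone (steps p mu)).
Proof.
apply: dmap_eqP => j; rewrite dmap_compE dgE //.
case: (unliftP ord0 j) => [l|] ->.
  by rewrite dcone_lift stepsE card_set_up_lt lift0 stepsE /unbump; lia.
by rewrite steps0 dcone0.
Qed.

Lemma shuffle_signE m (mu : {set 'I_m}) : shuffle_sign mu =
  (\sum_(i < m) \sum_(j < m) [&& i \in mu, j \notin mu & (j < i)%N])%N.
Proof.
rewrite pair_bigA /shuffle_sign -sum1_card big_mkcond.
by apply: eq_bigr => -[i j] _; rewrite inE /=; case: ifP.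
Qed.

Lemma shuffle_sign_up_true mu :
  shuffle_sign (set_up true mu) = shuffle_sign mu.
Proof.
rewrite !shuffle_signE big_ord_recl big1 ?add0n => [|j _]; last by rewrite ltn0 !andbF.
apply: eq_bigr => i _; rewrite big_ord_recl !in_set_up andbF add0n.
by apply: eq_bigr => j _; rewrite !in_set_up.
Qed.

(** A first step outside [mu] forms an inversion with every element of [mu]; this is the origin of
    the sign [(-1) ^+ p] in [shuffleS]. *)
Lemma shuffle_sign_up_false mu :
  shuffle_sign (set_up false mu) = (#|mu| + shuffle_sign mu)%N.
Proof.
rewrite !shuffle_signE big_ord_recl big1 ?add0n => [|j _]; last by rewrite in_set_up.
rewrite -sum1_card [X in _ = (X + _)%N]big_mkcond -big_split; apply: eq_bigr => i _ /=.
rewrite big_ord_recl !in_set_up /= andbT; congr (_ + _)%N.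
by apply: eq_bigr => j _; rewrite !in_set_up.
Qed.
End ShuffleSets.

Section ShuffleProduct.
Variable k : fieldType.

Lemma salg_act_eq (X : salg k) l m m' n (g : dmap m n) (f : dmap l m)
    (g' : dmap m' n) (f' : dmap l m') (x : X n) :
  dmap_comp g f = dmap_comp g' f' ->
  salg_act X f (salg_act X g x) = salg_act X f' (salg_act X g' x).
Proof. exact: (@sact_eq k X). Qed.

Definition dec_salg (X : salg k) : salg k :=
  @Salg k (fun n => X n.+1) (fun m n f => salg_act X (dcone f))
    (fun m n f => salg_act1 X (dcone f)) (fun m n f => @salg_actM k X _ _ (dcone f))
    (@dec_act_id k X) (@dec_act_comp k X).

Definition s0 (X : salg k) n (x : X n) : dec_salg X n := salg_act X (dg n 0) x.

Section Recursion.
Variable X : salg k.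

(** The shuffles in which [x] takes the first step: read in the decalage, [x] has one degree less,
    and [y], which rests during that step, enters as [s0 y]. *)
Definition shuffle_l p q n : X p -> X q -> X n.+1 :=
  match p return X p -> X q -> X n.+1 with
  | 0%N => fun _ _ => 0
  | p'.+1 => fun x y => @shuffle k (dec_salg X) p' q n x (s0 y)
  end.

Definition shuffle_r p q n (x : X p) : X q -> X n.+1 :=
  match q return X q -> X n.+1 with
  | 0%N => fun _ => 0
  | q'.+1 => fun y => @shuffle k (dec_salg X) p q' n (s0 x) y
  end.

(* Shuffles are split according to their first step. *)
Lemma shuffleS p q n (x : X p) (y : X q) :
  shuffle n.+1 x y = shuffle_l n x y + (-1) ^+ p *: shuffle_r n x y.
Proof.
rewrite /shuffle (bigID (fun mu : {set 'I_n.+1} => ord0 \in mu)) /=; congr (_ + _).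
  rewrite (reindex_onto (@set_up n true) (@set_down n)) => [|mu /andP[_ mu0]]; last first.
    by rewrite set_downK.
  case: p x => [|p] x.
    by rewrite big_pred0 // => mu; rewrite card_set_up.
  apply: eq_big => mu.
    by rewrite setC_up !card_set_up in_set_up set_upK eqxx !andbT.
  move=> _; rewrite setC_up steps_up_true steps_up_false shuffle_sign_up_true.
  by rewrite salg_act_comp.
rewrite (reindex_onto (@set_up n false) (@set_down n)) => [|mu /andP[_ mu0]]; last first.
  by rewrite set_downK //; apply/negbTE.
case: q y => [|q] y.
  rewrite scaler0 big_pred0 // => mu; rewrite setC_up !card_set_up.
  by rewrite /= andbF.
rewrite scaler_sumr; apply: eq_big => mu.
  by rewrite setC_up !card_set_up in_set_up set_upK eqxx !andbT.
rewrite setC_up !card_set_up => /andP[/andP[/andP[/eqP mup _] _] _].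
rewrite steps_up_true steps_up_false shuffle_sign_up_false.
by rewrite exprD scalerA (mup : #|mu| = p) salg_act_comp.
Qed.

Lemma shuffle0 (x y : X 0%N) : shuffle 0 x y = x * y.
Proof.
rewrite /shuffle (big_pred1 set0) => [|mu]; last first.
  have -> : mu = set0 by apply/setP => i; have := ltn_ord i.
  by rewrite setC0 cardsT card_ord cards0 /= !eqxx.
rewrite (_ : @shuffle_sign 0 set0 = 0)%N ?scale1r; last first.
  by apply/eqP; rewrite cards_eq0; apply/eqP/setP => -[i j]; have := ltn_ord i.
have -> (mu : {set 'I_0}) : steps 0 mu = dmap_id 0.
  by apply: dmap_eqP => i; rewrite !ord1.
have -> (mu : {set 'I_0}) : steps 0 mu = dmap_id 0.
  by apply: dmap_eqP => i; rewrite !ord1.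
by rewrite !salg_act_id.
Qed.

Lemma shuffleDl p q n (x x' : X p) (y : X q) :
  shuffle n (x + x') y = shuffle n x y + shuffle n x' y.
Proof.
rewrite /shuffle -big_split; apply: eq_bigr => mu _ /=.
by rewrite raddfD /= mulrDl scalerDr.
Qed.
Lemma shuffleDr p q n (x : X p) (y y' : X q) :
  shuffle n x (y + y') = shuffle n x y + shuffle n x y'.
Proof.
rewrite /shuffle -big_split; apply: eq_bigr => mu _ /=.
by rewrite raddfD /= mulrDr scalerDr.
Qed.
Lemma shuffleZl p q n c (x : X p) (y : X q) :
  shuffle n (c *: x) y = c *: shuffle n x y.
Proof.
rewrite /shuffle scaler_sumr; apply: eq_bigr => mu _.
by rewrite linearZ /= -algZAl !scalerA mulrC.
Qed.
Lemma shuffleZr p q n c (x : X p) (y : X q) :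
  shuffle n x (c *: y) = c *: shuffle n x y.
Proof.
rewrite /shuffle scaler_sumr; apply: eq_bigr => mu _.
by rewrite linearZ /= -algZAr !scalerA mulrC.
Qed.
Lemma shuffleNl p q n (x : X p) (y : X q) : shuffle n (- x) y = - shuffle n x y.
Proof. by rewrite -scaleN1r shuffleZl scaleN1r. Qed.
Lemma shuffleNr p q n (x : X p) (y : X q) : shuffle n x (- y) = - shuffle n x y.
Proof. by rewrite -scaleN1r shuffleZr scaleN1r. Qed.
Lemma shuffleBl p q n (x x' : X p) (y : X q) :
  shuffle n (x - x') y = shuffle n x y - shuffle n x' y.
Proof. by rewrite shuffleDl shuffleNl. Qed.
Lemma shuffleBr p q n (x : X p) (y y' : X q) :
  shuffle n x (y - y') = shuffle n x y - shuffle n x y'.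
Proof. by rewrite shuffleDr shuffleNr. Qed.
Lemma shuffle0l p q n (y : X q) : shuffle n (0 : X p) y = 0.
Proof. by rewrite -(scale0r (0 : X p)) shuffleZl scale0r. Qed.
Lemma shuffle0r p q n (x : X p) : shuffle n x (0 : X q) = 0.
Proof. by rewrite -(scale0r (0 : X q)) shuffleZr scale0r. Qed.
End Recursion.

Lemma s00 (X : salg k) n : s0 (0 : X n) = 0.
Proof. exact: raddf0. Qed.

(* The iterated degeneracies of the shuffle map fix the first vertex. *)
Lemma s0_shuffle (X : salg k) p q n (x : X p) (y : X q) :
  s0 (shuffle n x y) = shuffle n (s0 x) (s0 y).
Proof.
rewrite /s0 /shuffle raddf_sum; apply: eq_bigr => mu _ /=.
rewrite linearZ /= salg_actM.
have e r (z : X r) (nu : {set 'I_n}) : salg_act X (dg n 0) (salg_act X (steps r nu) z) =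
    salg_act X (dcone (steps r nu)) (salg_act X (dg r 0) z).
  by apply: salg_act_eq; rewrite dg0_dcone ?steps0.
by rewrite !e.
Qed.

Lemma shuffle_1l (X : salg k) n (x : X n) : shuffle n (1 : X 0%N) x = x.
Proof.
elim: n X x => [|n IHn] X x; first by rewrite shuffle0 mul1r.
rewrite shuffleS add0r scale1r /= (salg_act1 X (dg 0 0) : s0 (1 : X 0%N) = 1).
exact: (IHn (dec_salg X)).
Qed.

(** Expanding twice by [shuffleS] leaves three families on each side, according to which of [x],
    [y], [z] steps first; each is associativity in the decalage. Degrees are tied by equations,
    which avoids transports. *)
Lemma shuffleA (X : salg k) p q r n m l (x : X p) (y : X q) (z : X r) :
  n = (p + q + r)%N -> m = (q + r)%N -> l = (p + q)%N ->
  shuffle n x (shuffle m y z) = shuffle n (shuffle l x y) z.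
Proof.
elim: n X p q r m l x y z => [|n IHn] X [|p] [|q] [|r] [|m] [|l] x y z //;
  rewrite ?addSn ?addnS ?addn0 ?add0n //.
  by rewrite !shuffle0 mulrA.
all: move=> nE mE lE; rewrite [LHS](@shuffleS X) [RHS](@shuffleS X) /= ?s0_shuffle.
all: rewrite ?(@shuffleS X) /= ?shuffleDl ?shuffleDr ?shuffleZl ?shuffleZr.
all: rewrite ?shuffle0l ?shuffle0r ?scaler0 ?addr0 ?add0r ?expr0 ?scale1r.
all: rewrite ?scalerDr ?scalerA -?exprD.
all: rewrite ?addrA.
all: repeat match goal with |- (_ + _)%R = _ => congr (_ + _) end.
all: try match goal with |- (_ *: _)%R = _ => congr (_ *: _) end.
all: try by congr (_ ^+ _); lia.
all: by apply: (IHn (dec_salg X)); lia.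
Qed.

Lemma shuffleC (X : salg k) p q n (x : X p) (y : X q) :
  (forall m, commutative (@GRing.mul (X m))) -> n = (p + q)%N ->
  shuffle n x y = (-1) ^+ (p * q) *: shuffle n y x.
Proof.
move=> Xcomm; elim: n p q X Xcomm x y => [|n IHn] [|p] [|q] X Xcomm x y //.
  by rewrite !shuffle0 muln0 expr0 scale1r Xcomm.
all: have Dcomm m : commutative (@GRing.mul (dec_salg X m)) := @Xcomm m.+1.
all: rewrite ?addSn ?addnS ?addn0 ?add0n => -[nE].
all: rewrite !(@shuffleS X) /= ?scaler0 ?addr0 ?add0r ?expr0 ?scale1r.
all: have IH := IHn _ _ (dec_salg X) Dcomm.
- by rewrite IH // expr0 scale1r.
- by rewrite IH ?addn0 // !muln0 expr0 scale1r.
rewrite (IH _ _ x (s0 y)) ?addnS // (IH _ _ (s0 x) y) ?addSn // addrC.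
rewrite scalerDr !scalerA -!exprD.
have eE a b : odd a = odd b -> (-1) ^+ a = (-1) ^+ b :> k.
  by move=> ab; rewrite -signr_odd ab signr_odd.
by congr (_ *: _ + _ *: _); apply: eE; lia.
Qed.

Section AlgebraMap.
Variables (X Y : salg k) (f : samap X Y).
Lemma samap_shuffle p q n (x : X p) (y : X q) :
  f n (shuffle n x y) = shuffle n (f p x) (f q y).
Proof.
rewrite /shuffle raddf_sum; apply: eq_bigr => mu _.
by rewrite [LHS]linearZ /= samapM !samap_nat.
Qed.
End AlgebraMap.

Definition dec_proj_samap (X : salg k) : samap (dec_salg X) X :=
  @Samap k (dec_salg X) X (fun n => salg_act X (fc n 0))
    (fun n => salg_act1 X (fc n 0)) (fun n => @salg_actM k X _ _ (fc n 0))
    (@dec_proj_nat k X).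

Lemma fc0_s0 (X : salg k) n (x : X n) : salg_act X (fc n 0) (s0 x) = x.
Proof. by rewrite -salg_act_comp dg_fc_id // salg_act_id. Qed.

Lemma bd_s0 (X : salg k) n (x : X n.+1) :
  @bd k (dec_salg X) n.+1 (s0 x) = x - s0 (bdp (x : smod_of_salg X n.+1)).
Proof. exact: (@bd_dg0 k X n x). Qed.

Definition bdp0 (X : salg k) n : X n -> X n.-1 :=
  match n return X n -> X n.-1 with
  | 0%N => fun _ => 0
  | n'.+1 => fun x => bdp (x : smod_of_salg X n'.+1)
  end.

(** On the decalage [d_0] is an algebra map that undoes [s0], so it erases the first step of each
    shuffle. *)
Lemma shuffle_fc0 (X : salg k) p q n (x : X p) (y : X q) :
  salg_act X (fc n 0) (shuffle n.+1 x y) =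
  match p return X p -> X n with 0%N => fun=> 0 | p'.+1 => fun x =>
    shuffle n (salg_act X (fc p' 0) x) y end x +
  (-1) ^+ p *: match q return X q -> X n with 0%N => fun=> 0 | q'.+1 => fun y =>
    shuffle n x (salg_act X (fc q' 0) y) end y.
Proof.
rewrite shuffleS raddfD /= linearZ /=; congr (_ + _ *: _).
  case: p x => [|p] x; first exact: raddf0.
  by rewrite [LHS](samap_shuffle (dec_proj_samap X)) /= fc0_s0.
case: q y => [|q] y; first exact: raddf0.
by rewrite [LHS](samap_shuffle (dec_proj_samap X)) /= fc0_s0.
Qed.

Lemma bd_deg0 (X : smod k) (x : X 0%N) : bd x = 0.
Proof. by []. Qed.

Lemma shuffle_bd_of_bdp (X : salg k) p q n (x : X p) (y : X q) :
  bdp (shuffle n.+1 x y : smod_of_salg X n.+1) =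
    shuffle n (bdp0 x) y + (-1) ^+ p *: shuffle n x (bdp0 y) ->
  @bd k X n.+1 (shuffle n.+1 x y) =
  shuffle n (@bd k X p x : X p.-1) y
  + (-1) ^+ p *: shuffle n x (@bd k X q y : X q.-1).
Proof.
move=> bdpE; rewrite bd_bdp bdpE [X in X - _]shuffle_fc0 opprD addrACA -scalerBr.
congr (_ + _ *: _).
  case: p x {bdpE} => [|p] x; first by rewrite !shuffle0l subr0.
  by rewrite -shuffleBl bd_bdp.
case: q y {bdpE} => [|q] y; first by rewrite !shuffle0r subr0.
by rewrite -shuffleBr bd_bdp.
Qed.

(** The face [d_0] is settled by [shuffle_bd_of_bdp]. What remains concerns [bdp], the boundary of
    the decalage, and follows by induction on the two halves of [shuffleS]. *)
Lemma shuffle_leibniz (X : salg k) p q n (x : X p) (y : X q) :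
  n.+1 = (p + q)%N ->
  @bd k X n.+1 (shuffle n.+1 x y) =
  shuffle n (@bd k X p x : X p.-1) y
  + (-1) ^+ p *: shuffle n x (@bd k X q y : X q.-1).
Proof.
move=> nE; apply: shuffle_bd_of_bdp.
(* By [bd_s0] each half of the shuffle product contributes the product of [x] and [y] in the
   decalage, with opposite signs: these are the terms [u]. *)
have cancel_mid (V : zmodType) (a u b c d : V) :
    a + (- u + b) + (u - c + d) = a - c + (b + d).
  rewrite -!addrA; congr (_ + _).
  by rewrite addrCA addKr addrCA.
elim: n X p q x y nE => [|n IHn] X p q x y nE.
  rewrite bdp1 (@shuffleS X); case: p q x y nE => [|[|p]] [|[|q]] x y //= _.
    rewrite add0r expr0 !scale1r shuffle0l add0r !shuffle0 /= bdp1.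
    by rewrite salg_actM -salg_act_comp dg_fc_id // salg_act_id.
  rewrite scaler0 addr0 shuffle0r scaler0 addr0 !shuffle0 /= bdp1.
  by rewrite salg_actM -salg_act_comp dg_fc_id // salg_act_id.
rewrite bdpE (@shuffleS X).
have IH p' q' x' y' e := shuffle_bd_of_bdp (IHn (dec_salg X) p' q' x' y' e).
have bdD_ m (z : X m.+2) : @bd k (dec_salg X) m.+1 z = bdp (z : smod_of_salg X m.+2).
  by rewrite bdpE.
rewrite [LHS]bdD [X in _ + X]bdZ.
(* Degree 1 is separate because it is degree 0 of the decalage, where the boundary is 0 but [bdp] is
   [d_1]. *)
case: p q x y nE => [|[|p]] [|[|q]] x y //; rewrite ?addSn ?addnS ?addn0 ?add0n => -[nE].
all: rewrite /shuffle_l /shuffle_r /bdp0 ?(@bd0 _ (dec_salg X) n.+1) ?scaler0 ?addr0 ?add0r.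
all: rewrite ?IH ?addnS ?addSn ?addn0 ?add0n //; rewrite ?bd_s0 ?bdD_.
all: rewrite ?bd_deg0 ?(@shuffleS X) /shuffle_l /shuffle_r ?shuffleBr ?shuffleBl.
all: rewrite ?s00 ?shuffle0l ?shuffle0r ?scaler0 ?addr0 ?add0r ?expr0 ?scale1r ?subr0 ?sub0r.
all: rewrite ?scalerDr ?scalerN ?scalerA -?exprD.
all: try by [|rewrite nE|rewrite scaler0 addr0].
- by rewrite expr1 !scaleN1r opprK addrACA subrr add0r addrC.
- by rewrite expr1 !scaleN1r opprK -[X in _ + X = _]addrA addrACA subrr add0r addrCA.
- by rewrite /= !exprS !mulN1r !opprK !scaleNr opprK -[LHS]addr0 -addrA cancel_mid addr0.
- move: ((-1) ^+ (p.+2 + p.+2) *: _) => d.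
  by rewrite /= !exprS !mulN1r !opprK !scaleNr opprK cancel_mid.
Qed.
End ShuffleProduct.

(** * Homology *)

Section Homology.
Variable k : fieldType.

Section Classes.
Variable X : smod k.

Lemma hrepr_cycle n (h : homology X n) : bd (hrepr h) = 0.
Proof. by apply/eqP; exact: (valP (lrepr h)). Qed.

Lemma hreprK n (h : homology X n) : hclass (hrepr h) = h.
Proof. by rewrite /hclass /hrepr valKd lreprK. Qed.

Lemma val_hclass n (x : X n) : bd x = 0 -> val (insubd (0 : Defs.cycle X n) x) = x.
Proof. by move=> x0; rewrite insubdK //; apply/eqP. Qed.

Lemma hclass_eqP n (x y : X n) : bd x = 0 -> bd y = 0 ->
  hclass x = hclass y <-> exists z : X n.+1, bd z = x - y.
Proof.
move=> x0 y0; rewrite lpi_eq; split=> [/asboolP[z zE]|[z zE]].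
  by exists z; rewrite zE raddfB /= !val_hclass.
by apply/asboolP; exists z; rewrite zE raddfB /= !val_hclass.
Qed.

Lemma hclass_lin n c (x y : X n) : bd x = 0 -> bd y = 0 ->
  hclass (c *: x + y) = c *: hclass x + hclass y.
Proof.
move=> x0 y0; rewrite /hclass -lpiZ -lpiD; congr lpi; apply: val_inj.
rewrite val_hclass; last by rewrite bdD bdZ x0 y0 scaler0 addr0.
by rewrite linearP /= !val_hclass.
Qed.

Lemma hclassZ n c (x : X n) : bd x = 0 -> hclass (c *: x) = c *: hclass x.
Proof.
move=> x0; rewrite -[in RHS](addr0 x) /hclass -lpiZ; congr lpi; apply: val_inj.
rewrite val_hclass; last by rewrite bdZ x0 scaler0.
by rewrite addr0 linearZ_LR /= !val_hclass.
Qed.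

Lemma hrepr_hclass n (x : X n) : bd x = 0 ->
  exists z : X n.+1, hrepr (hclass x) = x + bd z.
Proof.
move=> x0; have /(hclass_eqP (hrepr_cycle _) x0)[z zE] := hreprK (hclass x).
by exists z; rewrite zE addrC subrK.
Qed.
End Classes.

Lemma hmap_hclass (X Y : smod k) (f : smap X Y) n (x : X n) :
  bd x = 0 -> hmap f (hclass x) = hclass (f n x).
Proof.
move=> x0; have [z zE] := hrepr_hclass x0; rewrite /hmap zE.
apply/hclass_eqP.
- by rewrite -smap_bd bdD x0 bd_bdS addr0 raddf0.
- by rewrite -smap_bd x0 raddf0.
by exists (f n.+1 z); rewrite -smap_bd raddfD [X in _ = X - _]addrC addrK.
Qed.

Lemma hmap_linear (X Y : smod k) (f : smap X Y) n : linear (@hmap k X Y f n).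
Proof.
move=> c x y; rewrite -[x]hreprK -[y]hreprK.
have x0 := hrepr_cycle x; have y0 := hrepr_cycle y.
rewrite -hclass_lin // !hmap_hclass ?bdD ?bdZ ?x0 ?y0 ?scaler0 ?addr0 //.
by rewrite linearP hclass_lin // -smap_bd ?x0 ?y0 raddf0.
Qed.

Lemma hmap_comp (X Y Z : smod k) (f : smap X Y) (g : smap Y Z) (h : smap X Z) n :
  (forall m x, h m x = g m (f m x)) ->
  forall x : homology X n, hmap h x = hmap g (hmap f x).
Proof.
move=> hE x; rewrite -[x]hreprK; have x0 := hrepr_cycle x.
rewrite !hmap_hclass ?hE //.
by rewrite -smap_bd x0 raddf0.
Qed.

Lemma bijective_inj_surj (U V : lmodType k) (f : U -> V) :
  injective f -> (forall y, exists x, f x = y) -> bijective f.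
Proof.
move=> f_inj f_surj; pose g y := projT1 (cid (f_surj y)).
have gK : cancel g f by move=> y; exact: projT2 (cid (f_surj y)).
by exists g => // x; apply: f_inj; rewrite gK.
Qed.

Lemma preimageK (U V : lmodType k) (f : U -> V) (y : V) :
  bijective f -> f (Defs.preimage f y) = y.
Proof.
case=> g _ gK; rewrite /Defs.preimage; case: pselect => [ex|[]]; first by case: cid.
by exists (g y).
Qed.

Lemma preimage_eq (U V : lmodType k) (f : U -> V) (x : U) y :
  bijective f -> f x = y -> Defs.preimage f y = x.
Proof. by move=> fbij fx; apply: (bij_inj fbij); rewrite fx preimageK. Qed.

Lemma preimage_linear (U V : lmodType k) (f : U -> V) :
  bijective f -> linear f -> linear (Defs.preimage f).
Proof.
move=> fbij flin c x y; apply: preimage_eq => //.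
by rewrite flin !preimageK.
Qed.

Lemma hmap_bijective (X Y : smod k) (f : smap X Y) n :
  (forall x : X n, bd x = 0 -> (exists y : Y n.+1, bd y = f n x) -> exists y : X n.+1, bd y = x) ->
  (forall y : Y n, bd y = 0 -> exists2 x : X n, bd x = 0 & exists z : Y n.+1, bd z = f n x - y) ->
  bijective (@hmap k X Y f n).
Proof.
move=> f_inj f_surj; apply: bijective_inj_surj => [x y|y].
  rewrite -[x]hreprK -[y]hreprK; have x0 := hrepr_cycle x; have y0 := hrepr_cycle y.
  have fc (z : X n) : bd z = 0 -> bd (f n z) = 0.
    by move=> z0; rewrite -smap_bd z0 raddf0.
  rewrite !hmap_hclass // => /(hclass_eqP (fc _ x0) (fc _ y0)) [z zE].
  apply/hclass_eqP => //; apply: f_inj; first by rewrite bdB x0 y0 subrr.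
  by exists z; rewrite zE raddfB.
have y0 := hrepr_cycle y; have [x x0 [z zE]] := f_surj _ y0.
exists (hclass x); rewrite hmap_hclass // -[y]hreprK.
apply/hclass_eqP => //; first by rewrite -smap_bd x0 raddf0.
by exists z.
Qed.

(** An elementwise form of the long exact sequence: chains are lifted along the surjection and the
    lifts are corrected inside the acyclic kernel. *)
Lemma weak_equiv_acyclic_ker (X Y : smod k) (f : smap X Y) :
  (forall n y, exists x, f n x = y) ->
  (forall n (x : X n), f n x = 0 -> bd x = 0 ->
     exists2 y : X n.+1, f n.+1 y = 0 & bd y = x) ->
  weak_equiv f.
Proof.
move=> f_surj f_ker n; apply: hmap_bijective => [x x0 [y yE]|y y0].
  have [y' y'E] := f_surj _ y.
  have [||w w0 wE] := f_ker n (x - bd y').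
  - by rewrite raddfB /= -yE -y'E -smap_bd subrr.
  - by rewrite bdB x0 bd_bdS subrr.
  by exists (w + y'); rewrite bdD wE subrK.
have [x xE] := f_surj _ y.
(* The boundary of the lift [x] is a cycle in the kernel; subtracting a kernel chain with that
   boundary turns the lift into a cycle. *)
have [w wf wE] : exists2 w : X n, f n w = 0 & bd w = bd x.
  case: n y y0 x xE => [|n] y y0 x xE; first by exists 0; rewrite ?raddf0.
  by apply: f_ker; rewrite ?bd_bdS // [LHS](smap_bd f x) xE.
exists (x - w); first by rewrite bdB wE subrr.
by exists 0; rewrite bd0 raddfB /= wf xE subr0 subrr.
Qed.

Lemma weak_equiv_comp (X Y Z : smod k) (f : smap X Y) (g : smap Y Z) (h : smap X Z) :
  (forall m x, h m x = g m (f m x)) -> weak_equiv f -> weak_equiv g -> weak_equiv h.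
Proof.
move=> hE fW gW n; apply: (eq_bij (bij_comp (gW n) (fW n))) => x.
by rewrite [RHS](hmap_comp hE).
Qed.
End Homology.

(** * The graded algebra structure on the homotopy of a simplicial algebra *)

Section Products.
Variable k : fieldType.

Section Salg.
Variable X : salg k.
Local Notation mulH p q n := (@galg_mul k (homotopy_galg X) p q n).
Local Notation bdX n := (@bd k X n).

Lemma shuffle_cycle p q n (x : X p) (y : X q) : n = (p + q)%N ->
  bdX p x = 0 -> bdX q y = 0 -> bdX n (shuffle n x y) = 0.
Proof.
case: n => [|n] nE x0 y0 //.
by rewrite shuffle_leibniz // x0 y0 shuffle0l shuffle0r scaler0 addr0.
Qed.

Lemma shuffle_bdl p q (w : X p.+1) (y : X q) : bdX q y = 0 ->
  shuffle (p + q) (bdX p.+1 w : X p) y = bdX (p + q).+1 (shuffle (p + q).+1 w y).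
Proof.
by move=> y0; rewrite shuffle_leibniz ?addSn // y0 shuffle0r scaler0 addr0.
Qed.

Lemma shuffle_bdr p q (x : X p) (w : X q.+1) : bdX p x = 0 ->
  shuffle (p + q) x (bdX q.+1 w : X q) =
  (-1) ^+ p *: bdX (p + q).+1 (shuffle (p + q).+1 x w).
Proof.
move=> x0; rewrite shuffle_leibniz ?addnS // x0 shuffle0l add0r scalerA.
by rewrite -signr_odd -signr_addb addbb scale1r.
Qed.

(** The product is defined through chosen representatives; by the Leibniz rule any cycles may be
    used. The separate index [n] lets degrees such as [q + p] be matched without a transport. *)
Lemma hclass_mul p q n (x : X p) (y : X q) : n = (p + q)%N ->
  bdX p x = 0 -> bdX q y = 0 ->
  mulH p q n (@hclass k X p x) (@hclass k X q y) =
  @hclass k X n (shuffle n x y).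
Proof.
move=> -> x0 y0; have [z zE] := hrepr_hclass x0; have [w wE] := hrepr_hclass y0.
have cyc p' (u : X p') v : bdX p' u = 0 -> bdX p' (u + bdX p'.+1 v) = 0.
  by move=> u0; rewrite bdD u0 bd_bdS addr0.
rewrite /= zE wE; apply/hclass_eqP.
- by apply: shuffle_cycle => //; apply: cyc.
- exact: shuffle_cycle.
exists (shuffle (p + q).+1 z (y + bdX q.+1 w) +
  (-1) ^+ p *: shuffle (p + q).+1 x w).
rewrite bdD bdZ -shuffle_bdl ?cyc // -shuffle_bdr //.
by rewrite [in RHS]shuffleDl [X in _ = X + _ - _]shuffleDr addrC [RHS]addrC !addrA addNr add0r.
Qed.

Lemma homotopy_mul_linl p q (y : homology X q) :
  linear (fun x : homology X p => mulH p q (p + q)%N x y).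
Proof.
move=> c x x'; rewrite -[x]hreprK -[x']hreprK -[y]hreprK.
have x0 := hrepr_cycle x; have x'0 := hrepr_cycle x'; have y0 := hrepr_cycle y.
rewrite -hclass_lin // !hclass_mul //; last by rewrite bdD bdZ x0 x'0 scaler0 addr0.
by rewrite shuffleDl shuffleZl hclass_lin //; apply: shuffle_cycle.
Qed.

Lemma homotopy_mul_linr p q (x : homology X p) :
  linear (fun y : homology X q => mulH p q (p + q)%N x y).
Proof.
move=> c y y'; rewrite -[x]hreprK -[y]hreprK -[y']hreprK.
have x0 := hrepr_cycle x; have y'0 := hrepr_cycle y'; have y0 := hrepr_cycle y.
rewrite -hclass_lin // !hclass_mul //; last by rewrite bdD bdZ y0 y'0 scaler0 addr0.
by rewrite shuffleDr shuffleZr hclass_lin //; apply: shuffle_cycle.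
Qed.

Lemma homotopy_graded_commutative :
  (forall n, commutative (@GRing.mul (X n))) ->
  graded_commutative (homotopy_galg X).
Proof.
move=> XC; split.
- by move=> p q y; apply: homotopy_mul_linl.
- by move=> p q x; apply: homotopy_mul_linr.
- move=> n x; rewrite -[x]hreprK; have x0 := hrepr_cycle x.
  by rewrite [LHS](@hclass_mul 0 n n) // shuffle_1l.
- move=> p q r x y z; rewrite -[x]hreprK -[y]hreprK -[z]hreprK.
  have x0 := hrepr_cycle x; have y0 := hrepr_cycle y; have z0 := hrepr_cycle z.
  have yz0 := shuffle_cycle erefl y0 z0; have xy0 := shuffle_cycle erefl x0 y0.
  rewrite !hclass_mul ?addnA //.
  by rewrite (@shuffleA _ X _ _ _ _ _ (p + q)).
move=> p q x y; rewrite -[x]hreprK -[y]hreprK.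
have x0 := hrepr_cycle x; have y0 := hrepr_cycle y.
have e := addnC p q.
rewrite (hclass_mul erefl x0 y0) (hclass_mul e y0 x0) shuffleC //.
by apply: (@hclassZ k X); apply: shuffle_cycle.
Qed.
End Salg.

Lemma hmap_mul (X Y : salg k) (f : samap X Y) p q (x : homology X p)
    (y : homology X q) :
  @hmap k X Y f (p + q)%N (@galg_mul k (homotopy_galg X) p q (p + q)%N x y) =
  @galg_mul k (homotopy_galg Y) p q (p + q)%N (@hmap k X Y f p x) (@hmap k X Y f q y).
Proof.
rewrite -[x]hreprK -[y]hreprK.
have x0 := hrepr_cycle x; have y0 := hrepr_cycle y.
rewrite hclass_mul // !hmap_hclass ?hclass_mul //; last exact: shuffle_cycle.
- by congr hclass; exact: samap_shuffle.
- by rewrite -(smap_bd f) x0 raddf0.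
- by rewrite -(smap_bd f) y0 raddf0.
Qed.

Lemma hmap_one (X Y : salg k) (f : samap X Y) :
  @hmap k X Y f 0%N (galg_one (homotopy_galg X)) = galg_one (homotopy_galg Y).
Proof. by rewrite [LHS]hmap_hclass //= samap1. Qed.
End Products.

(** * Diagonals of bisimplicial modules *)

Fact dconst_mono m n : monotone (finfun (fun _ : 'I_m.+1 => ord0 : 'I_n.+1)).
Proof. exact: monotone_finfun. Qed.
Definition dconst m n : dmap m n := Dmap (dconst_mono m n).

Lemma dconstE m n i : dconst m n i = ord0.
Proof. by rewrite ffunE. Qed.

Section Diagonal.
Variable k : fieldType.

Section Contraction.
Variable Y : smod k.

(** The hypotheses give [bdp y = 0]: in positive degree it is the boundary of the decalage, and in
    degree 0 it is [d_1], the restriction to the first vertex. *)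
Lemma bd_dec_contract n (y : Y n.+1) : @bd k (dec Y) n y = 0 ->
  sact Y (dconst 0 n.+1) y = 0 ->
  @bd k (dec Y) n.+1 (sact Y (dg n.+1 0) y) = y.
Proof.
move=> y0 fy0; suff bdp0 : bdp y = 0 by rewrite bd_dg0 bdp0 raddf0 subr0.
case: n y y0 fy0 => [|n] y y0 fy0; last by rewrite bdpE.
rewrite bdp1 -[RHS]fy0; congr (sact Y _ _); apply: dmap_eqP => i.
by rewrite dconstE ord1 fcE.
Qed.
End Contraction.

Record bsmod := Bsmod {
  bs_ob :> nat -> nat -> lmodType k;
  bact : forall m n p q, dmap m p -> dmap n q -> {linear bs_ob p q -> bs_ob m n};
  bact_id : forall p q x, bact (dmap_id p) (dmap_id q) x = x;
  bact_comp : forall l m n l' m' n' (g : dmap m n) (f : dmap l m)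
    (g' : dmap m' n') (f' : dmap l' m') x,
    bact (dmap_comp g f) (dmap_comp g' f') x = bact f f' (bact g g' x) }.

Definition bs_diag (X : bsmod) : smod k :=
  @Smod k (fun n => X n n) (fun m n f => bact X f f)
    (fun n => @bact_id X n n) (fun l m n g f => @bact_comp X l m n l m n g f g f).

Fact col_act_comp (X : bsmod) p l m n (g : dmap m n) (f : dmap l m) x :
  bact X (dmap_id p) (dmap_comp g f) x =
  bact X (dmap_id p) f (bact X (dmap_id p) g x).
Proof. by rewrite -[LHS](f_equal (fun h => bact X h _ x) (dmap_comp1l (dmap_id p))) bact_comp. Qed.

Definition bs_col (X : bsmod) p : smod k :=
  @Smod k (X p) (fun m n f => bact X (dmap_id p) f)
    (fun n => @bact_id X p n) (@col_act_comp X p).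

Fact dec2_act_id (X : bsmod) p q (x : X p.+1 q.+1) :
  bact X (dcone (dmap_id p)) (dcone (dmap_id q)) x = x.
Proof. by rewrite !dcone_id bact_id. Qed.
Fact dec2_act_comp (X : bsmod) l m n l' m' n' (g : dmap m n) (f : dmap l m)
    (g' : dmap m' n') (f' : dmap l' m') (x : X n.+1 n'.+1) :
  bact X (dcone (dmap_comp g f)) (dcone (dmap_comp g' f')) x =
  bact X (dcone f) (dcone f') (bact X (dcone g) (dcone g') x).
Proof. by rewrite !dcone_comp bact_comp. Qed.
Definition dec2 (X : bsmod) : bsmod :=
  @Bsmod (fun p q => X p.+1 q.+1) (fun m n p q f g => bact X (dcone f) (dcone g))
    (@dec2_act_id X) (@dec2_act_comp X).

Lemma bact_eq (X : bsmod) l m n l' m' n' h h' (g : dmap m n) (f : dmap l m)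
    (g' : dmap m' n') (f' : dmap l' m') (u : dmap h n) (v : dmap l h)
    (u' : dmap h' n') (v' : dmap l' h') x :
  dmap_comp g f = dmap_comp u v -> dmap_comp g' f' = dmap_comp u' v' ->
  bact X f f' (bact X g g' x) = bact X v v' (bact X u u' x).
Proof. by move=> e e'; rewrite -!bact_comp e e'. Qed.

Lemma col_dec2_bd (X : bsmod) p q (x : X p.+1 q.+1) :
  @bd k (bs_col (dec2 X) p) q x = @bd k (dec (bs_col X p.+1)) q x.
Proof.
by case: q x => [|q] x //; rewrite !bdE; apply: eq_bigr => i _ /=; rewrite dcone_id.
Qed.

Fact col_proj_nat (X : bsmod) p m n (f : dmap m n) (x : bs_col (dec2 X) p n) :
  bact X (fc p 0) (fc m 0) (sact (bs_col (dec2 X) p) f x) =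
  sact (bs_col X p) f (bact X (fc p 0) (fc n 0) x).
Proof.
apply: bact_eq; last by rewrite dcone_fc0.
by rewrite dcone_id dmap_comp1l dmap_comp1r.
Qed.
Definition col_proj (X : bsmod) p : smap (bs_col (dec2 X) p) (bs_col X p) :=
  @Smap k (bs_col (dec2 X) p) (bs_col X p) (fun n => bact X (fc p 0) (fc n 0))
    (@col_proj_nat X p).

(** Subobjects are predicates, so that kernels can be iterated in [diag_acyclic] without building
    new modules. *)
Definition sub_closed (X : bsmod) (S : forall p q, X p q -> Prop) : Prop :=
  [/\ forall p q, S p q 0,
      forall p q c x y, S p q x -> S p q y -> S p q (c *: x + y) &
      forall m n p q (f : dmap m p) (g : dmap n q) x,
        S p q x -> S m n (bact X f g x)].

Definition sub_acyclic (Y : smod k) (S : forall n, Y n -> Prop) : Prop :=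
  forall n (x : Y n), S n x -> bd x = 0 -> exists2 y : Y n.+1, S n.+1 y & bd y = x.

Lemma sub_bd (Y : smod k) (S : forall n, Y n -> Prop) n (x : Y n) :
  (forall n, S n 0) -> (forall n c x y, S n x -> S n y -> S n (c *: x + y)) ->
  (forall m n (f : dmap m n) x, S n x -> S m (sact Y f x)) ->
  S n x -> S n.-1 (bd x).
Proof.
move=> S0 SP Sact; case: n x => [|n] x Sx; first exact: S0.
rewrite bdE; apply: (big_ind (S n)) => [|y z Sy Sz|i _]; first exact: S0.
  by rewrite -[y]scale1r; apply: SP.
by rewrite -[_ *: _]addr0; apply: SP => //; apply: Sact.
Qed.

Section Cover.
Variables (X : bsmod) (S : forall p q, X p q -> Prop).
Hypotheses (clS : sub_closed S) (acS : forall p, sub_acyclic (Y := bs_col X p) (@S p)).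

(** The degenerate lift [y0] projects to [x] but is not based at 0. Its base vertex [v] bounds in
    the acyclic column, and the bounding edge moves the base to 0 without changing the
    projection. *)
Lemma cover_lift p q (x : X p q) : S x -> exists y : X p.+1 q.+1,
  [/\ S y, bact X (dmap_id p.+1) (dconst 0 q.+1) y = 0 &
      bact X (fc p 0) (fc q 0) y = x].
Proof.
have [S0 SP Sact] := clS; move=> Sx.
have SB p' q' (u v : X p' q') : S u -> S v -> S (u - v).
  by move=> Su Sv; rewrite addrC -scaleN1r; apply: SP.
have SD p' q' (u v : X p' q') : S u -> S v -> S (u + v).
  by move=> Su Sv; rewrite -[u]scale1r; apply: SP.
pose y0 := bact X (dg p 0) (dg q 0) x.
have Sy0 : S y0 by apply: Sact.
pose v := bact X (dmap_id p.+1) (dconst 0 q.+1) y0.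
have [w Sw wE] : exists2 w : X p.+1 1%N, S w & @bd k (bs_col X p.+1) 1 w = v.
  by apply: (@acS p.+1 0%N v) => //; apply: Sact.
pose d i := bact X (dmap_id p.+1) (fc 0 i).
(* Normalized so that [d_0 w' = 0] and [d_1 w' = v]. *)
pose w' := bact X (dmap_id p.+1) (dg 0 0) (d 0%N w) - w.
have Sw' : S w' by apply: SB => //; do 2!apply: (Sact).
have dw' i : (i <= 1)%N -> d i w' = d 0%N w - d i w.
  move=> i1; rewrite raddfB /=; congr (_ - _).
  by rewrite [LHS]/= -col_act_comp dg_fc_id // bact_id.
(* The map to [[1]] sends the first vertex to 0 and all others to 1: hence [y1] has base vertex
   [d_1 w' = v], and its projection is a degeneracy of [d_0 w' = 0]. *)
pose y1 := bact X (dmap_id p.+1) (dcone (dconst q 0)) w'.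
exists (y0 - y1); split; first by apply: SB => //; apply: Sact.
  rewrite raddfB /= -/v /y1 -col_act_comp.
  have -> : dmap_comp (dcone (dconst q 0)) (dconst 0 q.+1) = fc 0 1.
    by apply: dmap_eqP => i; rewrite dmap_compE dconstE dcone0 fcE // ord1.
  rewrite -/(d 1%N w') dw' // -wE bdE !big_ord_recl big_ord0 /= expr0 expr1.
  by rewrite scale1r scaleN1r addr0 subrr.
rewrite raddfB /= [X in _ - X](_ : _ = 0) ?subr0.
  by rewrite /y0 -bact_comp !dg_fc_id // bact_id.
rewrite (@bact_eq X _ _ _ _ _ _ _ _ _ _ _ _ (dmap_id _) (fc p 0) (fc 0 0) (dconst q 0)).
- by rewrite -/(d 0%N w') dw' // subrr raddf0.
- by rewrite dmap_comp1l.
by rewrite dcone_fc0.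
Qed.

(* The based path objects of the columns. *)
Definition cover p q (y : dec2 X p q) : Prop :=
  S (y : X p.+1 q.+1) /\ bact X (dmap_id p.+1) (dconst 0 q.+1) y = 0.

Definition cover_ker p q (y : dec2 X p q) : Prop := cover y /\ bact X (fc p 0) (fc q 0) y = 0.

Lemma cover_closed : sub_closed (X := dec2 X) cover.
Proof.
have [S0 SP Sact] := clS; split=> [p q|p q c x y [Sx x0] [Sy y0]|m n p q f g x [Sx x0]].
- by split; [exact: S0|rewrite raddf0].
- by split; [exact: SP|rewrite linearP x0 y0 scaler0 addr0].
split; first exact: Sact.
rewrite /= (@bact_eq X _ _ _ _ _ _ _ _ _ _ _ _ (dmap_id _) (dcone f) (dconst 0 q.+1) (dmap_id 0)).
- by rewrite x0 raddf0.
- by rewrite dmap_comp1l dmap_comp1r.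
by apply: dmap_eqP => i; rewrite !dmap_compE !dconstE dcone0.
Qed.

Lemma cover_ker_closed : sub_closed (X := dec2 X) cover_ker.
Proof.
have [S0 SP Sact] := cover_closed.
split=> [p q|p q c x y [Sx x0] [Sy y0]|m n p q f g x [Sx x0]].
- by split; [exact: S0|rewrite raddf0].
- by split; [exact: SP|rewrite linearP x0 y0 scaler0 addr0].
split; first exact: Sact.
rewrite /= (@bact_eq X _ _ _ _ _ _ _ _ _ _ _ _ (fc p 0) f (fc q 0) g) ?dcone_fc0 //.
by rewrite x0 raddf0.
Qed.

Lemma cover_col_acyclic p : sub_acyclic (Y := bs_col (dec2 X) p) (@cover p).
Proof.
move=> q y [Sy y0] bdy; exists (bact X (dmap_id p.+1) (dg q.+1 0) y).
  have [_ _ Sact] := clS; split; first exact: Sact.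
  rewrite -col_act_comp -[RHS]y0; congr (bact X _ _ _); apply: dmap_eqP => i.
  by rewrite dmap_compE !dconstE dgE.
rewrite col_dec2_bd; apply: (@bd_dec_contract (bs_col X p.+1)) => //.
by rewrite -col_dec2_bd.
Qed.

Lemma cover_diag_acyclic : sub_acyclic (Y := bs_diag (dec2 X)) (fun n => @cover n n).
Proof.
move=> n y [Sy y0] bdy; exists (bact X (dg n.+1 0) (dg n.+1 0) y).
  have [_ _ Sact] := clS; split; first exact: Sact.
  rewrite (@bact_eq X _ _ _ _ _ _ _ _ _ _ _ _ (dmap_id _) (dg _ 0) (dconst 0 n.+1) (dmap_id 0)).
  - by rewrite y0 raddf0.
  - by rewrite dmap_comp1l dmap_comp1r.
  by apply: dmap_eqP => i; rewrite !dmap_compE !dconstE dgE.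
apply: (@bd_dec_contract (bs_diag X)) => //=.
rewrite -[dconst 0 n.+1 in X in bact _ X](dmap_comp1l (dconst 0 n.+1)).
by rewrite -[X in bact _ _ X](dmap_comp1r (dconst 0 n.+1)) bact_comp y0 raddf0.
Qed.

(** The cover is contractible and its target acyclic. If [e] bounds [y] in the cover, the projection
    of [e] is a cycle, hence the boundary of some [f]; with a lift [g] of [f], the chain [e - bd g]
    bounds [y] inside the kernel. *)
Lemma cover_ker_col_acyclic p : sub_acyclic (Y := bs_col (dec2 X) p) (@cover_ker p).
Proof.
have [S0 SP Sact] := cover_closed.
move=> q y [Sy y0] bdy; have [e Se eE] := cover_col_acyclic Sy bdy.
have [||f Sf fE] := @acS p q.+1 (bact X (fc p 0) (fc q.+1 0) e).
- by have [_ _ SaX] := clS; apply: SaX; case: Se.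
- by rewrite -[LHS](smap_bd (col_proj X p) (e : bs_col (dec2 X) p q.+1)) eE.
have [g [Sg g0 gE]] := cover_lift Sf.
have Sbg : cover (@bd k (bs_col (dec2 X) p) q.+2 g).
  apply: (@sub_bd (bs_col (dec2 X) p) (@cover p) q.+2 g) => // *; first exact: SP.
  exact: Sact.
exists (e - @bd k (bs_col (dec2 X) p) q.+2 g); last by rewrite bdB bd_bdS subr0.
split; first by rewrite addrC -scaleN1r; apply: SP.
rewrite raddfB /= [X in _ - X](smap_bd (col_proj X p) (g : bs_col (dec2 X) p q.+2)).
by rewrite [X in bd X]gE fE subrr.
Qed.
End Cover.

(** The induction is over all [X] and [S] at once, since the kernel of the cover sits in [dec2 X].
    With [y] a lift of [x], the boundary of [y] is a cycle one degree lower in this kernel;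
    correcting [y] there gives a cycle in the contractible cover. *)
Lemma diag_acyclic (X : bsmod) (S : forall p q, X p q -> Prop) :
  sub_closed S -> (forall p, sub_acyclic (Y := bs_col X p) (@S p)) ->
  sub_acyclic (Y := bs_diag X) (fun n => @S n n).
Proof.
move=> clS acS n; elim: n X S clS acS => [|n IHn] X S clS acS x Sx bdx.
all: have [y [Sy y0 yE]] := cover_lift clS acS Sx.
all: have [S0 SP Sact] := cover_closed clS; have [_ _ SaX] := clS.
  have y0' : @bd k (bs_diag (dec2 X)) 0 y = 0 by [].
  have [z [Sz z0] zE] := cover_diag_acyclic clS (conj Sy y0) y0'.
  exists (bact X (fc 1 0) (fc 1 0) z); first exact: SaX.
  rewrite -[LHS](smap_bd (dec_proj (bs_diag X)) (z : dec (bs_diag X) 1%N)).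
  by rewrite -[RHS]yE; congr (bact X _ _ _).
have [||w [[Sw w0] piw] wE] := IHn _ _ (cover_ker_closed clS)
    (cover_ker_col_acyclic clS acS) (@bd k (bs_diag (dec2 X)) n.+1 y).
- split; last first.
    rewrite [LHS](smap_bd (dec_proj (bs_diag X)) (y : dec (bs_diag X) n.+1)).
    by rewrite [X in bd X](yE : dec_proj (bs_diag X) n.+1 y = x).
  apply: (@sub_bd (bs_diag (dec2 X)) (fun m => @cover X S m m) n.+1 y) (conj Sy y0) => *.
  + exact: S0.
  + exact: SP.
  exact: Sact.
- exact: bd_bdS.
have [||z [Sz z0] zE] := cover_diag_acyclic clS (n := n.+1) (x := y - w).
- have [S1 S2] := @SP _ _ (-1) _ _ (conj Sw w0) (conj Sy y0).
  by rewrite addrC -scaleN1r.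
- by rewrite bdB wE subrr.
exists (bact X (fc n.+2 0) (fc n.+2 0) z); first exact: SaX.
rewrite -[LHS](smap_bd (dec_proj (bs_diag X)) (z : dec (bs_diag X) n.+2)).
rewrite -[RHS]yE -[RHS]subr0 -[X in _ = _ - X]piw -[RHS]raddfB.
by congr (bact X _ _ _).
Qed.
End Diagonal.

(** * Adjoining the initial object of Delta S *)

Lemma alg_linl (k : fieldType) (A : alg k) c (x x' y : A) :
  (c *: x + x') * y = c *: (x * y) + x' * y.
Proof. by rewrite mulrDl -algZAl. Qed.

Lemma alg_linr (k : fieldType) (A : alg k) c (x y y' : A) :
  x * (c *: y + y') = c *: (x * y) + x * y'.
Proof. by rewrite mulrDr -algZAr. Qed.

Section SimplicialIdeal.
Variables (k : fieldType) (Z : smod k) (Y : salg k) (f : smap Z Y).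
Local Notation "'in_f' x" := (exists x', f _ x' = x) (at level 10).
Hypothesis f_inj : forall n, injective (f n).
Hypothesis f_ideal : forall n (x y : Y n), in_f x \/ in_f y -> in_f (x * y).

Lemma ideal_shuffle p q n (x : Y p) (y : Y q) :
  in_f x \/ in_f y -> in_f (shuffle n x y).
Proof.
move=> Ixy; apply: (big_ind (fun z : Y n => in_f z)) => [|z w [z' <-] [w' <-]|mu _].
- by exists 0; rewrite raddf0.
- by exists (z' + w'); rewrite raddfD.
have Iact r m (g : dmap m r) (z : Y r) : in_f z -> in_f (salg_act Y g z).
  by move=> [z' <-]; exists (sact Z g z'); rewrite smap_nat.
have [|z zE] := @f_ideal n (salg_act Y (steps p mu) x) (salg_act Y (steps q (~: mu)) y).
  by case: Ixy => I; [left|right]; exact: Iact.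
by exists ((-1) ^+ shuffle_sign mu *: z); rewrite linearZ /= zE.
Qed.

Variables (u : Y 0%N) (v : Y 1%N).
Hypotheses (Iu : in_f u) (bd_v : @bd k Y 1 v = u - 1).

Lemma shuffle_unit_homotopy n (x : Y n) : @bd k Y n x = 0 ->
  x = shuffle n u x - @bd k Y n.+1 (shuffle n.+1 v x).
Proof.
move=> x0; rewrite shuffle_leibniz ?add1n // x0 shuffle0r scaler0 addr0 bd_v.
by rewrite shuffleBl shuffle_1l opprB addrC subrK.
Qed.

(* Up to boundaries x is u x, which lies in the image of f. *)
Lemma simplicial_ideal_weak_equiv : weak_equiv f.
Proof.
have sh := shuffle_unit_homotopy.
move=> n; apply: hmap_bijective => [x x0 [y yE]|y y0].
  have [z zE] : in_f (shuffle n.+1 v (f n x)).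
    by apply: ideal_shuffle; right; exists x.
  have [w wE] : in_f (shuffle n.+1 u y) by apply: ideal_shuffle; left.
  (* From [f x = bd y] follows [f x = bd (u y - v (f x))], and both products lie in the image of
     [f]. *)
  exists (w - z); apply: (@f_inj n).
  rewrite [LHS](smap_bd f (w - z : Z n.+1)).
  have -> : f n.+1 (w - z) = f n.+1 w - f n.+1 z by exact: raddfB.
  rewrite wE zE bdB [RHS]sh; last first.
    by rewrite -(smap_bd f) x0 raddf0.
  rewrite -yE; congr (_ - _).
  by rewrite [RHS](@shuffle_bdr k Y 0 n) // expr0 scale1r.
have [x xE] : in_f (shuffle n u y) by apply: ideal_shuffle; left.
have yE := sh _ _ y0; exists x.
  apply: (@f_inj n.-1).
  rewrite [LHS](smap_bd f) [X in bd X]xE raddf0.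
  by apply: (@shuffle_cycle k Y 0 n).
exists (shuffle n.+1 v y).
by rewrite [X in _ = X - _]xE [X in _ = _ - X]yE opprB [RHS]addrC subrK.
Qed.
End SimplicialIdeal.

Section UnitalBar.
Variables (k : fieldType) (X : salg k).

Section Retraction.
Variable p : nat.

(** In each degree the simplices starting at a nonempty object span a direct summand. The projection
    onto it shows that [bar_incl] is injective. *)
Definition bar_retr_gen (d : decor true (X p) p) : bar_mod false (X p) p :=
  if insub (val d) is Some d' then bar_gen d' else 0.

Fact bar_retr_multilinear : multilinear_map bar_retr_gen.
Proof.
move=> u v a b c s d d1 d2 dE d1E d2E; rewrite /bar_retr_gen.
have sz w : (0 < size (u ++ w :: v))%N by rewrite size_cat addnS.
have dP (e : decor true (X p) p) w : val e = (u ++ w :: v, s) ->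
    exists2 e' : decor false (X p) p, insub (val e) = Some e' & val e' = val e.
  move=> eE; case: insubP => [e' _ e'E|]; first by exists e'.
  by case/negP; rewrite eE /is_decor /= sz; have := decorP e; rewrite eE => /andP[_].
have [e -> eE] := dP _ _ dE; have [e1 -> e1E] := dP _ _ d1E.
have [e2 -> e2E] := dP _ _ d2E.
by apply: (bar_genD (u := u) (v := v) (a := a) (b := b) (s := s)); rewrite ?eE ?e1E ?e2E.
Qed.

Definition bar_retr : {linear bar_mod true (X p) p -> bar_mod false (X p) p} :=
  bar_ext bar_retr_multilinear.

Lemma bar_inclK : cancel (bar_incl X p) bar_retr.
Proof.
move=> x; apply: (@bar_linP _ _ _ _ _ (bar_retr \o bar_incl_fun X p) idfun) => d.
rewrite [LHS](congr1 bar_retr (bar_extE _ d)) [LHS]bar_extE /bar_retr_gen.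
case: insubP => [e _ eE|]; first by congr bar_gen; apply: val_inj.
by rewrite (decorP d : is_decor _ _).
Qed.
End Retraction.

Local Notation "'in_bar' x" := (exists x', bar_incl X _ x' = x) (at level 10).

Lemma in_bar_lin p c (x y : bar_salg X p) : in_bar x -> in_bar y -> in_bar (c *: x + y).
Proof. by move=> [x' <-] [y' <-]; exists (c *: x' + y'); rewrite linearP. Qed.

Lemma in_bar0 p : in_bar (0 : bar_salg X p).
Proof. by exists 0; rewrite raddf0. Qed.

Lemma in_bar_gen p (d : decor true (X p) p) :
  (0 < size d.1)%N -> in_bar (bar_agen d : bar_salg X p).
Proof.
move=> sd; have dP : is_decor false d.
  by rewrite /is_decor /= sd; have /andP[_] := decorP d.
exists (bar_gen (Decor dP)); rewrite [LHS]bar_extE; congr bar_gen.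
exact: val_inj.
Qed.

Lemma bar_salg_ind p (P : bar_salg X p -> Prop) : P 0 ->
  (forall c (d : decor true (X p) p) x, P x -> P (c *: bar_agen d + x)) -> forall x, P x.
Proof. exact: bar_ind. Qed.

Lemma bar_smod_ind p (P : bar_smod X false p -> Prop) : P 0 ->
  (forall c (d : decor false (X p) p) x, P x -> P (c *: bar_gen d + x)) -> forall x, P x.
Proof. exact: bar_ind. Qed.

Lemma in_bar_mul_gen p (d e : decor true (X p) p) :
  (0 < size d.1 + size e.1)%N ->
  in_bar (bar_agen d * bar_agen e : bar_salg X p).
Proof. by move=> de; rewrite [_ * _]bar_agenM; apply: in_bar_gen; rewrite size_cat. Qed.

Lemma in_bar_mulr p (x y : bar_salg X p) : in_bar y -> in_bar (x * y).
Proof.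
move=> [y' <-]; move: x; apply: bar_salg_ind => [|c d x IHx].
  by rewrite mul0r; apply: in_bar0.
rewrite (@alg_linl k (bar_salg X p)); apply: in_bar_lin; last exact: IHx.
move: y' {x IHx}.
apply: bar_smod_ind => [|b e y' IHy].
  by rewrite raddf0 mulr0; apply: in_bar0.
rewrite linearP (@alg_linr k (bar_salg X p)); apply: in_bar_lin; last exact: IHy.
have -> : bar_incl X p (bar_gen e) = bar_agen (decor_incl e) by exact: bar_extE.
apply: in_bar_mul_gen; have /andP[/= e0 _] := decorP e.
by rewrite addn_gt0 e0 orbT.
Qed.

Lemma in_bar_mull p (x y : bar_salg X p) : in_bar x -> in_bar (x * y).
Proof.
move=> [x' <-]; move: y; apply: bar_salg_ind => [|c d y IHy].
  by rewrite mulr0; apply: in_bar0.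
rewrite (@alg_linr k (bar_salg X p)); apply: in_bar_lin; last exact: IHy.
 move: x' {y IHy}.
apply: bar_smod_ind => [|b e x' IHx].
  by rewrite raddf0 mul0r; apply: in_bar0.
rewrite linearP (@alg_linl k (bar_salg X p)); apply: in_bar_lin; last exact: IHx.
have -> : bar_incl X p (bar_gen e) = bar_agen (decor_incl e) by exact: bar_extE.
apply: in_bar_mul_gen; have /andP[/= e0 _] := decorP e.
by rewrite addn_gt0 e0.
Qed.

Fact decor_uP : is_decor true (([:: 1], [tuple]) : seq (X 0%N) * 0.-tuple mor).
Proof. by []. Qed.
Definition bar_u : bar_salg X 0%N := bar_agen (Decor decor_uP).

(** The single empty monomial with the empty tensor as coefficient. Under [d_0] the empty product
    produces the factor 1 of [bar_u]; [d_1] gives the unit. *)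
Fact decor_vP : is_decor true (([::], [tuple [:: [::]]]) : seq (X 1%N) * 1.-tuple mor).
Proof. by []. Qed.
Definition bar_v : bar_salg X 1%N := bar_agen (Decor decor_vP).

Lemma bd_bar_v : @bd k (bar_salg X) 1 bar_v = bar_u - 1.
Proof.
rewrite bdE !big_ord_recl big_ord0 /= expr0 expr1 scale1r scaleN1r addr0.
rewrite bar_agen1; congr (_ - _).
  rewrite [LHS]bar_act_gen; congr bar_gen; apply: val_inj.
  rewrite /= /decor_pull_def /=; congr (_, _); last by apply: val_inj.
  by rewrite /dnat fcE // inordK // /Bsym /= big_nil.
rewrite [LHS]bar_act_gen; congr bar_gen; apply: val_inj.
rewrite /= /decor_pull_def /=; congr (_, _); last by apply: val_inj.
by rewrite /dnat fcE // inordK.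
Qed.

Lemma bar_incl_weak_equiv : weak_equiv (bar_incl X).
Proof.
apply: (@simplicial_ideal_weak_equiv _ _ _ _ _ _ bar_u bar_v).
- by move=> n; apply: can_inj; exact: bar_inclK.
- by move=> n x y [Ix|Iy]; [exact: in_bar_mull|exact: in_bar_mulr].
- exact: in_bar_gen.
exact: bd_bar_v.
Qed.
End UnitalBar.

(** * Extra degeneracies of resolutions *)

Definition mk_linear (k : fieldType) (U V : lmodType k) (f : U -> V)
    (f_lin : linear f) : {linear U -> V} :=
  HB.pack_for {linear U -> V} f (GRing.isLinear.Build k U V _ f f_lin).

Section LinearLift.
Variables (k : fieldType) (U V W : lmodType k).
Variables (f : {linear V -> W}) (g : {linear U -> W}).
Hypothesis fg : forall v, exists u, g u = f v.

(** Linear maps on subspaces of [V], encoded by graphs so that unions bound chains in Zorn's lemma;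
    the last clause says that the linear relation is single-valued. *)
Definition partial_lift (G : V * U -> Prop) : Prop :=
  [/\ forall c x y, G x -> G y -> G (c *: x + y),
      forall x, G x -> g x.2 = f x.1 &
      forall x, G x -> x.1 = 0 -> x.2 = 0].

Lemma zorn_lift : exists G : V * U -> Prop,
  partial_lift G /\ forall v, exists u, G (v, u).
Proof.
have [|G [[GP Gfg G0] Gmax]] := @classical_sets.Zorn_bigcup (V * U)%type partial_lift.
  move=> F FP Ftot; split=> [c x y [A FA Ax] [B FB By]|x [A FA Ax]|x [A FA Ax]].
  - have [AB|BA] := Ftot _ _ FA FB.
      by exists B => //; have [BP _ _] := FP _ FB; apply: BP => //; apply: AB.
    by exists A => //; have [AP _ _] := FP _ FA; apply: AP => //; apply: BA.
  - by have [_ + _] := FP _ FA; apply.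
  by have [_ _ +] := FP _ FA; apply.
(* The empty graph satisfies [partial_lift], so 0 has to be adjoined by hand. *)
pose G' (z : V * U) := z = 0 \/ G z.
have G'P c x y : G' x -> G' y -> G' (c *: x + y).
  move=> [->|Gx] [->|Gy]; rewrite ?scaler0 ?add0r ?addr0; [by left|by right| |by right; apply: GP].
  right; have := GP (c - 1) x x Gx Gx.
  by rewrite -{2}[x]scale1r -scalerDl subrK.
have G'fg x : G' x -> g x.2 = f x.1 by case=> [->|/Gfg//]; rewrite !raddf0.
have G'0 x : G' x -> x.1 = 0 -> x.2 = 0 by case=> [->//|]; exact: G0.
exists G'; split=> // v0; apply: contrapT => nG.
have [u0 u0E] := fg v0; pose z0 : V * U := (v0, u0).
(* The graph extended by the line through [(v0, u0)]. *)
pose H z := exists c w, G' w /\ z = c *: z0 + w.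
apply: (Gmax H).
  split=> [z Gz|HG]; first by exists 0, z; rewrite scale0r add0r; split; [right|].
  apply: nG; exists u0; right; apply: HG; exists 1, 0; rewrite scale1r addr0.
  by split; [left|].
split=> [c _ _ [a [x [Gx ->]]] [b [y [Gy ->]]]|_ [a [x [Gx ->]]]|_ [a [x [Gx ->]]]] /=.
- exists (c * a + b), (c *: x + y); split; first exact: G'P.
  by rewrite scalerDr scalerDl scalerA addrACA.
- by rewrite !linearP /= u0E G'fg.
(* For [a != 0] a vanishing first component would put [v0] into the domain of the graph already. *)
have [->|a0] := eqVneq a 0; first by rewrite !scale0r !add0r; exact: G'0.
move=> e; case: nG.
have xE : G' ((- a^-1) *: x + 0) by apply: G'P => //; left.
have {e}e : v0 = - a^-1 *: x.1.
  rewrite scaleNr -[LHS](scalerK a0).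
  by move/eqP: e; rewrite addr_eq0 => /eqP->; rewrite scalerN.
by exists (- a^-1 *: x.2); move: xE; rewrite addr0 e.
Qed.

Lemma linear_lift : exists h : {linear V -> U}, forall v, g (h v) = f v.
Proof.
have [G [[GP Gfg G0] Gtot]] := zorn_lift.
pose h v := projT1 (cid (Gtot v)).
have hP v : G (v, h v) by exact: projT2 (cid (Gtot v)).
have h_lin : linear h.
  move=> c x y; apply/eqP; rewrite -subr_eq0; apply/eqP.
  have := GP (-1) _ _ (GP c _ _ (hP x) (hP y)) (hP (c *: x + y)).
  move=> /G0 /=; rewrite !scaleN1r addNr => /(_ erefl) e.
  by rewrite [LHS]addrC.
exists (mk_linear h_lin) => v.
exact: Gfg (hP v).
Qed.
End LinearLift.

Section ExtraDegeneracy.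
Variables (k : fieldType) (X : smod k).
Local Notation d n i := (sact X (fc n i)).
Local Notation s n i := (sact X (dg n i)).

Lemma face_face n i j (x : X n.+2) : (i < j)%N -> (j <= n.+2)%N ->
  d n i (d n.+1 j x) = d n j.-1 (d n.+1 i x).
Proof. by move=> ij jn; apply: sact_eq; apply: fc_fc. Qed.

Lemma face_deg_lt n i j (x : X n.+1) : (j < i)%N -> (i <= n.+1)%N ->
  d n.+1 j (s n.+1 i x) = s n i.-1 (d n j x).
Proof. by move=> ji iN; apply: sact_eq; apply: dg_fc_lt. Qed.

Lemma face_deg_id n i j (x : X n) : (i <= j <= i.+1)%N -> (i <= n)%N ->
  d n j (s n i x) = x.
Proof. by move=> ij iN; rewrite -sact_comp dg_fc_id // sact_id. Qed.

Lemma face_deg_gt n i j (x : X n.+1) : (i.+1 < j)%N -> (j <= n.+2)%N ->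
  d n.+1 j (s n.+1 i x) = s n i (d n j.-1 x).
Proof. by move=> ji iN; apply: sact_eq; apply: dg_fc_gt. Qed.

(** Simplicial modules are Kan: face [m] is corrected by subtracting a degeneracy [s_m], which
    leaves the faces below [m] unchanged by the matching condition. *)
Lemma horn_fill n (y : nat -> X n.+1) m :
  (forall i j, (i < j)%N -> (j <= n.+1)%N -> d n i (y j) = d n j.-1 (y i)) ->
  (m <= n.+2)%N ->
  exists w : X n.+2, forall j, (j < m)%N -> d n.+1 j w = y j.
Proof.
move=> yP; elim: m => [|m IHm] le_mn; first by exists 0.
have [w wP] := IHm (ltnW le_mn).
exists (w - s n.+1 m (d n.+1 m w - y m)) => j; rewrite ltnS leq_eqVlt.
case/orP=> [/eqP->|lt_jm]; rewrite raddfB /=.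
  by rewrite face_deg_id ?leqnn ?leqnSn // subKr.
rewrite face_deg_lt // raddfB /= face_face ?(ltnW le_mn) // wP //.
by rewrite -yP // subrr raddf0 subr0.
Qed.

(** Moore normalization: subtracting [s_m d_m w] kills face [m] and keeps the earlier zeros. The
    boundary changes by [s_m d_m (bd w)], which is 0 because all faces of [bd w] vanish. *)
Lemma normalize_chain n (w : X n.+2) m :
  (forall j, (j <= n.+1)%N -> d n j (@bd k X n.+2 w) = 0) -> (m <= n.+2)%N ->
  exists2 w' : X n.+2, @bd k X n.+2 w' = @bd k X n.+2 w &
    forall j, (j < m)%N -> d n.+1 j w' = 0.
Proof.
move=> zP; elim: m => [|m IHm] le_mn; first by exists w.
have [w1 w1E w1P] := IHm (ltnW le_mn).
exists (w1 - s n.+1 m (d n.+1 m w1)) => [|j]; last first.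
  rewrite ltnS leq_eqVlt => /orP[/eqP->|lt_jm]; rewrite raddfB /=.
    by rewrite face_deg_id ?leqnn ?leqnSn // subrr.
  by rewrite face_deg_lt // face_face ?(ltnW le_mn) // w1P // !raddf0 ?addr0.
suff e : @bd k X n.+2 (s n.+1 m (d n.+1 m w1)) = s n m (d n m (@bd k X n.+2 w1)).
  by rewrite bdB e w1E zP // raddf0 subr0.
apply/eqP; rewrite -subr_eq0 !bdE !raddf_sum /= -big_split /=; apply/eqP.
pose c j : X n.+1 := d n.+1 j (s n.+1 m (d n.+1 m w1)) - s n m (d n m (d n.+1 j w1)).
rewrite (eq_bigr (fun j : 'I_n.+3 => (-1) ^+ j *: c j)) => [|j _]; last first.
  by rewrite scalerBr; congr (_ - _); rewrite [d n m _]linearZ [LHS]linearZ.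
have lt_m : (m < n.+3)%N by lia.
have lt_m1 : (m.+1 < n.+3)%N by lia.
rewrite (bigD1 (Ordinal lt_m)) //= (bigD1 (Ordinal lt_m1)) /=; last first.
  by rewrite -val_eqE /=; lia.
(* These two terms carry opposite signs and cancel; every other [c j] is 0. *)
have cE : c m.+1 = c m.
  rewrite /c !face_deg_id ?leqnn ?leqnSn //; congr (_ - s n m _).
  by rewrite face_face.
rewrite cE big1 => [|j]; first by rewrite addr0 exprS mulN1r scaleNr subrr.
rewrite -!val_eqE /= => /andP[jm jm1]; rewrite [c j](_ : _ = 0) ?scaler0 // /c.
have := ltn_ord j; rewrite ltnS => le_j.
have [lt_jm|le_mj] := ltnP j m.
  by rewrite face_deg_lt // face_face ?(ltnW le_mn) // w1P // !raddf0 ?addr0.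
have lt_mj : (m.+1 < j)%N by lia.
by rewrite face_deg_gt // (@face_face _ m j) ?(ltnW lt_mj) // subrr.
Qed.

Variables (V : lmodType k) (e : forall n, {linear X n -> V}).
Hypothesis e_nat : forall m n (f : dmap m n) x, e m (sact X f x) = e n x.
Hypothesis e_surj : forall v, exists x, e 0%N x = v.
Hypothesis e_acyclic : forall n (x : X n), e n x = 0 -> bd x = 0 ->
  exists y : X n.+1, bd y = x.

(** A horn filler is wrong at most on the last face. The error has zero faces and is killed by [e],
    so it bounds, and normalization concentrates the bounding chain on its last face. *)
Lemma sphere_fill n (y : nat -> X n.+1) :
  (forall i j, (i < j)%N -> (j <= n.+2)%N -> d n i (y j) = d n j.-1 (y i)) ->
  exists w : X n.+2, forall j, (j <= n.+2)%N -> d n.+1 j w = y j.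
Proof.
move=> yP; have [|w wP] := @horn_fill n y n.+2 _ (leqnn _).
  by move=> i j ij jn; apply: yP => //; apply: leq_trans jn _.
pose z := y n.+2 - d n.+1 n.+2 w.
have zP j : (j <= n.+1)%N -> d n j z = 0.
  by move=> jn; rewrite raddfB /= [X in _ - X]face_face // wP // (@yP j n.+2) // subrr.
have [||w0 w0E] := @e_acyclic n.+1 z.
- by rewrite -(e_nat (fc n 0)) zP // raddf0.
- by rewrite bdE big1 // => i _; rewrite zP ?scaler0 // -ltnS.
have [|w1 w1E w1P] := @normalize_chain n w0 n.+2 _ (leqnn _).
  by rewrite w0E.
(* The boundary of [w1] is its last face with the sign [(-1) ^+ n.+2]. *)
exists (w + (-1) ^+ n *: w1) => j; rewrite leq_eqVlt => /orP[/eqP->|lt_jn]; last first.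
  by rewrite raddfD /= linearZ /= w1P // scaler0 addr0 wP.
have : @bd k X n.+2 w1 = z by rewrite w1E.
rewrite bdE big_ord_recr big1 /= => [|i _]; last by rewrite w1P ?scaler0.
rewrite add0r !exprS !mulN1r opprK => zE.
by rewrite raddfD /= linearZ /= zE addrC subrK.
Qed.

(** The second clause is the matching condition: it makes the faces prescribed for the next stage a
    sphere that can be filled. *)
Definition compatible n (sg : {linear X n -> X n.+1}) : Prop :=
  (forall x, d n n.+1 (sg x) = x) /\ (forall i j (x : X n.+1), (i < j)%N -> (j <= n.+1)%N ->
     d n i (sg (d n j x)) = d n j.-1 (sg (d n i x))).

Definition extends n (sg : {linear X n -> X n.+1})
    (sg' : {linear X n.+1 -> X n.+2}) : Prop :=
  forall j (x : X n.+1), (j <= n.+1)%N -> d n.+1 j (sg' x) = sg (d n j x).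

Lemma compatible0 : exists2 sg : {linear X 0%N -> X 1%N}, compatible sg &
  exists sec : {linear V -> X 0%N}, forall x, d 0%N 0%N (sg x) = sec (e 0%N x).
Proof.
have [sec secE] := @linear_lift k _ _ _ (idfun : {linear V -> V}) (e 0%N) e_surj.
pose f (x : X 0%N) : (X 0%N * X 0%N)%type := (sec (e 0%N x), x).
pose g (w : X 1%N) : (X 0%N * X 0%N)%type := (d 0%N 0%N w, d 0%N 1%N w).
have f_lin : linear f by move=> c x y; rewrite /f !linearP.
have g_lin : linear g by move=> c x y; rewrite /g !linearP.
have [|sg sgE] := @linear_lift k _ _ _ (mk_linear f_lin) (mk_linear g_lin).
  move=> x; have [||w wE] := @e_acyclic 0%N (sec (e 0%N x) - x).
  - by rewrite raddfB /= secE subrr.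
  - by [].
  (* A degenerate edge shifts both endpoints by the same element; here [d_1] becomes [x], and then
     [d_0] is [sec (e x)]. *)
  exists (w + s 0%N 0%N (x - d 0%N 1%N w)).
  move: wE; rewrite bdE !big_ord_recl big_ord0 /= expr0 expr1 scale1r scaleN1r addr0 => wE.
  have E j : (j <= 1)%N ->
      d 0%N j (w + s 0%N 0%N (x - d 0%N 1%N w)) = d 0%N j w + (x - d 0%N 1%N w).
    by move=> j1; rewrite raddfD /= face_deg_id.
  rewrite /= /f /g !E // [X in (_, X)]addrC subrK; congr (_, _).
  by rewrite addrCA wE addrC subrK.
exists sg.
  split=> [x|i j x ij j1]; first by have [] := sgE x.
  have -> : i = 0%N by lia.
  have -> : j = 1%N by lia.
  by have [-> _] := sgE (d 0%N 1%N x); have [-> _] := sgE (d 0%N 0%N x); rewrite !e_nat.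
by exists sec => x; have [] := sgE x.
Qed.

(** [f] lists the faces prescribed for [sg' x], which [sphere_fill] places in the image of [g];
    [linear_lift] makes the choice of fillers linear. *)
Lemma compatibleS n (sg : {linear X n -> X n.+1}) : compatible sg ->
  exists2 sg', compatible sg' & extends sg sg'.
Proof.
move=> [sgK sgC].
pose f (x : X n.+1) : {ffun 'I_n.+3 -> X n.+1} :=
  [ffun j : 'I_n.+3 => if (j <= n.+1)%N then sg (d n j x) else x].
pose g (w : X n.+2) : {ffun 'I_n.+3 -> X n.+1} := [ffun j : 'I_n.+3 => d n.+1 j w].
have f_lin : linear f.
  by move=> c x y; apply/ffunP => j; rewrite !ffunE; case: ifP => _ //; rewrite !linearP.
have g_lin : linear g.
  by move=> c x y; apply/ffunP => j; rewrite !ffunE linearP.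
have [|sg' sg'E] := @linear_lift k _ _ _ (mk_linear f_lin) (mk_linear g_lin).
  move=> x.
  have [|w wP] := @sphere_fill n (fun j => if (j <= n.+1)%N then sg (d n j x) else x).
    move=> i j ij jn; have -> : (i <= n.+1)%N by lia.
    case: leqP => [jn1|jn1]; first exact: sgC.
    have -> : j = n.+2 by lia.
    by rewrite /= sgK.
  by exists w; apply/ffunP => j; rewrite !ffunE wP // -ltnS.
have sg'P j x : (j <= n.+2)%N -> d n.+1 j (sg' x) =
    if (j <= n.+1)%N then sg (d n j x) else x.
  move=> jn; have := congr1 (fun h : {ffun 'I_n.+3 -> X n.+1} =>
    h (Ordinal (jn : (j < n.+3)%N))) (sg'E x).
  by rewrite !ffunE.
have ext : extends sg sg' by move=> j x jn; rewrite sg'P ?(leq_trans jn) // jn.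
exists sg' => //; split=> [x|i j x ij jn]; first by rewrite sg'P // ltnn.
rewrite ext; last by lia.
rewrite ext; last by lia.
by rewrite face_face.
Qed.

(* Nothing is required of the degeneracies: compatibility with each single face
   suffices for the tensor powers of sg to be contractions, since faces act
   diagonally. *)
Lemma extra_degeneracy : exists sg : forall n, {linear X n -> X n.+1},
  [/\ forall n x, d n n.+1 (sg n x) = x,
      forall n j (x : X n.+1), (j <= n.+1)%N -> d n.+1 j (sg n.+1 x) = sg n (d n j x) &
      exists sec : {linear V -> X 0%N}, forall x, d 0%N 0%N (sg 0%N x) = sec (e 0%N x)].
Proof.
have [sg0 sg0C sg0E] := compatible0.
pose step n (sg : {f : {linear X n -> X n.+1} | compatible f}) :=
  cid2 (compatibleS (svalP sg)).
pose sg := nat_rect (fun n => {f : {linear X n -> X n.+1} | compatible f})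
  (exist _ sg0 sg0C) (fun n f => exist _ (s2val (step n f)) (s2valP (step n f))).
exists (fun n => sval (sg n)); split=> //.
  by move=> n; case: (svalP (sg n)).
by move=> n; exact: (s2valP' (step n (sg n))).
Qed.
End ExtraDegeneracy.

(** * Homotopy invariance of the bar construction *)

Section Contractions.
Variables (k : fieldType) (Y : smod k) (sg : forall n, {linear Y n -> Y n.+1}).

(** In degree 0 a condition on [x] alone suffices: [sg] contracts onto an augmentation, and the
    lemma serves elements of its kernel. *)
Lemma bd_last_contract n (x : Y n) :
  (forall n (x : Y n), sact Y (fc n n.+1) (sg n x) = x) ->
  (forall n j (x : Y n.+1), (j <= n.+1)%N ->
     sact Y (fc n.+1 j) (sg n.+1 x) = sg n (sact Y (fc n j) x)) ->
  (n = 0%N -> sact Y (fc n 0) (sg n x) = 0) -> bd x = 0 ->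
  bd ((-1) ^+ n.+1 *: sg n x) = x.
Proof.
move=> sgK sgC x00 x0; rewrite bdZ bdE big_ord_recr /= sgK.
rewrite [X in X + _](_ : _ = 0) ?add0r.
  by rewrite scalerA -signr_odd -signr_addb addbb scale1r.
case: n x x00 x0 => [|n] x x00 x0; first by rewrite big_ord1 x00 // scaler0.
transitivity (sg n (@bd k Y n.+1 x)); last by rewrite x0 raddf0.
rewrite bdE raddf_sum; apply: eq_bigr => i _.
by rewrite [RHS]linearZ sgC // -ltnS.
Qed.

Lemma bd_first_contract n (x : Y n) :
  (forall n (x : Y n), sact Y (fc n 0) (sg n x) = x) ->
  (forall n j (x : Y n.+1), (j <= n.+1)%N ->
     sact Y (fc n.+1 j.+1) (sg n.+1 x) = sg n (sact Y (fc n j) x)) ->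
  (n = 0%N -> sact Y (fc n 1) (sg n x) = 0) -> bd x = 0 ->
  bd (sg n x) = x.
Proof.
move=> sgK sgC x00 x0; rewrite bd_bdp sgK [X in _ - X](_ : _ = 0) ?subr0 //.
case: n x x00 x0 => [|n] x x00 x0; first by rewrite bdp1 x00.
transitivity (sg n (@bd k Y n.+1 x)); last by rewrite x0 raddf0.
rewrite bdE raddf_sum; apply: eq_bigr => i _.
by rewrite [RHS]linearZ sgC // -ltnS.
Qed.
End Contractions.

Section BarLinear.
Variable k : fieldType.

Section Map.
Variables (A B : alg k) (f : {linear A -> B}) (aug : bool) (p : nat).

(** Functoriality in merely linear maps, since an extra degeneracy is not multiplicative.
    Commutation with the nerve operators, in [bar_lin_act], asks for an algebra map. *)
Fact decor_linP (d : decor aug A p) : is_decor aug (map f d.1, d.2).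
Proof. by rewrite /is_decor /= size_map; apply: decorP d. Qed.
Definition decor_lin (d : decor aug A p) : decor aug B p := Decor (decor_linP d).

Fact bar_lin_multilinear :
  multilinear_map (fun d : decor aug A p => bar_gen (decor_lin d)).
Proof.
move=> u v a b c s d d1 d2 dE d1E d2E.
apply: (@bar_genD _ _ _ _ (map f u) (map f v) (f a) (f b) c s).
- by rewrite /= dE /= map_cat /= linearP.
- by rewrite /= d1E /= map_cat.
- by rewrite /= d2E /= map_cat.
Qed.

Definition bar_lin : {linear bar_mod aug A p -> bar_mod aug B p} :=
  bar_ext bar_lin_multilinear.

Lemma bar_lin_gen d : bar_lin (bar_gen d) = bar_gen (decor_lin d).
Proof. exact: bar_extE. Qed.
End Map.

Lemma bar_lin_comp (A B C : alg k) (f : {linear A -> B}) (g : {linear B -> C})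
    (h : {linear A -> C}) aug p (x : bar_mod aug A p) :
  (forall a, h a = g (f a)) -> bar_lin h aug p x = bar_lin g aug p (bar_lin f aug p x).
Proof.
move=> hE; apply: (@bar_linP _ _ _ _ _ (bar_lin h aug p) (bar_lin g aug p \o bar_lin f aug p)) => d.
rewrite [RHS](congr1 _ (bar_lin_gen _ d)) !bar_lin_gen; congr bar_gen.
apply: val_inj => /=; congr (_, _); rewrite -map_comp; exact: eq_map.
Qed.

Lemma bar_lin_id (A : alg k) (f : {linear A -> A}) aug p (x : bar_mod aug A p) :
  (forall a, f a = a) -> bar_lin f aug p x = x.
Proof.
move=> fE; apply: (@bar_linP _ _ _ _ _ (bar_lin f aug p) idfun) => d.
rewrite bar_lin_gen; congr bar_gen; apply: val_inj => /=.
by rewrite (eq_map fE) map_id; case: (val d).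
Qed.

Lemma bar_lin_act (A B : alg k) (f : {linear A -> B}) aug q p (th : dmap q p)
    (x : bar_mod aug A p) : f 1 = 1 -> {morph f : x y / x * y} ->
  bar_lin f aug q (bar_act (const_salg A) aug th x) =
  bar_act (const_salg B) aug th (bar_lin f aug p x).
Proof.
move=> f1 fM.
apply: (@bar_linP _ _ _ _ _ (bar_lin f aug q \o bar_act (const_salg A) aug th)
  (bar_act (const_salg B) aug th \o bar_lin f aug p)) => d.
rewrite [LHS](congr1 _ (bar_act_gen th d)) [LHS]bar_lin_gen.
rewrite [RHS](congr1 _ (bar_lin_gen _ d)) [RHS]bar_act_gen.
congr bar_gen; apply: val_inj; rewrite /= /decor_pull_def /= size_map !map_id.
congr (_, _); rewrite Bsym_map //.
have /andP[_ dP] := decorP d.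
by have := is_mor_arrow dP (leq0n (dnat th 0)); rewrite vertex0.
Qed.

Section Bisimplicial.
Variables (X : salg k) (aug : bool).

(** The first index is the nerve direction over a fixed algebra, the second the simplicial direction
    of [X]; the diagonal is [bar_smod]. *)
Definition bar2_act m n p q (f : dmap m p) (g : dmap n q) :
    {linear bar_mod aug (X q) p -> bar_mod aug (X n) m} :=
  bar_act (const_salg (X n)) aug f \o bar_lin (salg_act X g) aug p.

Lemma bar2_actE m n p q (f : dmap m p) (g : dmap n q) x :
  bar2_act f g x = bar_act (const_salg (X n)) aug f (bar_lin (salg_act X g) aug p x).
Proof. by []. Qed.

Fact bar2_act_id p q x : bar2_act (dmap_id p) (dmap_id q) x = x.
Proof.
rewrite bar2_actE (@bar_act_id k (const_salg (X q))); apply: bar_lin_id.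
exact: salg_act_id.
Qed.

Fact bar2_act_comp l m n l' m' n' (g : dmap m n) (f : dmap l m)
    (g' : dmap m' n') (f' : dmap l' m') x :
  bar2_act (dmap_comp g f) (dmap_comp g' f') x = bar2_act f f' (bar2_act g g' x).
Proof.
rewrite !bar2_actE bar_lin_act; [|exact: salg_act1|exact: salg_actM].
rewrite (@bar_act_comp k (const_salg (X l'))).
by rewrite (bar_lin_comp (f := salg_act X g') (g := salg_act X f')) // => a; exact: salg_act_comp.
Qed.

Definition bar2 : bsmod k := Bsmod bar2_act_id bar2_act_comp.

Lemma bar2_diag p q (th : dmap q p) x : bar2_act th th x = bar_act X aug th x.
Proof.
apply: (@bar_linP _ _ _ _ _ (bar2_act th th) (bar_act X aug th)) => d.
rewrite bar2_actE bar_lin_gen [LHS](@bar_act_gen k (const_salg (X q))) bar_act_gen.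
congr bar_gen; apply: val_inj.
by rewrite /= /decor_pull_def /= size_map map_id.
Qed.

Lemma bar2E m n p q (f : dmap m p) (g : dmap n q) (x : bar2 p q) :
  bact bar2 f g x = bar_act (const_salg (X n)) aug f (bar_lin (salg_act X g) aug p x).
Proof. by []. Qed.

Definition bar2_diag_map : smap (bs_diag bar2) (bar_smod X aug) :=
  @Smap k (bs_diag bar2) (bar_smod X aug)
    (fun n => idfun : {linear bar_mod aug (X n) n -> bar_mod aug (X n) n})
    (fun q p th x => bar2_diag th x).

Lemma bar2_diag_bd n (x : bar_mod aug (X n) n) :
  @bd k (bs_diag bar2) n x = @bd k (bar_smod X aug) n x.
Proof. exact: (smap_bd bar2_diag_map). Qed.

Lemma bar2_col m n p (f : dmap m n) (x : bar_mod aug (X n) p) :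
  bar2_act (dmap_id p) f x = bar_lin (salg_act X f) aug p x.
Proof. by rewrite bar2_actE (@bar_act_id k (const_salg (X m))). Qed.

Lemma bar2_row m n p (f : dmap m n) (x : bar_mod aug (X p) n) :
  bar2_act f (dmap_id p) x = bar_act (const_salg (X p)) aug f x.
Proof. by rewrite bar2_actE (@bar_lin_id _ (salg_act X (dmap_id p))) //; exact: salg_act_id. Qed.
End Bisimplicial.

Section Resolution.
Variables (A : alg k) (R : salg k) (f : samap R (const_salg A)).
Hypothesis fW : weak_equiv f.

(** The constant algebra has zero boundary from degree 1 to degree 0, so surjectivity on classes is
    surjectivity on elements in degree 0; degeneracies carry it to all degrees. *)
Lemma resolution_surj n (a : A) : exists x : R n, f n x = a.
Proof.
have [x xE] : exists x : R 0%N, f 0%N x = a.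
  have [g _ gK] := fW 0; have /(hclass_eqP _ _)[||y] : 
      @hclass k (const_salg A) 0 (f 0%N (hrepr (g (@hclass k (const_salg A) 0 a)))) = 
      @hclass k (const_salg A) 0 a by exact: gK.
  - by [].
  - by [].
  rewrite bdE !big_ord_recl big_ord0 /= expr0 expr1 scale1r scaleN1r addr0 subrr.
  by move/esym/eqP; rewrite subr_eq0 => /eqP<-; eexists.
by exists (salg_act R (dconst n 0) x); rewrite samap_nat.
Qed.

Lemma resolution_acyclic n (x : R n) : f n x = 0 -> @bd k R n x = 0 ->
  exists y : R n.+1, @bd k R n.+1 y = x.
Proof.
move=> fx0 x0; have /(hclass_eqP x0 (bd0 _ _))[y yE] : @hclass k R n x = hclass 0.
  apply: (bij_inj (fW n)); rewrite !hmap_hclass ?bd0 // [X in hclass X]fx0.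
  by congr hclass; rewrite raddf0.
by exists y; rewrite yE subr0.
Qed.

Variable aug : bool.

Lemma bar_map_lin n (x : bar_mod aug (R n) n) : bar_map f aug n x = bar_lin (f n) aug n x.
Proof.
apply: (@bar_linP _ _ _ _ _ (bar_map_fun f aug n) (bar_lin (f n) aug n)) => d.
by rewrite bar_lin_gen [LHS]bar_extE; congr bar_gen; apply: val_inj.
Qed.

Lemma bar_lin_surj p n (y : bar_mod aug A p) : exists x, bar_lin (f n) aug p x = y.
Proof.
move: y; apply: bar_ind => [|c d y [x xE]]; first by exists 0; rewrite raddf0.
have [r rE] : exists r : seq (R n), map (f n) r = d.1.
  elim: (d.1) => [|a s [r rE]]; first by exists [::].
  by have [z zE] := resolution_surj n a; exists (z :: r); rewrite /= zE rE.
have dP : is_decor aug (r, d.2).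
  have := decorP d; rewrite /is_decor /=.
  by rewrite -(size_map (f n) r) rE.
have dE : decor_lin (f n) (Decor dP) = d.
  by apply: val_inj; rewrite /= rE; case: (val d).
by exists (c *: bar_gen (Decor dP) + x); rewrite linearP xE bar_lin_gen dE.
Qed.

Let S p q (x : bar2 R aug p q) : Prop := bar_lin (f q) aug p x = 0.

Lemma bar_ker_closed : sub_closed S.
Proof.
split=> [p q|p q c x y|m n p q g h x]; rewrite /S; first by rewrite raddf0.
  by move=> x0 y0; rewrite linearP x0 y0 scaler0 addr0.
move=> x0; rewrite bar2E bar_lin_act; [|exact: samap1|exact: samapM].
by rewrite -(bar_lin_comp (h := f q)) ?x0 ?raddf0 // => a; rewrite samap_nat.
Qed.

(* An extra degeneracy of R acts factorwise on the tensor powers of R. *)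
Lemma bar_ker_acyclic p : sub_acyclic (Y := bs_col (bar2 R aug) p) (@S p).
Proof.
have [sg [sgK sgC [sec secE]]] := @extra_degeneracy k R A (fun n => f n)
  (fun m n g x => samap_nat f g x) (resolution_surj 0) resolution_acyclic.
pose Sg n := bar_lin (sg n : {linear R n -> R n.+1}) aug p.
have fsg n x : f n.+1 (sg n x) = f n x.
  by rewrite -[in RHS](sgK n x); rewrite [RHS]samap_nat.
have fSg n x : bar_lin (f n.+1) aug p (Sg n x) = bar_lin (f n) aug p x.
  apply/esym; apply: (@bar_lin_comp (R n) (R n.+1) A (sg n) (f n.+1) (f n)) => a.
  by rewrite fsg.
move=> n x Sx x0; exists ((-1) ^+ n.+1 *: Sg n x).
  transitivity ((-1) ^+ n.+1 *: bar_lin (f n.+1) aug p (Sg n x)); first exact: linearZ.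
  by rewrite fSg (Sx : bar_lin (f n) aug p x = 0) scaler0.
apply: (@bd_last_contract k (bs_col (bar2 R aug) p) Sg) => //.
- move=> m y; rewrite [LHS]bar2_col -(bar_lin_comp (h := idfun)); first exact: bar_lin_id.
  by move=> a; exact/esym/sgK.
- move=> m j y jm; rewrite [LHS]bar2_col [X in _ = Sg m X]bar2_col /Sg.
  pose h := sg m \o salg_act R (fc m j) : {linear R m.+1 -> R m.+1}.
  by rewrite -!(bar_lin_comp (h := h)) // => a; rewrite [RHS]sgC.
(* In degree 0 the face [d_0] after [sg] is [sec] after [f], which kills the kernel of the tensor
   powers of [f]. *)
move=> n0; subst n; rewrite [LHS]bar2_col -(bar_lin_comp (h := sec \o f 0%N)).
  by rewrite (bar_lin_comp (f := f 0%N) (g := sec)) // [X in bar_lin _ _ _ X]Sx raddf0.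
by move=> a; rewrite [RHS]secE.
Qed.

Lemma bar_map_weak_equiv : weak_equiv (bar_map f aug).
Proof.
apply: weak_equiv_acyclic_ker => [n y|n x fx x0].
  by have [x xE] := bar_lin_surj n y; exists x; rewrite bar_map_lin.
have [||y Sy yE] := @diag_acyclic k (bar2 R aug) S bar_ker_closed bar_ker_acyclic n x.
- by rewrite /S -bar_map_lin.
- by rewrite bar2_diag_bd.
by exists y; [rewrite bar_map_lin|rewrite -bar2_diag_bd].
Qed.
End Resolution.
End BarLinear.

(** * The bar construction of a free algebra *)

(* The j-th entry of v is moved to position t_j. *)
Definition arrange (T : Type) (v : seq (seq T)) (t : seq nat) : seq (seq T) :=
  [seq nth [::] v (index i t) | i <- iota 0 (size v)].

Definition select (T : Type) (v : seq (seq T)) (r : seq nat) : seq (seq T) :=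
  [seq nth [::] v j | j <- r].

Lemma perm_map_nth (t r : seq nat) : perm_eq r (iota 0 (size t)) ->
  perm_eq [seq nth 0%N t j | j <- r] t.
Proof.
move/(perm_map (nth 0%N t))/perm_trans; apply.
by rewrite map_nth_iota0 // take_size.
Qed.

(** Composition with [r] is injective on the finite list of all permutations, hence rearranges
    it. *)
Lemma perm_select_permutations m (r : seq nat) : perm_eq r (iota 0 m) ->
  perm_eq [seq [seq nth 0%N t j | j <- r] | t <- permutations (iota 0 m)]
          (permutations (iota 0 m)).
Proof.
move=> rP; set P := permutations (iota 0 m).
have Psize t : t \in P -> size t = m by rewrite mem_permutations => /perm_size->; rewrite size_iota.
have uP : uniq P by exact: permutations_uniq.
have u1 : uniq [seq [seq nth 0%N t j | j <- r] | t <- P].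
  rewrite map_inj_in_uniq // => t t' Pt Pt' e.
  apply: (@eq_from_nth _ 0%N); rewrite ?Psize // => j lt_jm.
  have rj : j \in r by rewrite (perm_mem rP) mem_iota.
  have := congr1 (fun u => nth 0%N u (index j r)) e.
  by rewrite !(nth_map 0%N) ?index_mem // !nth_index.
have [||_ eq_P] := @uniq_min_size _ _ P u1; last exact: uniq_perm.
  move=> _ /mapP[t Pt ->]; rewrite mem_permutations.
  apply: perm_trans (perm_map_nth _) _; first by rewrite Psize.
  by rewrite -mem_permutations.
by rewrite size_map.
Qed.

Lemma arrange_select (T : Type) (v : seq (seq T)) (r t : seq nat) :
  perm_eq r (iota 0 (size v)) -> perm_eq t (iota 0 (size v)) ->
  arrange (select v r) [seq nth 0%N t j | j <- r] = arrange v t.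
Proof.
move=> rP tP; have sr : size r = size v by rewrite (perm_size rP) size_iota.
have st : size t = size v by rewrite (perm_size tP) size_iota.
rewrite /arrange {1}/select size_map sr; apply/eq_in_map => i.
rewrite mem_iota /= add0n => lt_i.
have ti : i \in t by rewrite (perm_mem tP) mem_iota.
have ij : (index i t < size v)%N by rewrite -st index_mem.
have rj : index i t \in r by rewrite (perm_mem rP) mem_iota.
have -> : index i [seq nth 0%N t j | j <- r] = index (index i t) r.
  rewrite -{1}(nth_index 0%N ti) -{1}(nth_index 0%N rj) -(nth_map _ 0%N) ?index_mem //.
  rewrite index_uniq ?size_map ?index_mem //.
  by rewrite (perm_uniq (perm_map_nth _)) ?(perm_uniq tP) ?iota_uniq ?st.
by rewrite /select (nth_map 0%N) ?index_mem // nth_index.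
Qed.

(** Rearranging the letters by [r] only relabels the summation index. This makes averages over all
    orderings compatible with morphisms, which permute letters. *)
Lemma sum_arrange (V : zmodType) (T : Type) (v : seq (seq T)) (r : seq nat)
    (G : seq (seq T) -> seq nat -> V) : perm_eq r (iota 0 (size v)) ->
  \sum_(t <- permutations (iota 0 (size v))) G (arrange (select v r) t) t =
  \sum_(t <- permutations (iota 0 (size v)))
    G (arrange v t) [seq nth 0%N t j | j <- r].
Proof.
move=> rP; rewrite -(perm_big _ (perm_select_permutations rP)) big_map.
apply: eq_big_seq => t; rewrite mem_permutations => tP.
by rewrite arrange_select.
Qed.

Definition subst_words (T : Type) (f : mor) (v : seq (seq T)) : seq (seq T) :=
  [seq flatten (select v Y) | Y <- f].

Lemma nth_map_nil (S T : Type) (h : seq S -> seq T) (f : seq (seq S)) i :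
  h [::] = [::] -> nth [::] (map h f) i = h (nth [::] f i).
Proof.
move=> h0; case: (ltnP i (size f)) => [lt_i|le_i]; first by rewrite (nth_map [::]).
by rewrite !nth_default ?size_map.
Qed.

Lemma subst_words_comp (T : Type) g f (v : seq (seq T)) :
  subst_words (mor_comp g f) v = subst_words g (subst_words f v).
Proof.
rewrite /subst_words -map_comp; apply: eq_map => Y /=.
elim: Y => //= i Y IHY; rewrite /select map_cat flatten_cat [X in _ ++ X]IHY.
by rewrite nth_map_nil.
Qed.

Lemma mor_comp_map g f (h : nat -> nat) :
  mor_comp g [seq map h Y | Y <- f] = [seq map h Y | Y <- mor_comp g f].
Proof.
rewrite /mor_comp -map_comp; apply: eq_map => Y /=.
by rewrite map_flatten -map_comp; congr flatten; apply: eq_map => i /=; rewrite nth_map_nil.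
Qed.

Lemma flatten_subst_words (T : Type) f (v : seq (seq T)) :
  flatten (subst_words f v) = flatten (select v (flatten f)).
Proof.
by elim: f => //= Y f IHf; rewrite IHf /select map_cat flatten_cat.
Qed.

Section Patterns.
Variables (T : Type) (ws : seq (seq T)).
Let m := size (flatten ws).

Definition letters : seq (seq T) := [seq [:: x] | x <- flatten ws].
(** The tuple of monomials with the word lengths of [ws] and with variables [t] in reading order.
    Paired with [arrange letters t] it gives the m! presentations of [ws] from its letters. *)
Definition pattern (t : seq nat) : mor := reshape (shape ws) t.

Lemma size_letters : size letters = m.
Proof. by rewrite size_map. Qed.

Lemma pattern_map t : size t = m ->
  pattern t = [seq map (nth 0%N t) Y | Y <- pattern (iota 0 m)].
Proof.
by move=> st; rewrite /pattern map_reshape -st map_nth_iota0 // take_size.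
Qed.

Lemma size_pattern t : size (pattern t) = size ws.
Proof. by rewrite size_reshape size_map. Qed.

Lemma flatten_pattern t : size t = m -> flatten (pattern t) = t.
Proof. by move=> st; rewrite reshapeKr // st -size_flatten. Qed.

Lemma is_mor_pattern t : perm_eq t (iota 0 m) -> is_mor m (pattern t).
Proof. by move=> tP; rewrite /is_mor flatten_pattern // (perm_size tP) size_iota. Qed.

Lemma subst_pattern_letters : subst_words (pattern (iota 0 m)) letters = ws.
Proof.
rewrite /subst_words /pattern (map_comp flatten (select letters)) map_reshape.
rewrite -size_letters map_nth_iota0 // take_size.
rewrite /letters -map_reshape flattenK -map_comp -[RHS]map_id.
by apply: eq_map => w /=; rewrite flatten_seq1.
Qed.

Lemma subst_pattern t : perm_eq t (iota 0 m) ->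
  subst_words (pattern t) (arrange letters t) = ws.
Proof.
move=> tP; have st : size t = m by rewrite (perm_size tP) size_iota.
rewrite pattern_map // -[RHS]subst_pattern_letters /subst_words -map_comp.
apply/eq_in_map => Y PY /=; congr flatten; rewrite /select -map_comp.
apply/eq_in_map => j Yj /=; have lt_j : (j < m)%N.
  by apply: (is_mor_lt _ PY Yj); apply: is_mor_pattern.
have lt_tj : (nth 0%N t j < m)%N.
  by have : nth 0%N t j \in t by [apply: mem_nth; rewrite st]; rewrite (perm_mem tP) mem_iota.
rewrite /arrange size_letters (nth_map 0%N) ?size_iota // nth_iota // add0n.
by rewrite index_uniq ?st // (perm_uniq tP) iota_uniq.
Qed.

Lemma letters_flatten_select (r : seq nat) : {in r, forall j, (j < m)%N} ->
  [seq [:: x] | x <- flatten (select letters r)] = select letters r.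
Proof.
elim: r => //= j r IHr jrP; rewrite map_cat IHr; last first.
  by move=> i ri; apply: jrP; rewrite inE ri orbT.
have [x ->] : exists x, nth [::] letters j = [:: x].
  have := jrP j (mem_head _ _); rewrite /letters /m; move: j {jrP}.
  by elim: (flatten ws) => [|x w IHw] [|j] //=; [exists x|apply: IHw].
by [].
Qed.

Lemma shape_subst_letters f : {in flatten f, forall j, (j < m)%N} ->
  shape (subst_words f letters) = shape f.
Proof.
elim: f => //= Y f IHf fP; congr cons; last first.
  by apply: IHf => j fj; apply: fP; rewrite mem_cat fj orbT.
have YP : {in Y, forall j, (j < m)%N} by move=> j Yj; apply: fP; rewrite mem_cat Yj.
rewrite -(size_map (fun x => [:: x])) letters_flatten_select //.
exact: size_map.
Qed.
End Patterns.

Section PatternsComp.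
Variables (T : Type) (ws : seq (seq T)) (g : mor).
Hypothesis gP : is_mor (size ws) g.
Let m := size (flatten ws).
Let Q := mor_comp g (pattern ws (iota 0 m)).

Lemma is_mor_pattern_comp : is_mor m Q.
Proof.
apply: is_mor_comp; last by rewrite size_pattern.
exact: is_mor_pattern.
Qed.

Let Qlt : {in flatten Q, forall j, (j < m)%N}.
Proof. by move=> j; rewrite (perm_mem is_mor_pattern_comp) mem_iota. Qed.

Lemma subst_wordsE : subst_words g ws = subst_words Q (letters ws).
Proof. by rewrite subst_words_comp subst_pattern_letters. Qed.

Lemma letters_subst : letters (subst_words g ws) = select (letters ws) (flatten Q).
Proof. by rewrite /letters subst_wordsE flatten_subst_words letters_flatten_select. Qed.

Lemma size_flatten_subst : size (flatten (subst_words g ws)) = m.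
Proof.
rewrite -size_letters letters_subst size_map.
by rewrite (perm_size is_mor_pattern_comp) size_iota.
Qed.

(** [g] permutes the letters by [flatten Q], so the patterns of the image are those of [ws] followed
    by [g], relabelled by this permutation. *)
Lemma pattern_subst t : size t = m ->
  pattern (subst_words g ws) [seq nth 0%N t j | j <- flatten Q] =
  mor_comp g (pattern ws t).
Proof.
move=> st; rewrite (@pattern_map _ ws t) // mor_comp_map -/Q.
rewrite /pattern subst_wordsE shape_subst_letters //.
rewrite map_flatten -{1}[shape Q](_ : shape [seq map (nth 0%N t) Y | Y <- Q] = _) ?flattenK //.
by rewrite /shape -map_comp; apply: eq_map => Y /=; rewrite size_map.
Qed.
End PatternsComp.

Section Tensors.
Variables (k : fieldType) (A : alg k) (p : nat).

(** Made total by the value 0 off composable chains, so that linearity in each factor can be used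
    without carrying proofs. *)
Definition tgen (a : seq A) (s : p.-tuple mor) : bar_mod true A p :=
  if insub (a, s) is Some d then bar_gen d else 0.

Lemma tgenE (d : decor true A p) : tgen d.1 d.2 = bar_gen d.
Proof. by rewrite /tgen -surjective_pairing valK. Qed.

Lemma tgen_lin u v c a b (s : p.-tuple mor) :
  tgen (u ++ (c *: a + b) :: v) s = c *: tgen (u ++ a :: v) s + tgen (u ++ b :: v) s.
Proof.
have eP w : is_decor true (u ++ (c *: a + b) :: v, s) = is_decor true (u ++ w :: v, s).
  by rewrite /is_decor /= !size_cat.
rewrite /tgen; case: insubP => [d _ dE|nd]; last first.
  by rewrite !insubF ?scaler0 ?addr0 // -eP; apply/negbTE.
have d1P : is_decor true (u ++ a :: v, s) by rewrite -eP -dE; apply: decorP.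
have d2P : is_decor true (u ++ b :: v, s) by rewrite -eP -dE; apply: decorP.
by rewrite !insubT (bar_genD (d1 := Decor d1P) (d2 := Decor d2P) dE).
Qed.

Definition decor_mul (d : decor true A p) : A := \prod_(a <- d.1) a.

Fact decor_mul_multilinear : multilinear_map decor_mul.
Proof.
move=> u v a b c s d d1 d2 dE d1E d2E.
rewrite /decor_mul dE d1E d2E /= !big_cat /= !big_cons.
by rewrite mulrDl mulrDr -algZAl -algZAr.
Qed.

Definition bar_mul : {linear bar_mod true A p -> A} := bar_ext decor_mul_multilinear.

Lemma bar_mul_gen d : bar_mul (bar_gen d) = \prod_(a <- d.1) a.
Proof. exact: bar_extE. Qed.
End Tensors.

Lemma lin_ext_lin (k : fieldType) (K : choiceType) (W : lmodType k) c (h h' : K -> W)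
    (x : {malg k[K]}) :
  lin_ext (fun w => c *: h w + h' w) x = c *: lin_ext h x + lin_ext h' x.
Proof.
rewrite /lin_ext scaler_sumr -big_split; apply: eq_bigr => w _ /=.
by rewrite scalerDr !scalerA mulrC.
Qed.

Lemma eq_lin_ext (k : fieldType) (K : choiceType) (W : lmodType k) (h h' : K -> W)
    (x : {malg k[K]}) : h =1 h' -> lin_ext h x = lin_ext h' x.
Proof. by move=> hh'; apply: eq_bigr => w _; rewrite hh'. Qed.

Lemma lin_ext_comp (k : fieldType) (K : choiceType) (W W' : lmodType k)
    (f : {linear W -> W'}) (h : K -> W) (x : {malg k[K]}) :
  f (lin_ext h x) = lin_ext (fun w => f (h w)) x.
Proof. by rewrite /lin_ext raddf_sum; apply: eq_bigr => w _; exact: linearZ. Qed.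

Lemma spanned_ind (k : fieldType) (V : lmodType k) (G P : V -> Prop) :
  (forall x, x \in Defs.span G) -> P 0 ->
  (forall c g x, G g -> P x -> P (c *: g + x)) -> forall x, P x.
Proof. by move=> spanG P0 PD x; have /asboolP := spanG x; elim=> // c g y Gg _; exact: PD. Qed.

(** Both sides of the hypothesis are linear in each of the four variables, which are extended from
    the spanning set one at a time. *)
Lemma comm_ideal_ker (k : fieldType) (A : alg k) (W : lmodType k) (f : {linear A -> W})
    (G : A -> Prop) : (forall x, x \in Defs.span G) ->
  (forall u a b v, G u -> G a -> G b -> G v -> f (u * (a * b) * v) = f (u * (b * a) * v)) ->
  forall x, x \in @comm_ideal k A -> f x = 0.
Proof.
move=> spanG fG; apply: span_ker => _ [u [_ [v [[a [b ->]] ->]]]].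
transitivity (f (u * (a * b) * v) - f (u * (b * a) * v)).
  by rewrite mulrBr mulrBl linearB.
apply/eqP; rewrite subr_eq0; apply/eqP.
have ind P := @spanned_ind k A G P spanG.
have {}fG u' a' b' v' : G u' -> G a' -> G b' ->
    f (u' * (a' * b') * v') = f (u' * (b' * a') * v').
  move=> Gu Ga Gb; move: v'; apply: ind => [|c g x Gg IH]; first by rewrite !mulr0.
  by rewrite !alg_linr !linearP IH fG.
have {}fG u' a' b' v' : G u' -> G a' -> f (u' * (a' * b') * v') = f (u' * (b' * a') * v').
  move=> Gu Ga; move: b'; apply: ind => [|c g x Gg IH].
    by rewrite !(mulr0, mul0r).
  by rewrite !(alg_linr, alg_linl) !linearP IH fG.
have {}fG u' a' b' v' : G u' -> f (u' * (a' * b') * v') = f (u' * (b' * a') * v').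
  move=> Gu; move: a'; apply: ind => [|c g x Gg IH].
    by rewrite !(mulr0, mul0r).
  by rewrite !(alg_linr, alg_linl) !linearP IH fG.
move: u; apply: ind => [|c g x Gg IH]; first by rewrite !mul0r.
by rewrite !alg_linl !linearP IH fG.
Qed.

Lemma dnat_fc p i j : (j <= p)%N -> (i <= p.+1)%N -> dnat (fc p i) j = bump i j.
Proof. by move=> jp ip; rewrite /dnat fcE // inordK. Qed.

Lemma dnat_dcone0 q p (th : dmap q p) : dnat (dcone th) 0 = 0%N.
Proof. by rewrite /dnat (_ : inord 0 = ord0) ?dcone0 //; apply: val_inj; rewrite /= inordK. Qed.

Lemma dnat_dconeS q p (th : dmap q p) j : (j <= q)%N ->
  dnat (dcone th) j.+1 = (dnat th j).+1.
Proof.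
move=> jq; rewrite /dnat (_ : inord j.+1 = lift ord0 (inord j : 'I_q.+1)) ?dcone_lift //.
by apply: val_inj; rewrite /= !inordK // ltnS.
Qed.

Lemma subst_words_id (T : Type) (v : seq (seq T)) : subst_words (mor_id (size v)) v = v.
Proof.
rewrite /subst_words /mor_id -map_comp -[RHS](mkseq_nth [::]) /mkseq.
by apply: eq_map => i /=; rewrite cats0.
Qed.

(** * The symmetrizing contraction for the free algebra on an alphabet *)

Section WordAlgebra.
Variables (k : fieldType) (L : choiceType).

Definition word_alg : alg k := malg_alg k {fmonom L}.
Local Notation T := word_alg.

Definition word (w : seq L) : T := << FMonom w >>.

Lemma word_nil : word [::] = 1.
Proof. by rewrite /word -fmE. Qed.

Lemma word_cat u v : word (u ++ v) = word u * word v.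
Proof. by rewrite [RHS]malgU_mul /mmul /= /fmmul fmE. Qed.

Lemma word_prod (s : seq (seq L)) : \prod_(w <- s) word w = word (flatten s).
Proof.
elim: s => [|w s IHs]; first by rewrite big_nil word_nil.
by rewrite big_cons IHs word_cat.
Qed.

Lemma word_linP (W : lmodType k) (f g : {linear T -> W}) :
  (forall w, f (word w) = g (word w)) -> f =1 g.
Proof. by move=> fg; apply: malg_linP => -[w]; exact: fg. Qed.

Lemma word_ind (P : T -> Prop) : P 0 ->
  (forall c w x, P x -> P (c *: word w + x)) -> forall x, P x.
Proof.
move=> P0 PD x; rewrite (malg_basis x).
by elim/big_rec: _ => // -[w] y _; exact: PD.
Qed.

Lemma Bsym_words f (ws : seq (seq L)) : is_mor (size ws) f ->
  Bsym f (map word ws) = map word (subst_words f ws).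
Proof.
move=> fP; rewrite /Bsym /subst_words -map_comp; apply/eq_in_map => Y fY /=.
rewrite -word_prod big_map; apply: eq_big_seq => i Yi.
by rewrite (nth_map [::]) // (is_mor_lt fP fY Yi).
Qed.

Section Level.
Variable p : nat.

Definition wgen (ws : seq (seq L)) (s : p.-tuple mor) : bar_mod true T p :=
  tgen (map word ws) s.

(** Coordinates in the basis of tensors of words. They allow a linear map out of [bar_mod] to be
    prescribed by arbitrary values on words and chains ([wext]). *)
Fixpoint expand (a : seq T) : {malg k[seq (seq L)]} :=
  if a is x :: a' then
    lin_ext (fun w : {fmonom L} => lin_ext (fun ws => << (w : seq L) :: ws >>) (expand a')) x
  else << [::] >>.

Lemma expand_words ws : expand (map word ws) = << ws >>.
Proof. by elim: ws => //= w ws ->; rewrite lin_extU lin_extU. Qed.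

Lemma expand_lin u v c a b :
  expand (u ++ (c *: a + b) :: v) = c *: expand (u ++ a :: v) + expand (u ++ b :: v).
Proof.
elim: u => [|x u IHu] /=; first exact: linearP.
rewrite -lin_ext_lin; apply: eq_lin_ext => w.
by rewrite IHu linearP.
Qed.

Section Extension.
Variables (W : lmodType k) (G : seq (seq L) -> p.-tuple mor -> W).

Fact wext_multilinear : multilinear_map (fun d : decor true T p =>
  lin_ext (fun ws => G ws d.2) (expand d.1)).
Proof.
move=> u v a b c s d d1 d2 dE d1E d2E.
by rewrite dE d1E d2E /= expand_lin linearP.
Qed.

Definition wext : {linear bar_mod true T p -> W} := bar_ext wext_multilinear.

Lemma wext_gen ws (s : p.-tuple mor) : is_chain (size ws) s ->
  wext (wgen ws s) = G ws s.
Proof.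
move=> sP; have dP : is_decor true (map word ws, s) by rewrite /is_decor /= size_map.
rewrite /wgen (tgenE (Decor dP)) [LHS]bar_extE /=.
by rewrite expand_words lin_extU.
Qed.
End Extension.

(** The prefix [ws0] holds the factors already reduced to words, so the induction proceeds from left
    to right. *)
Lemma tgen_expand ws0 (a : seq T) (s : p.-tuple mor) :
  tgen (map word ws0 ++ a) s = lin_ext (fun ws => wgen (ws0 ++ ws) s) (expand a).
Proof.
elim: a ws0 => [|x a IHa] ws0 /=; first by rewrite lin_extU /wgen map_cat.
have tg_lin : linear (fun y => tgen (map word ws0 ++ y :: a) s).
  by move=> c y z; exact: tgen_lin.
have ex_lin : linear (fun y => lin_ext (fun ws => wgen (ws0 ++ ws) s)
    (lin_ext (fun w : {fmonom L} => lin_ext (fun ws => << (w : seq L) :: ws >>) (expand a)) y)).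
  by move=> c y z; rewrite !linearP.
apply: (word_linP (f := mk_linear tg_lin) (g := mk_linear ex_lin)) => w /=.
rewrite lin_extU /= -cat_rcons -map_rcons IHa lin_ext_comp.
by apply: eq_lin_ext => ws /=; rewrite lin_extU cat_rcons.
Qed.

Lemma wgen_out ws (s : p.-tuple mor) : ~~ is_chain (size ws) s -> wgen ws s = 0.
Proof. by move=> nP; rewrite /wgen /tgen insubF // /is_decor /= size_map; apply/negbTE. Qed.

Lemma wgen_linP (W : lmodType k) (f g : {linear bar_mod true T p -> W}) :
  (forall ws (s : p.-tuple mor), is_chain (size ws) s -> f (wgen ws s) = g (wgen ws s)) ->
  f =1 g.
Proof.
move=> fg; apply: bar_linP => d.
rewrite -tgenE (tgen_expand [::] d.1 d.2) !lin_ext_comp.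
apply: eq_lin_ext => ws; have [sP|nP] := boolP (is_chain (size ws) d.2); first exact: fg.
by rewrite wgen_out // !raddf0.
Qed.
End Level.

Lemma bar_act_wgen p q (th : dmap q p) ws (s : p.-tuple mor) : is_chain (size ws) s ->
  bar_act (const_salg T) true th (wgen ws s) =
  wgen (subst_words (arrow (size ws) s 0 (dnat th 0)) ws)
       (Tuple (size_chain_pull (size ws) s (dnat th) q)).
Proof.
move=> sP; have dP : is_decor true (map word ws, s) by rewrite /is_decor /= size_map.
rewrite /wgen (tgenE (Decor dP)) bar_act_gen -tgenE /= map_id Bsym_words ?size_map.
  congr tgen; exact: val_inj.
by have := is_mor_arrow sP (leq0n (dnat th 0)); rewrite vertex0.
Qed.

Lemma bar_mul_wgen p ws (s : p.-tuple mor) : is_chain (size ws) s ->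
  bar_mul T p (wgen ws s) = word (flatten ws).
Proof.
move=> sP; have dP : is_decor true (map word ws, s) by rewrite /is_decor /= size_map.
by rewrite /wgen (tgenE (Decor dP)) bar_mul_gen /= big_map word_prod.
Qed.

Hypothesis k_char0 : [pchar k]%R =i pred0.

(* The average over all ways of writing the tensor ws of words as the image of a
   tensor of letters under a morphism. *)
Definition sym_gen p (ws : seq (seq L)) (s : p.-tuple mor) : bar_mod true T p.+1 :=
  ((size (flatten ws))`!%:R)^-1 *:
  \sum_(t <- permutations (iota 0 (size (flatten ws))))
     wgen (arrange (letters ws) t) [tuple of pattern ws t :: s].

Definition sym_contract p := wext (@sym_gen p).

Lemma sym_contract_wgen p ws (s : p.-tuple mor) : is_chain (size ws) s ->
  sym_contract p (wgen ws s) = sym_gen ws s.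
Proof. exact: wext_gen. Qed.

(** Characteristic 0 enters here, through the invertibility of m!. *)
Lemma sum_permutations_const (W : lmodType k) m (x : W) :
  (m`!%:R)^-1 *: \sum_(t <- permutations (iota 0 m)) x = x.
Proof.
have mP : m`!%:R != 0 :> k by move/pcharf0P: k_char0 => ->; rewrite -lt0n fact_gt0.
rewrite big_const_seq count_predT size_permutations ?iota_uniq // size_iota.
by rewrite iter_addr_0 -scaler_nat scalerA mulVf // scale1r.
Qed.

Lemma is_chain_sym (ws : seq (seq L)) t p (s : p.-tuple mor) :
  is_chain (size ws) s -> perm_eq t (iota 0 (size (flatten ws))) ->
  is_chain (size (arrange (letters ws) t)) [tuple of pattern ws t :: s].
Proof.
move=> sP tP; rewrite /= size_map size_iota size_letters is_mor_pattern //=.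
by rewrite size_pattern.
Qed.

Lemma linear_sym_gen (W : lmodType k) p (f : {linear bar_mod true T p.+1 -> W}) ws s :
  f (sym_gen ws s) = ((size (flatten ws))`!%:R)^-1 *:
  \sum_(t <- permutations (iota 0 (size (flatten ws))))
     f (wgen (arrange (letters ws) t) [tuple of pattern ws t :: s]).
Proof. by rewrite /sym_gen linearZ /= raddf_sum. Qed.

(** [d_0] applies the pattern to the rearranged letters, so every summand returns the original
    simplex and the average is that simplex. *)
Lemma sym_contract_face0 p (x : bar_mod true T p) :
  bar_act (const_salg T) true (fc p 0) (sym_contract p x) = x.
Proof.
apply: (wgen_linP (f := bar_act (const_salg T) true (fc p 0) \o sym_contract p)
  (g := idfun)) => ws s sP.
transitivity (bar_act (const_salg T) true (fc p 0) (sym_contract p (wgen ws s))) => //.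
transitivity (wgen ws s) => //; rewrite sym_contract_wgen // /sym_gen.
rewrite -/(sym_gen ws s) linear_sym_gen.
rewrite -[RHS](sum_permutations_const (size (flatten ws))).
congr (_ *: _); apply: eq_big_seq => t; rewrite mem_permutations => tP.
have tsP := is_chain_sym sP tP.
rewrite bar_act_wgen // dnat_fc // arrow1 // subst_pattern //.
congr wgen; apply: val_inj; apply: (@eq_from_nth _ [::]); rewrite size_mkseq ?size_tuple //.
by move=> i lt_ip; rewrite nth_mkseq // !dnat_fc ?arrow1 ?size_tuple // ltnW.
Qed.

(** For a single ordering the letters of the image of [ws] would come out permuted; the average over
    all orderings absorbs this permutation. *)
Lemma sym_contract_dcone p q (th : dmap q p) (x : bar_mod true T p) :
  bar_act (const_salg T) true (dcone th) (sym_contract p x) =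
  sym_contract q (bar_act (const_salg T) true th x).
Proof.
apply: (wgen_linP (f := bar_act (const_salg T) true (dcone th) \o sym_contract p)
  (g := sym_contract q \o bar_act (const_salg T) true th)) => ws s sP.
transitivity (bar_act (const_salg T) true (dcone th) (sym_contract p (wgen ws s))) => //.
transitivity (sym_contract q (bar_act (const_salg T) true th (wgen ws s))) => //.
set g := arrow (size ws) s 0 (dnat th 0).
have gP : is_mor (size ws) g.
  by have := is_mor_arrow sP (leq0n (dnat th 0)); rewrite vertex0.
have s'P : is_chain (size (subst_words g ws)) (chain_pull (size ws) s (dnat th) q).
  rewrite size_map size_arrow //; apply: is_chain_pull => // *; exact: dnat_mono.
set s' := Tuple (size_chain_pull (size ws) s (dnat th) q).
rewrite (sym_contract_wgen sP) linear_sym_gen (bar_act_wgen th sP) -/s'.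
rewrite (@sym_contract_wgen q (subst_words g ws) s' s'P).
have sE := size_flatten_subst gP.
rewrite /sym_gen sE.
congr (_ *: _).
rewrite letters_subst // -{1 2}(size_letters ws).
(* The sum is reindexed by the permutation of the letters effected by [g]; afterwards the summands
   agree one by one. *)
rewrite (@sum_arrange _ _ (letters ws) _ (fun u t' => wgen u
  [tuple of pattern (subst_words g ws) t' :: s'])).
  rewrite size_letters; apply: eq_big_seq => t; rewrite mem_permutations => tP.
  have tsP := is_chain_sym sP tP.
  rewrite bar_act_wgen // dnat_dcone0 arrow_id vertex0 subst_words_id.
  rewrite pattern_subst ?(perm_size tP) ?size_iota //.
  congr wgen; apply: val_inj; apply: (@eq_from_nth _ [::]); rewrite ?size_mkseq ?size_tuple //.
  (* Entry 0 is the arrow from the adjoined vertex to the vertex [th 0], that is, the pattern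
     followed by [g]. *)
  move=> [|i] lt_i; rewrite nth_mkseq // ?dnat_dcone0 !dnat_dconeS //; last exact: ltnW.
    move: tsP; rewrite /arrange size_mkseq => tsP.
    rewrite -(@arrow_comp _ _ 0 1 _ tsP) // (arrow1 tsP) //= /g.
    by rewrite /arrow /vertex /= size_pattern.
  rewrite [RHS]/= nth_mkseq //.
  by rewrite /arrow /vertex /= size_pattern.
by rewrite size_letters; apply: is_mor_pattern_comp.
Qed.

Definition sym_word (w : seq L) : bar_mod true T 0 :=
  ((size w)`!%:R)^-1 *:
  \sum_(t <- permutations (iota 0 (size w))) wgen (arrange [seq [:: x] | x <- w] t) [tuple].

Lemma sym_word_perm w w' : perm_eq w w' -> sym_word w = sym_word w'.
Proof.
move=> ww'; have /(perm_iotaP [::])[r rP rE] := perm_map (fun x => [:: x]) ww'.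
rewrite /sym_word (perm_size ww'); congr (_ *: _).
rewrite rE -[size w'](size_map (fun x => [:: x])).
by rewrite (sum_arrange (fun u _ => wgen u [tuple]) rP).
Qed.

Definition sym_poly : {linear T -> bar_mod true T 0} :=
  lin_ext (fun w : {fmonom L} => sym_word w).

Lemma sym_poly_word w : sym_poly (word w) = sym_word w.
Proof. exact: lin_extU. Qed.

(** [d_1] forgets the pattern, and the averaged letters depend on [ws] only through its
    concatenation. With [sym_poly_comm] the result factors through the abelianization. *)
Lemma sym_contract_face1 (x : bar_mod true T 0) :
  bar_act (const_salg T) true (fc 0 1) (sym_contract 0 x) = sym_poly (bar_mul T 0 x).
Proof.
apply: (wgen_linP (f := bar_act (const_salg T) true (fc 0 1) \o sym_contract 0)
  (g := sym_poly \o bar_mul T 0)) => ws s sP.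
transitivity (bar_act (const_salg T) true (fc 0 1) (sym_contract 0 (wgen ws s))) => //.
transitivity (sym_poly (bar_mul T 0 (wgen ws s))) => //.
rewrite sym_contract_wgen // linear_sym_gen bar_mul_wgen // sym_poly_word /sym_word.
congr (_ *: _); apply: eq_big_seq => t; rewrite mem_permutations => tP.
rewrite bar_act_wgen ?is_chain_sym // dnat_fc // arrow_id vertex0 subst_words_id.
by congr wgen; exact: val_inj.
Qed.

Lemma sym_poly_comm (x : T) : x \in @comm_ideal k T -> sym_poly x = 0.
Proof.
apply: (@comm_ideal_ker k T _ sym_poly (fun y => exists w, y = word w)).
  apply: (@word_ind (fun y => y \in Defs.span _)) => [|c w z /asboolP zP]; apply/asboolP.
    exact: spanned0.
  by apply: spannedD => //; exists w.
move=> _ _ _ _ [u ->] [a ->] [b ->] [v ->]; rewrite -!word_cat !sym_poly_word.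
by apply: sym_word_perm; rewrite !perm_cat2r perm_cat2l perm_catC.
Qed.

Lemma sym_contract_face p i (x : bar_mod true T p.+1) : (i <= p.+1)%N ->
  bar_act (const_salg T) true (fc p.+1 i.+1) (sym_contract p.+1 x) =
  sym_contract p (bar_act (const_salg T) true (fc p i) x).
Proof. by move=> ip; rewrite -sym_contract_dcone dcone_fc. Qed.
End WordAlgebra.

(** * From the bar construction to the abelianization, for levelwise free algebras *)

Section BarMul.
Variable k : fieldType.

Lemma ab_pi_eq0 (A : alg k) (x : A) : ab_pi x = 0 <-> x \in @comm_ideal k A.
Proof. by rewrite -(raddf0 (@ab_pi k A)) [X in X <-> _]lpi_eq subr0. Qed.

(** A morphism of Delta S_+ permutes the factors of the total product, which is therefore simplicial
    only after [ab_pi]. *)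
Lemma bar_mul_act (X : salg k) p q (th : dmap q p) (x : bar_mod true (X p) p) :
  ab_pi (bar_mul (X q) q (bar_act X true th x)) =
  ab_act X th (ab_pi (bar_mul (X p) p x)).
Proof.
apply: (@bar_linP _ _ _ _ _ (@ab_pi k (X q) \o (bar_mul (X q) q \o bar_act X true th))
  (ab_act X th \o (@ab_pi k (X p) \o bar_mul (X p) p))) => d.
transitivity (ab_pi (bar_mul (X q) q (bar_act X true th (bar_gen d)))) => //.
transitivity (ab_act X th (ab_pi (bar_mul (X p) p (bar_gen d)))) => //.
rewrite bar_act_gen !bar_mul_gen ab_actE /=.
rewrite (big_morph _ (@salg_actM k X q p th) (@salg_act1 k X q p th)).
set f := arrow _ _ _ _; set b := map _ _.
have df : is_mor (size d.1) f.
  have /andP[_ dP] := decorP d.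
  by have := is_mor_arrow dP (leq0n (dnat th 0)); rewrite vertex0.
have -> : \prod_(a <- Bsym f b) a = \prod_(a <- [seq b`_i | i <- flatten f]) a.
  by rewrite /Bsym !big_map big_flatten.
rewrite -(big_map (salg_act X th) predT id); apply: ab_pi_perm.
rewrite -[X in perm_eq _ X](mkseq_nth 0) size_map /mkseq.
exact: perm_map.
Qed.

Lemma bar_mul_act_const (A : alg k) p q (th : dmap q p) (x : bar_mod true A p) :
  ab_pi (bar_mul A q (bar_act (const_salg A) true th x)) = ab_pi (bar_mul A p x).
Proof.
rewrite [LHS](@bar_mul_act (const_salg A)).
by have [a aE] := ab_piK (ab_pi (bar_mul A p x)); rewrite [RHS]aE [X in ab_act _ _ X]aE ab_actE.
Qed.

Lemma bar_mul_lin (A B : alg k) (f : {linear A -> B}) p (x : bar_mod true A p) :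
  f 1 = 1 -> {morph f : x y / x * y} ->
  bar_mul B p (bar_lin f true p x) = f (bar_mul A p x).
Proof.
move=> f1 fM.
apply: (@bar_linP _ _ _ _ _ (bar_mul B p \o bar_lin f true p) (f \o bar_mul A p)) => d.
transitivity (bar_mul B p (bar_lin f true p (bar_gen d))) => //.
transitivity (f (bar_mul A p (bar_gen d))) => //.
by rewrite bar_lin_gen !bar_mul_gen (big_morph f fM f1) big_map.
Qed.

Lemma comm_ideal_map (A B : alg k) (f : {linear A -> B}) :
  {morph f : x y / x * y} ->
  forall x, x \in @comm_ideal k A -> f x \in @comm_ideal k B.
Proof. by move=> fM x xI; apply/ab_pi_eq0; exact: (ab_map_ker fM xI). Qed.

Section BarMulSalg.
Variable X : salg k.

Definition bar_augt_fun p : {linear bar_alg (X p) p -> abelianization (X p)} :=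
  @ab_pi k (X p) \o bar_mul (X p) p.

Lemma bar_mul1 p : bar_mul (X p) p (1 : bar_alg (X p) p) = 1.
Proof. by rewrite bar_agen1 [LHS]bar_mul_gen big_nil. Qed.

Lemma bar_mulM p : {morph (bar_mul (X p) p : bar_alg (X p) p -> X p) : x y / x * y}.
Proof.
apply: (@bar_alg_morphP _ _ _ (X p) (bar_mul (X p) p : {linear bar_alg (X p) p -> X p})).
move=> x y; rewrite bar_agenM.
transitivity (\prod_(a <- (decor_sum x y).1) a); first exact: bar_mul_gen.
by rewrite big_cat; congr (_ * _); apply/esym/bar_mul_gen.
Qed.

Definition bar_augt : samap (bar_salg X) (ab_salg X) :=
  @Samap k (bar_salg X) (ab_salg X) bar_augt_fun
    (fun p => etrans (congr1 (@ab_pi k (X p)) (bar_mul1 p)) (ab_pi1 (X p)))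
    (fun p x y => etrans (congr1 (@ab_pi k (X p)) (bar_mulM x y)) (@ab_piM k (X p) _ _))
    (fun q p th x => bar_mul_act th x).
End BarMulSalg.

Hypothesis k_char0 : [pchar k]%R =i pred0.

(** Taking all elements of [A] as letters avoids forming a type of generators: [A] is then a
    retract, with [phi] sending a generator to its letter and [psi] multiplying letters out. *)
Lemma free_retract (A : alg k) (S : A -> Prop) : free_on S ->
  exists (phi : {linear A -> word_alg k A}) (psi : {linear word_alg k A -> A}),
    [/\ phi 1 = 1, {morph phi : x y / x * y}, psi 1 = 1, {morph psi : x y / x * y} &
        forall x, psi (phi x) = x].
Proof.
move=> Sfree; have [[phi [phil phi1 phiM] phiS] _] :=
  Sfree (word_alg k A) (fun x => word k [:: x]).
pose psi : {linear word_alg k A -> A} := lin_ext (fun w : {fmonom A} => \prod_(a <- (w : seq A)) a).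
have psiw w : psi (word k w) = \prod_(a <- w) a by exact: lin_extU.
have psi1 : psi 1 = 1 by rewrite -[X in psi X]word_nil psiw big_nil.
have psiM : {morph psi : x y / x * y}.
  apply: (@alg_morph_span k (word_alg k A) A (fun y => exists w, y = word k w)).
    apply: (@word_ind k A (fun y => y \in Defs.span _)) => [|c w z /asboolP zP]; apply/asboolP.
      exact: spanned0.
    by apply: spannedD => //; exists w.
  by move=> _ _ [u ->] [v ->]; rewrite -word_cat !psiw big_cat.
exists (mk_linear phil), psi; split=> //.
have [_ uniq_hom] := Sfree A id.
apply: (uniq_hom (fun x => psi (phi x)) id) => [||x Sx].
- split=> [c x y||x y] /=; first by rewrite phil linearP.
  + by rewrite phi1.
  by rewrite phiM psiM.
- by split.
by rewrite phiS // psiw big_seq1.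
Qed.

(** Section and retraction are algebra maps, so they commute with the nerve operators and carry the
    contraction over to [A]. *)
Lemma free_contract (A : alg k) (S : A -> Prop) : free_on S ->
  exists h : forall p, {linear bar_mod true A p -> bar_mod true A p.+1},
  [/\ forall p x, bar_act (const_salg A) true (fc p 0) (h p x) = x,
      forall p i (x : bar_mod true A p.+1), (i <= p.+1)%N ->
        bar_act (const_salg A) true (fc p.+1 i.+1) (h p.+1 x) =
        h p (bar_act (const_salg A) true (fc p i) x) &
      forall x : bar_mod true A 0, ab_pi (bar_mul A 0 x) = 0 ->
        bar_act (const_salg A) true (fc 0 1) (h 0%N x) = 0].
Proof.
move=> /free_retract[phi [psi [phi1 phiM psi1 psiM psiK]]].
pose h p : {linear bar_mod true A p -> bar_mod true A p.+1} :=
  bar_lin psi true p.+1 \o (sym_contract k A p \o bar_lin phi true p).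
have hE p x : h p x = bar_lin psi true p.+1 (sym_contract k A p (bar_lin phi true p x)) by [].
have psiphi p x : bar_lin psi true p (bar_lin phi true p x) = x.
  by rewrite -(bar_lin_comp (h := idfun)) ?bar_lin_id // => a; rewrite psiK.
exists h; split=> [p x|p i x ip|x x0]; rewrite !hE.
- by rewrite -bar_lin_act // sym_contract_face0 // psiphi.
- have eA := bar_lin_act (fc p i) x phi1 phiM.
  rewrite eA -(sym_contract_face _ ip).
  by rewrite -(bar_lin_act (fc p.+1 i.+1) _ psi1 psiM).
rewrite -bar_lin_act // sym_contract_face1 // bar_mul_lin //.
rewrite sym_poly_comm ?raddf0 //; apply: comm_ideal_map => //.
exact/ab_pi_eq0.
Qed.

Fact bs_swap_comp (X : bsmod k) l m n l' m' n' (g : dmap m n) (f : dmap l m)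
    (g' : dmap m' n') (f' : dmap l' m') (x : X n' n) :
  bact X (dmap_comp g' f') (dmap_comp g f) x = bact X f' f (bact X g' g x).
Proof. exact: bact_comp. Qed.

(** The contraction now runs along the nerve, so this direction has to become the columns of
    [diag_acyclic]. *)
Definition bs_swap (X : bsmod k) : bsmod k :=
  @Bsmod k (fun p q => X q p) (fun m n p q f g => bact X g f)
    (fun p q => @bact_id k X q p) (@bs_swap_comp X).

Section Free.
Variable X : salg k.
Hypothesis X_free : forall n, exists S : X n -> Prop, free_on S.

Let S q p (x : bs_swap (bar2 X true) q p) : Prop := ab_pi (bar_mul (X q) p x) = 0.

Lemma augt_ker_closed : sub_closed S.
Proof.
split=> [p q|p q c x y|m n p q g h x]; rewrite /S; first by rewrite !raddf0.
  move=> x0 y0; transitivity (c *: ab_pi (bar_mul (X p) q x) + ab_pi (bar_mul (X p) q y)).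
    exact: (linearP (@ab_pi k (X p) \o bar_mul (X p) q)).
  by rewrite x0 y0 scaler0 addr0.
move=> /ab_pi_eq0 x0.
transitivity (ab_pi (bar_mul (X m) n (bar_act (const_salg (X m)) true h
  (bar_lin (salg_act X g) true q x)))) => //.
rewrite bar_mul_act_const; apply/ab_pi_eq0.
rewrite bar_mul_lin; [|exact: salg_act1|exact: salg_actM].
by apply: comm_ideal_map => //; exact: salg_actM.
Qed.

Lemma augt_ker_acyclic q : sub_acyclic (Y := bs_col (bs_swap (bar2 X true)) q) (@S q).
Proof.
have [B Bfree] := X_free q; have [h [h0 hS h1]] := free_contract Bfree.
move=> p x Sx x0; exists (h p x).
  by rewrite /S -(bar_mul_act_const (fc p 0)) h0.
refine (@bd_first_contract k (bs_col (bs_swap (bar2 X true)) q) h p x _ _ _ x0).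
- by move=> n y; rewrite [LHS]bar2_row h0.
- by move=> n j y jn; rewrite [LHS]bar2_row [X in _ = h n X]bar2_row hS.
by move=> p0; subst p; rewrite [LHS]bar2_row h1.
Qed.

Lemma bar_augt_weak_equiv : weak_equiv (bar_augt X).
Proof.
apply: weak_equiv_acyclic_ker => [n y|n x fx x0].
  have [a ->] := ab_piK y.
  (* The one-factor tensor [a] on the constant chain at [[0]] is a preimage. *)
  have dP : is_decor true (([:: a], nseq_tuple n (mor_id 1)) : seq (X n) * n.-tuple mor).
    by rewrite /is_decor /=; elim: (n).
  exists (bar_gen (Decor dP)); rewrite [LHS](congr1 (@ab_pi k (X n)) (bar_mul_gen _)).
  by rewrite /= big_seq1.
have [||y Sy yE] := @diag_acyclic k (bs_swap (bar2 X true)) S augt_ker_closed augt_ker_acyclic n x.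
- exact: fx.
- by rewrite -[RHS]x0 -bar2_diag_bd; exact: erefl.
exists y; first exact: Sy.
rewrite -[RHS]yE; apply/esym; exact: (@bar2_diag_bd k X true n.+1 y).
Qed.
End Free.
End BarMul.

(** * The comparison map *)

Section Assembly.
Variable k : fieldType.

Lemma graded_commutative_iso (G H : galg k) (f : forall n, G n -> H n) :
  galg_iso f -> graded_commutative H -> graded_commutative G.
Proof.
move=> [flin fbij f1 fM] [HDl HDr H1 HA HC].
have fMn n p q (x : G p) (y : G q) : n = (p + q)%N ->
    f n (galg_mul n x y) = galg_mul n (f p x) (f q y).
  by move=> ->; exact: fM.
have f_inj n := bij_inj (fbij n).
split.
- move=> p q y c x x'; apply: f_inj; rewrite fM flin HDl.
  by rewrite [RHS]flin !fM.
- move=> p q x c y y'; apply: f_inj; rewrite fM flin HDr.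
  by rewrite [RHS]flin !fM.
- by move=> n x; apply: f_inj; rewrite (fMn n 0%N n) // f1 H1.
- move=> p q r x y z; apply: f_inj.
  by rewrite !fMn ?addnA // HA.
move=> p q x y; apply: f_inj; rewrite fM HC -[X in X = _]addr0.
have fZ n c (u : G n) : f n (c *: u) = c *: f n u.
  have f0 : f n 0 = 0.
    by have := flin n (-1) 0 0; rewrite scaleN1r oppr0 addr0 scaleN1r addNr.
  by rewrite -[c *: u]addr0 flin f0 addr0.
by rewrite addr0 fZ (fMn _ q p) // addnC.
Qed.

Lemma bar_aug_incl (X : salg k) n (x : bar_smod X false n) :
  bar_aug X n x = bar_augt X n (bar_incl X n x).
Proof.
apply: (@bar_linP _ _ _ _ _ (bar_aug_fun X n) (bar_augt_fun X n \o bar_incl_fun X n)) => d.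
transitivity (bar_aug_fun X n (bar_gen d)) => //.
transitivity (ab_pi (bar_mul (X n) n (bar_incl_fun X n (bar_gen d)))) => //.
have -> : bar_incl_fun X n (bar_gen d) = bar_gen (decor_incl d) by exact: bar_extE.
by rewrite bar_mul_gen [LHS]bar_extE.
Qed.

Section BarSamap.
Variables (X Y : salg k) (f : samap X Y).

Lemma bar_map_incl n (x : bar_smod X false n) :
  bar_incl Y n (bar_map f false n x) = bar_map f true n (bar_incl X n x).
Proof.
apply: (@bar_linP _ _ _ _ _ (bar_incl_fun Y n \o bar_map_fun f false n)
  (bar_map_fun f true n \o bar_incl_fun X n)) => d.
rewrite [LHS](congr1 _ (bar_extE _ d)) [LHS]bar_extE.
rewrite [RHS](congr1 _ (bar_extE _ d)) [RHS]bar_extE.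
by congr bar_gen; apply: val_inj.
Qed.

Fact bar_samap1 n : (bar_map_fun f true n : bar_alg (X n) n -> bar_alg (Y n) n) 1 = 1.
Proof.
rewrite !bar_agen1 [LHS]bar_extE; congr bar_gen; exact: val_inj.
Qed.

Fact bar_samapM n :
  {morph (bar_map_fun f true n : bar_alg (X n) n -> bar_alg (Y n) n) : x y / x * y}.
Proof.
apply: (@bar_alg_morphP _ _ _ (bar_alg (Y n) n)
  (bar_map_fun f true n : {linear bar_alg (X n) n -> bar_alg (Y n) n})) => x y.
rewrite bar_agenM.
transitivity (bar_agen (decor_sum (decor_map f x) (decor_map f y))).
  rewrite [LHS]bar_extE; congr bar_gen; apply: val_inj.
  by rewrite /= map_cat.
by rewrite -bar_agenM; congr (_ * _); apply/esym/bar_extE.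
Qed.

Definition bar_samap : samap (bar_salg X) (bar_salg Y) :=
  @Samap k (bar_salg X) (bar_salg Y) (bar_map_fun f true)
    bar_samap1 bar_samapM (@bar_map_nat k X Y f true).
End BarSamap.

Lemma bijective_preimage_comp (U V W : lmodType k) (g : U -> V) (h : U -> W) :
  bijective g -> bijective h -> bijective (fun y => h (Defs.preimage g y)).
Proof.
move=> gb hb; have [g' gK g'K] := gb.
apply: (eq_bij (bij_comp hb (_ : bijective g'))) => [|y /=].
  by exists g.
by rewrite (@preimage_eq _ _ _ _ (g' y)).
Qed.

Section Transport.
Variables (Z Z' : smod k) (Y Y' W : salg k).
Variables (i : smap Z Y) (i' : smap Z' Y') (phi : smap Z Z').
Variables (Phi : samap Y Y') (a : samap Y W) (b : smap Z W).
Hypotheses (iW : weak_equiv i) (i'W : weak_equiv i') (phiW : weak_equiv phi).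
Hypothesis aW : weak_equiv a.
Hypothesis square : forall n x, i' n (phi n x) = Phi n (i n x).
Hypothesis triangle : forall n x, b n x = a n (i n x).

Local Notation incl n := (@hmap k Z' Y' i' n).

(** [HS A] is an instance of this up to conversion, with [i'] the inclusion [bar_incl] for the
    constant algebra. *)
Definition transport_galg : galg k :=
  @Galg k (homology Z') (Defs.preimage (incl 0%N) (galg_one (homotopy_galg Y')))
    (fun p q n x y => Defs.preimage (incl n)
      (@galg_mul k (homotopy_galg Y') p q n (incl p x) (incl q y))).

(** Every class of [Z'] is [phi] of a class of [Z], whose image in [Y] can be multiplied. The square
    carries such products to [Y'] and the triangle carries them to [W], as [Phi] and [a] are algebra
    maps. *)
Lemma transport_iso : galg_iso (G := transport_galg) (H := homotopy_galg W)
  (fun n x => @hmap k Z W b n (Defs.preimage (@hmap k Z Z' phi n) x)).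
Proof.
have bW : weak_equiv b by exact: (@weak_equiv_comp k Z Y W i a b triangle iW aW).
have bE n (x : homology Z n) : @hmap k Z W b n x = @hmap k Y W a n (@hmap k Z Y i n x).
  exact: (@hmap_comp k Z Y W i a b n triangle).
have sqE n (x : homology Z n) : @hmap k Z' Y' i' n (@hmap k Z Z' phi n x) =
    @hmap k Y Y' Phi n (@hmap k Z Y i n x).
  pose h : smap Z Y' := @Smap k Z Y' (fun n => Phi n \o i n)
    (fun m n f x => etrans (congr1 (Phi m) (smap_nat i f x)) (samap_nat Phi f _)).
  rewrite -(@hmap_comp k Z Y Y' i Phi h) //.
  by rewrite -(@hmap_comp k Z Z' Y' phi i' h) // => m y; rewrite square.
split=> [n|n||p q x y].
- move=> c x y /=; rewrite (preimage_linear (phiW n) (@hmap_linear k Z Z' phi n)).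
  exact: hmap_linear.
- exact: bijective_preimage_comp (phiW n) (bW n).
- have [x xE] : exists x, @hmap k Z Y i 0 x = galg_one (homotopy_galg Y).
    by have [g _ gK] := iW 0; exists (g (galg_one (homotopy_galg Y))).
  rewrite (@preimage_eq k _ _ _ x) ?bE ?xE ?hmap_one //.
  by rewrite /=; apply/esym/preimage_eq => //; rewrite sqE xE hmap_one.
have [u uE] : exists u, @hmap k Z Z' phi p u = x by have [g _ gK] := phiW p; exists (g x).
have [v vE] : exists v, @hmap k Z Z' phi q v = y by have [g _ gK] := phiW q; exists (g y).
have [w wE] : exists w, @hmap k Z Y i (p + q) w =
    @galg_mul k (homotopy_galg Y) p q (p + q) (@hmap k Z Y i p u) (@hmap k Z Y i q v).
  by have [g _ gK] := iW (p + q)%N; eexists; exact: gK.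
rewrite (preimage_eq (phiW p) uE) (preimage_eq (phiW q) vE).
rewrite (@preimage_eq k _ _ _ w) ?bE ?wE ?hmap_mul //.
by apply/esym/preimage_eq => //; rewrite sqE wE hmap_mul -uE -vE !sqE.
Qed.
End Transport.

Lemma SR_iso (k_char0 : [pchar k]%R =i pred0) (A : alg k) (R : resolution A) :
  galg_iso (@SR k A R).
Proof.
have augtW : weak_equiv (bar_augt R).
  apply: (bar_augt_weak_equiv k_char0) => n.
  by have [S [Sfree _]] := res_semi_free R; exists (S n).
exact: (@transport_iso (bar_smod R false) (bar_smod (const_salg A) false)
  (bar_salg R) (bar_salg (const_salg A)) (ab_salg R)
  (bar_incl R) (bar_incl (const_salg A)) (bar_map (res_map R) false)
  (bar_samap (res_map R)) (bar_augt R) (bar_aug R)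
  (bar_incl_weak_equiv R) (bar_incl_weak_equiv (const_salg A))
  (bar_map_weak_equiv (@res_weak_equiv _ _ R) false) augtW
  (@bar_map_incl _ _ (res_map R)) (@bar_aug_incl R)).
Qed.

Lemma HR_graded_commutative (X : salg k) : graded_commutative (HR X).
Proof. by apply: homotopy_graded_commutative => n; exact: ab_mulC. Qed.
End Assembly.

Theorem theorem1p1 (k : fieldType) (k_char0 : [pchar k]%R =i pred0)
  (A : alg k) (R : resolution A) :
  [/\ graded_commutative (HS A),
      graded_commutative (HR R) &
      galg_iso (@SR k A R)].
Proof.
have SRiso := SR_iso k_char0 R; have HRcomm := HR_graded_commutative R.
exact: And3 (graded_commutative_iso SRiso HRcomm) HRcomm SRiso.
Qed.
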